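(* Let $X$ be a uniformly contractible manifold of finite asymptotic dimension. Then there is $n$ such that the Riemannian product $X\times\mathbb{R}^n$ is integrally hyperspherical.
   Context: Manifolds here are complete Riemannian manifolds without boundary, regarded as metric spaces with the Riemannian distance. A metric space $X$ is uniformly contractible if there is a function $S:[0,\infty)\to[0,\infty)$ such that for every $x\in X$ and every $r$ the ball $B_r(x)$ is contractible to a point inside the ball $B_{S(r)}(x)$. The asymptotic dimension $\operatorname{asdim}X$ of a metric space $X$ is the minimal number $n$ (if it exists) such that for every $d>0$ there is a uniformly bounded cover $\mathcal{U}$ of $X$ which is a union of $n+1$ $d$-disjoint families $\mathcal{U}=\mathcal{U}^0\cup\dots\cup\mathcal{U}^n$. A family $\mathcal{V}$ of sets is $d$-disjoint if $d(V,V')=\inf\{d(x,x')\mid x\in V,\ x'\in V'\}>d$ for all distinct $V,V'\in\mathcal{V}$. An $N$-dimensional manifold $Z$ is integrally hyperspherical if for every $\epsilon>0$ there is an $\epsilon$-contracting (i.e. $\epsilon$-Lipschitz) proper continuous map $f_\epsilon:Z\to S^N$ of degree one onto the standard unit $N$-sphere. Here a continuous map $f:Z\to S^N$ is called proper if only one point of $S^N$ has unbounded preimage; this is understood in the sense that $f$ extends continuously to the one-point compactification of $Z$ with $\infty$ mapped to that point, so that the degree is defined. *)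

(* Defs.v *)
From HB Require Import structures.
From mathcomp Require Import all_boot all_order all_algebra.
From mathcomp Require Import all_classical all_reals all_analysis.

Set Implicit Arguments.
Unset Strict Implicit.
Unset Printing Implicit Defensive.

Import Order.TTheory GRing.Theory Num.Theory.
Import numFieldNormedType.Exports.

Local Open Scope classical_set_scope.
Local Open Scope ring_scope.

(** * Metric notions

    The first two notions depend on a distance function only.  Contractibility
    also uses a topology, which for a Riemannian manifold is the one induced by
    the Riemannian distance. *)

Section Metric.
Context {R : realType}.

Definition dball (T : Type) (dist : T -> T -> R) (x : T) (r : R) : set T :=
  [set y | dist x y < r].

(** The inclusion of [A] in [B] is homotopic, inside [B], to a constant map. *)
Definition contractible_inside (T : topologicalType) (A B : set T) : Prop :=
  exists (p : T) (h : R -> T -> T),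
    [/\ {within `[0, 1]%classic `*` A, continuous (fun u => h u.1 u.2)},
        B p,
        forall t y, 0 <= t <= 1 -> A y -> B (h t y),
        forall y, A y -> h 0 y = y
      & forall y, A y -> h 1 y = p].

Definition uniformly_contractible (T : topologicalType)
    (dist : T -> T -> R) : Prop :=
  exists S : R -> R,
    (forall r, 0 <= r -> 0 <= S r) /\
    (forall x r, 0 <= r ->
       contractible_inside (dball dist x r) (dball dist x (S r))).

(** The infimum is taken in the extended reals, so that the distance to the
    empty set is [+oo]. *)
Definition d_disjoint (T : Type) (dist : T -> T -> R) (d : R)
    (F : set (set T)) : Prop :=
  forall V V', F V -> F V' -> V <> V' ->
    (d%:E < ereal_inf [set (dist x x')%:E | x in V & x' in V'])%E.

Definition asdim_le (T : Type) (dist : T -> T -> R) (n : nat) : Prop :=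
  forall d : R, 0 < d ->
    exists U : 'I_n.+1 -> set (set T),
      [/\ forall x, exists i, exists2 V, U i V & V x,
          exists D : R, forall i V, U i V ->
            forall x y, V x -> V y -> dist x y <= D
        & forall i, d_disjoint dist d (U i)].

Definition is_asdim (T : Type) (dist : T -> T -> R) (n : nat) : Prop :=
  asdim_le dist n /\ forall m, asdim_le dist m -> (n <= m)%N.

Definition finite_asdim (T : Type) (dist : T -> T -> R) : Prop :=
  exists n, is_asdim dist n.

Definition metric_complete (T : Type) (dist : T -> T -> R) : Prop :=
  forall u : nat -> T,
    (forall e : R, 0 < e -> exists K : nat,
       forall m n : nat, (K <= m)%N -> (K <= n)%N -> dist (u m) (u n) < e) ->
    exists l : T, forall e : R, 0 < e -> exists K : nat,
       forall n : nat, (K <= n)%N -> dist (u n) l < e.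

End Metric.

(** * Maps of class [C^k] on an open set [O]

    All directional derivatives exist, and are of class [C^(k-1)]. *)

Section Smooth.
Context {R : realType} {V W : normedModType R}.

Fixpoint Ck (k : nat) (O : set V) (f : V -> W) : Prop :=
  (forall x, O x -> {for x, continuous f}) /\
  (if k is k'.+1 then
     forall v, (forall x, O x -> derivable f x v) /\ Ck k' O (fun x => 'D_v f x)
   else True).

Definition smooth_on (O : set V) (f : V -> W) : Prop := forall k, Ck k O f.

End Smooth.

(** * Riemannian manifolds *)

(** A family of charts [phi i], defined on [dom i], with inverses [psi i]; the
    values of [phi i] off [dom i] and of [psi i] off the image of [phi i] are
    irrelevant.  [met i x] is the Gram matrix of the coordinate frame of
    the chart [i] at the point with coordinates [x]. *)
Record riem_data (R : realType) (N : nat) := RiemData {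
  carrier :> topologicalType;
  idx : Type;
  dom : idx -> set carrier;
  phi : idx -> carrier -> 'rV[R]_N;
  psi : idx -> 'rV[R]_N -> carrier;
  met : idx -> 'rV[R]_N -> 'M[R]_N
}.

Section Manifold.
Context {R : realType} {N : nat}.

(** [jacobian] acts on row vectors from the right, so that its [k]-th row is
    the [k]-th partial derivative. *)
Record is_riemannian (M : riem_data R N) : Prop := IsRiemannian {
  rm_nonempty : exists x : M, True;
  rm_connected : connected [set: M];
  rm_hausdorff : hausdorff_space M;
  rm_second_countable : @second_countable M;
  rm_dom_open : forall i : idx M, open (dom i);
  rm_dom_cover : forall x : M, exists i : idx M, dom i x;
  rm_img_open : forall i : idx M, open (phi i @` dom i);
  rm_phiK : forall (i : idx M) x, dom i x -> psi i (phi i x) = x;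
  rm_phi_cont : forall i : idx M, {within dom i, continuous (phi i)};
  rm_psi_cont : forall i : idx M, {within phi i @` dom i, continuous (psi i)};
  rm_transition : forall i j : idx M,
    smooth_on (phi i @` (dom i `&` dom j)) (phi j \o psi i);
  rm_met_smooth : forall i : idx M, smooth_on (phi i @` dom i) (met i);
  rm_met_sym : forall (i : idx M) x, dom i x ->
    (met i (phi i x))^T = met i (phi i x);
  rm_met_pos : forall (i : idx M) x (v : 'rV[R]_N), dom i x -> v != 0 ->
    0 < (v *m met i (phi i x) *m v^T) 0 0;
  rm_met_compat : forall (i j : idx M) x, dom i x -> dom j x ->
    let J := jacobian (phi j \o psi i) (phi i x) in
    met i (phi i x) = J *m met j (phi j x) *m J^T
}.

(** Curves are of class [C^1], but not necessarily regular; piecewise [C^1]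
    curves, reparametrized so as to stop at their corners, are of this form.
    They are defined on the whole real line and used on [[0, 1]]. *)
Definition C1_curve (M : riem_data R N) (c : R -> M) : Prop :=
  continuous c /\
  forall i : idx M, Ck 1 (c @^-1` dom i : set R^o) (phi i \o c : R^o -> 'rV[R]_N).

Definition is_speed (M : riem_data R N) (c : R -> M) (s : R -> R) : Prop :=
  forall (t : R) (i : idx M), dom i (c t) ->
    let v := derive1 (phi i \o c) t in
    s t = Num.sqrt ((v *m met i (phi i (c t)) *m v^T) 0 0).

Definition riem_dist (M : riem_data R N) (x y : M) : R :=
  inf [set l : R | exists (c : R -> M) (s : R -> R),
    [/\ C1_curve c, c 0 = x, c 1 = y, is_speed c s
      & l = \int[lebesgue_measure]_(t in `[0, 1]%classic) s t]].

Definition complete_riemannian (M : riem_data R N) : Prop :=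
  is_riemannian M /\ metric_complete (@riem_dist M).

End Manifold.

Section Product.
Context {R : realType}.

Definition euclidean (n : nat) : riem_data R n :=
  @RiemData R n 'rV[R]_n unit (fun _ => setT) (fun _ => id) (fun _ => id)
    (fun _ _ => 1%:M).

Definition riem_prod (m n : nat) (X : riem_data R m) (Y : riem_data R n) :
    riem_data R (m + n) :=
  @RiemData R (m + n) (X * Y)%type (idx X * idx Y)%type
    (fun i => dom i.1 `*` dom i.2)
    (fun i z => row_mx (phi i.1 z.1) (phi i.2 z.2))
    (fun i x => (psi i.1 (lsubmx x), psi i.2 (rsubmx x)))
    (fun i x => block_mx (met i.1 (lsubmx x)) 0 0 (met i.2 (rsubmx x))).

End Product.

(** * The unit sphere and the degree *)

Section Sphere.
Context {R : realType}.

(** The unit [N]-sphere in [R^(N+1)] and its Riemannian (angular) distance. *)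
Definition sphere (N : nat) : set 'rV[R]_N.+1 :=
  [set x | (x *m x^T) 0 0 = 1].

Definition sphere_dist (N : nat) (x y : 'rV[R]_N.+1) : R :=
  acos ((x *m y^T) 0 0).

Context {N : nat}.

(** [o i x] is the sign of the coordinate frame of the chart [i] at [x]. *)
Definition is_orientation (Z : riem_data R N) (o : idx Z -> Z -> int) : Prop :=
  [/\ forall i x, dom i x -> o i x = 1 \/ o i x = -1,
      forall i x, dom i x -> \forall y \near x, o i y = o i x
    & forall i j x, dom i x -> dom j x ->
        o i x = sgz (\det (jacobian (phi j \o psi i) (phi i x))) * o j x].

Definition smooth_map (Z : riem_data R N) (g : Z -> 'rV[R]_N.+1) : Prop :=
  forall i : idx Z, smooth_on (phi i @` dom i) (g \o psi i).

Definition extend (T U : Type) (f : T -> U) (p : U)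
    (w : one_point_compactification T) : U :=
  if w is Some x then f x else p.

(** The sign of the determinant of the differential of [g] at [x], from the
    coordinate frame of the chart [i] to positive frames of the tangent space
    of the sphere, oriented by its outward normal (put first); it is [0]
    exactly when [x] is a critical point of [g]. *)
Definition jac_sign (Z : riem_data R N) (g : Z -> 'rV[R]_N.+1)
    (i : idx Z) (x : Z) : int :=
  sgz (\det (col_mx (g x) (jacobian (g \o psi i) (phi i x)) : 'M[R]_N.+1)).

(** [f : Z -> S^N], extended by [p] at infinity, has degree [k]: it is homotopic,
    relatively to infinity, to a map [g] which is smooth on [Z] and has a
    regular value [y <> p], whose preimages (listed by [s]) have signs [e] of
    sum [k]. *)
Definition has_degree (Z : riem_data R N) (o : idx Z -> Z -> int)
    (f : Z -> 'rV[R]_N.+1) (p : 'rV[R]_N.+1) (k : int) : Prop :=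
  exists (g : Z -> 'rV[R]_N.+1)
         (H : R -> one_point_compactification Z -> 'rV[R]_N.+1)
         (y : 'rV[R]_N.+1) (s : seq Z) (e : Z -> int),
    [/\ [/\ {within `[0, 1]%classic `*` setT, continuous (fun u => H u.1 u.2)},
            forall t w, 0 <= t <= 1 -> sphere (H t w),
            H 0 = extend f p,
            H 1 = extend g p
          & forall t, 0 <= t <= 1 -> H t None = p],
        smooth_map g,
        [/\ sphere y, y <> p, uniq s & forall x, x \in s <-> g x = y],
        forall x i, x \in s -> dom i x ->
          jac_sign g i x <> 0 /\ e x = o i x * jac_sign g i x
      & \sum_(x <- s) e x = k].

Definition integrally_hyperspherical (Z : riem_data R N) : Prop :=
  exists2 o : idx Z -> Z -> int, is_orientation o &
    forall eps : R, 0 < eps ->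
      exists (f : Z -> 'rV[R]_N.+1) (p : 'rV[R]_N.+1),
        [/\ forall x, sphere (f x),
            sphere p,
            continuous (extend f p),
            forall x y, sphere_dist (f x) (f y) <= eps * riem_dist x y
          & has_degree o f p 1].

End Sphere.

(* Main.v *)
From HB Require Import structures.
Require Import Defs.
From mathcomp Require Import all_boot all_order all_algebra.
From mathcomp Require Import all_classical all_reals all_analysis.
From mathcomp Require Import ring lra.

Set Implicit Arguments.
Unset Strict Implicit.
Unset Printing Implicit Defensive.

Import Order.TTheory GRing.Theory Num.Theory.
Import numFieldNormedType.Exports.

Local Open Scope classical_set_scope.
Local Open Scope ring_scope.

(** A cover of [X] witnessing [asdim X <= n], with disjointness [4 l], yields maps
    [Theta x : R^(2n+2) -> R^(2n+2)], proper of degree one for every [x] and [4 / l]-Lipschitz in [x],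
    such that [v] alone determines the blocks of the cover near [x] as soon as [|Theta x v| < 1].
    Contracting these blocks one colour after the other, by uniform contractibility, moves [x] to a
    point [P x v] at bounded distance which there depends on [v] only.  Let [q] be the displacement
    from a point [x0] in a chart.  The pair [(q (P x (c v)), Theta x (c v))], together with a radial
    coordinate built from the distance to [x0], defines a map from [X * R^(2n+2)] to the sphere: its
    first part depends on [c v] only and can be replaced by a Lipschitz function of [c v] on the
    compact set that matters, hence the map contracts as much as desired when [l] is large and then
    [c] is small.  Running the contractions backwards replaces [P x v] by [x], straightening [Theta x]
    replaces it by a multiple of [v], and the resulting map is homotopic to the inverse
    stereographic projection of a chart around [(x0, 0)], which has degree one. *)

(** * Calculus in row vector spaces *)

(** The Euclidean factor is there because [X] cannot be rescaled. The displacement from [x0] has no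
    reason to vary slowly on [X], and uniform contractibility bounds how far the contractions move
    points but says nothing of their moduli of continuity. A Lipschitz function of [c *: v],
    however, becomes as flat as desired for small [c]; so every quantity of uncontrolled slope has
    to be turned into a function of [v] alone. What still depends on [x], namely [Theta] and the
    distance to [x0], has slope of order [1 / l], and here the asymptotic dimension enters: it
    allows arbitrarily large [l] with a fixed number of colours, hence a fixed Euclidean dimension,
    with two coordinates for each colour. The order of choices is forced: [eps], then [l], then the
    cover and the contractions, then the compact set of relevant [v], then the approximations on it
    with their Lipschitz constants, and [c] last. The data read off [v] make sense only where
    [Theta] is small; this is harmless because the map to the sphere is constantly the pole
    elsewhere. *)

Section Calculus.
Context {R : realType}.

Lemma derive_line (V W : normedModType R) (f : V -> W) (x v : V) (t : R) :
  (derivable f (x + t *: v) v -> derivable (fun s : R => f (x + s *: v)) t 1) /\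
  'D_1 (fun s : R => f (x + s *: v)) t = 'D_v f (x + t *: v).
Proof.
have E : (fun h : R => h^-1 *: (f (x + (h *: 1 + t) *: v) - f (x + t *: v))) =
         (fun h : R => h^-1 *: (f (h *: v + (x + t *: v)) - f (x + t *: v))).
  apply/funext => h; congr (_ *: (f _ - _)).
  by rewrite scalerDl -[h *: 1]/(h * 1) mulr1 addrCA.
by split; [rewrite /derivable /= E|rewrite /derive /= E].
Qed.

Lemma mean_value_bound (f : R -> R) (a b D e : R) : a <= b ->
  (forall t, a <= t <= b -> derivable f t 1) ->
  (forall t, a <= t <= b -> `|'D_1 f t - D| <= e) ->
  `|f b - f a - (b - a) * D| <= e * (b - a).
Proof.
move=> ab df fe.
have [] := @MVT_segment R f ('D_1 f) a b ab.
- move=> x; rewrite in_itv /= => /andP[ax xb].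
  by apply: DeriveDef => //; apply: df; rewrite !ltW.
- apply: derivable_within_continuous => x; rewrite in_itv /= => xab.
  exact: df.
move=> c; rewrite in_itv /= => cab ->.
rewrite [X in `|_ - X|]mulrC -mulrBl normrM (ger0_norm (_ : 0 <= b - a)) ?subr_ge0//.
by apply: ler_wpM2r; [rewrite subr_ge0|exact: fe].
Qed.

Lemma mean_value_bound_line (V : normedModType R) (f : V -> R) (x v : V) (a D e : R) :
  (forall t, `|t| <= `|a| -> derivable f (x + t *: v) v) ->
  (forall t, `|t| <= `|a| -> `|'D_v f (x + t *: v) - D| <= e) ->
  `|f (x + a *: v) - f x - a * D| <= e * `|a|.
Proof.
move=> df fe; have [a0|a0] := lerP 0 a.
- have := @mean_value_bound (fun s => f (x + s *: v)) 0 a D e a0.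
  rewrite scale0r addr0 subr0 (ger0_norm a0); apply => t /andP[t0 ta].
    by apply (derive_line f x v t).1; apply: df; rewrite !ger0_norm.
  by rewrite (derive_line f x v t).2; apply: fe; rewrite !ger0_norm.
- have := @mean_value_bound (fun s => f (x + s *: v)) a 0 D e (ltW a0).
  rewrite scale0r addr0 sub0r (ltr0_norm a0) -normrN => H.
  have -> : f (x + a *: v) - f x - a * D = - (f x - f (x + a *: v) - - a * D) by ring.
  apply: H => t /andP[t0 ta].
    by apply (derive_line f x v t).1; apply: df; rewrite (ler0_norm ta) (ltr0_norm a0) lerN2.
  by rewrite (derive_line f x v t).2; apply: fe; rewrite (ler0_norm ta) (ltr0_norm a0) lerN2.
Qed.

Lemma differentiable_littleo (V W : normedModType R) (f : V -> W) (x : V)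
    (df : {linear V -> W}) : continuous df ->
  (forall e, 0 < e -> \forall h \near 0, `|f (h + x) - f x - df h| <= e * `|h|) ->
  differentiable f x.
Proof.
move=> dfc fe.
have E : f \o shift x = cst (f x) + df +o_ 0 id.
  apply/eqaddoP => e e0; near=> h.
  rewrite /= !fctE opprD addrA /=.
  near: h; exact: fe.
apply/diff_locallyP.
by rewrite (diff_unique dfc E).
Unshelve. all: by end_near. Qed.

Lemma cvg_sum_fin (T : Type) (V : normedModType R) (F : set_system T) {FF : Filter F}
    (I : finType) (f : I -> T -> V) (a : I -> V) :
  (forall i, f i x @[x --> F] --> a i) ->
  (\sum_i f i x) @[x --> F] --> \sum_i a i.
Proof.
move=> fa; elim: (index_enum I) => [|i s IH].
  rewrite big_nil; under eq_cvg do rewrite big_nil; exact: cvg_cst.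
rewrite big_cons; under eq_cvg do rewrite big_cons; exact: cvgD.
Qed.

Lemma coord_continuous_rV n (i : 'I_n) : continuous (fun x : 'rV[R]_n => x 0 i).
Proof. exact: coord_continuous. Qed.

Lemma normr_coord n (x : 'rV[R]_n) i : `|x 0 i| <= `|x|.
Proof.
rewrite [leRHS]/Num.Def.normr/= mx_normrE.
exact: (le_bigmax _ (fun ij : 'I_1 * 'I_n => `|x ij.1 ij.2|) (0, i)).
Qed.

Lemma normr_rV_le n (x : 'rV[R]_n) (e : R) : 0 <= e ->
  (forall i, `|x 0 i| <= e) -> `|x| <= e.
Proof.
move=> e0 H; rewrite [leLHS]/Num.Def.normr/= mx_normrE.
by apply/bigmax_le => // -[i j] _ /=; rewrite ord1.
Qed.

(** The increment is split into one step per coordinate, and each step is compared with the partial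
    derivative at [x] by the mean value theorem. *)
Lemma Ck1_differentiable_scalar n (O : set 'rV[R]_n) (f : 'rV[R]_n -> R) x :
  open O -> Ck 1 O f -> O x -> differentiable f x.
Proof.
move=> oO [_ Cf] Ox.
pose D j := 'D_(delta_mx 0 j) f x.
pose df0 (h : 'rV[R]_n) : R := \sum_j h 0 j * D j.
have df0l : linear df0.
  move=> a u v; rewrite /df0 scaler_sumr -big_split /=; apply: eq_bigr => j _.
  by rewrite !mxE mulrDl -mulrA.
pose dfL := GRing.isLinear.Build R 'rV[R]_n R *%R df0 df0l.
pose df : {linear 'rV[R]_n -> R} := HB.pack df0 dfL.
apply: (@differentiable_littleo _ _ _ _ df).
  move=> h; apply: (@cvg_sum_fin _ _ (nbhs h) _ _ (fun j (y : 'rV[R]_n) => y 0 j * D j)) => j.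
  by apply: cvgM; [exact: coord_continuous_rV|exact: cvg_cst].
move=> e e0.
(* Each of the [n] coordinate steps will cost [e']; [n.+1] avoids a division by zero. *)
pose e' := e / n.+1%:R.
have e'0 : 0 < e' by rewrite divr_gt0.
have H : \forall y \near x, O y /\ forall j, `|'D_(delta_mx 0 j) f y - D j| <= e'.
  near=> y; split; first by near: y; exact: open_nbhs_nbhs.
  move=> j; move: j; near: y; apply: filter_forall => j.
  have [_ [cD _]] := Cf (delta_mx 0 j).
  have /cvgrPdist_le/(_ _ e'0) := cD x Ox.
  by apply: filterS => y; rewrite distrC.
have [d /= d0 Hd] := (iffLR (nbhs_ballP _ _) H).
have H0 : \forall h \near (0 : 'rV[R]_n), `|h| < d.
  by apply/nbhs_ballP; exists d => //= y; rewrite -ball_normE /= sub0r normrN.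
near=> h.
have hd : `|h| < d by near: h; exact: H0.
(* The truncations of [h] to its first [k] coordinates: consecutive ones differ along one axis
   only. *)
pose hk k : 'rV[R]_n := \row_j if (j < k)%N then h 0 j else 0.
have hkn k : `|hk k| <= `|h|.
  apply: normr_rV_le => // i; rewrite mxE; case: ifP => _.
    exact: normr_coord.
  by rewrite normr0.
have main k : (k <= n)%N ->
    `|f (hk k + x) - f x - \sum_(j < n | (j < k)%N) h 0 j * D j| <= e' * k%:R * `|h|.
  elim: k => [_|k IH kn].
    rewrite (_ : hk 0%N = 0); last by apply/rowP => j; rewrite !mxE.
    by rewrite add0r subrr sub0r big_pred0_eq oppr0 normr0 mulr0 mul0r.
  pose jk := Ordinal kn.
  have hkS : hk k.+1 + x = (hk k + x) + h 0 jk *: delta_mx 0 jk.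
    rewrite addrAC; congr (_ + _); apply/rowP => j; rewrite !mxE eqxx /=.
    rewrite ltnS leq_eqVlt; case: (eqVneq j jk) => [->|njk] /=.
      by rewrite eqxx ltnn /= add0r mulr1.
    have /negbTE -> : (j != k :> nat) by apply: contra njk => /eqP jk'; apply/eqP/val_inj.
    by rewrite mulr0 addr0.
  rewrite (bigD1 jk) /= ?ltnSn//.
  rewrite (_ : \sum_(i < n | (i < k.+1)%N && (i != jk)) h 0 i * D i =
               \sum_(j < n | (j < k)%N) h 0 j * D j); last first.
    apply: eq_bigl => j; rewrite ltnS leq_eqVlt.
    case: (eqVneq j jk) => [->|njk] /=; first by rewrite ltnn andbF.
    have /negbTE -> : (j != k :> nat) by apply: contra njk => /eqP jk'; apply/eqP/val_inj.
    by rewrite andbT.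
  have -> : f (hk k.+1 + x) - f x - (h 0 jk * D jk + \sum_(j < n | (j < k)%N) h 0 j * D j)
    = (f (hk k + x) - f x - \sum_(j < n | (j < k)%N) h 0 j * D j) +
      (f (hk k.+1 + x) - f (hk k + x) - h 0 jk * D jk) by ring.
  rewrite (le_trans (ler_normD _ _))// -natr1 mulrDr mulr1 mulrDl lerD//.
    exact: (IH (ltnW kn)).
  have inball t : `|t| <= `|h 0 jk| -> ball x d (hk k + x + t *: delta_mx 0 jk).
    move=> ht; rewrite -ball_normE /= addrAC opprD addrCA subrr addr0 normrN.
    apply: le_lt_trans hd.
    apply: normr_rV_le => // i; rewrite !mxE eqxx /=.
    case: (eqVneq i jk) => [->|_]; rewrite ?ltnn ?add0r ?mulr1 ?mulr0 ?addr0.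
      exact: le_trans ht (normr_coord _ _).
    case: ifP => _; [exact: normr_coord|by rewrite normr0].
  rewrite hkS.
  apply: le_trans (_ : e' * `|h 0 jk| <= _).
    apply: mean_value_bound_line => t ht.
      have [Oy _] := Hd _ (inball t ht).
      by have [+ _] := Cf (delta_mx 0 jk); apply.
    by have [_ ] := Hd _ (inball t ht); apply.
  by apply: ler_wpM2l; [exact: ltW|exact: normr_coord].
have := main n (leqnn n).
rewrite (_ : hk n = h); last by apply/rowP => j; rewrite mxE ltn_ord.
rewrite (_ : \sum_(j < n | (j < n)%N) h 0 j * D j = df h); last first.
  by apply: eq_bigl => j; rewrite ltn_ord.
move=> /le_trans; apply; apply: ler_wpM2r => //.
by rewrite /e' mulrAC ler_pdivrMr// ler_pM2l// ler_nat.
Unshelve. all: by end_near. Qed.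

End Calculus.

(** * Closure properties of maps of class [C^k] *)

Section CkAlgebra.
Context {R : realType}.
Implicit Types V W : normedModType R.

Lemma Ck_continuous V W k O (f : V -> W) x : Ck k O f -> O x -> {for x, continuous f}.
Proof. by case: k => [|k] [+ _]; apply. Qed.

Lemma Ck_derivable V W k O (f : V -> W) x v : Ck k.+1 O f -> O x -> derivable f x v.
Proof. by move=> [_ /(_ v)[+ _]]; apply. Qed.

Lemma CkS V W k O (f : V -> W) : Ck k.+1 O f -> Ck k O f.
Proof.
elim: k f => [|k IH] f [fc fd]; split => // v; have [? ?] := fd v; split => //.
exact: IH.
Qed.

Lemma Ck_subset V W k O O' (f : V -> W) : O' `<=` O -> Ck k O f -> Ck k O' f.
Proof.
move=> OO; elim: k f => [|k IH] f [fc fd].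
  by split=> // x /OO; exact: fc.
split=> [x /OO|v].
- exact: fc.
- by have [fv ?] := fd v; split => [x /OO|]; [exact: fv|exact: IH].
Qed.

Lemma Ck_ext V W k O (f g : V -> W) : open O -> (forall x, O x -> f x = g x) ->
  Ck k O f -> Ck k O g.
Proof.
move=> oO; have nO x : O x -> (forall f g : V -> W, (forall x, O x -> f x = g x) -> \near x, f x = g x).
  by move=> Ox f' g' fg; near=> y; apply: fg; near: y; exact: open_nbhs_nbhs.
elim: k f g => [|k IH] f g fg [fc fd].
  split=> // x Ox; suff : g y @[y --> x] --> g x by []; rewrite -(fg x)//.
  by apply: cvg_trans (fc _ Ox); apply: near_eq_cvg; exact: nO.
split=> [x Ox|v].
  suff : g y @[y --> x] --> g x by []; rewrite -(fg x)//.
  by apply: cvg_trans (fc _ Ox); apply: near_eq_cvg; exact: nO.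
have [fv fC] := fd v; split=> [x Ox|].
  by apply: near_eq_derivable (fv _ Ox); exact: nO.
by apply: IH fC => x Ox; apply: near_eq_derive; exact: nO.
Unshelve. all: by end_near. Qed.

Lemma Ck_cst V W k O (a : W) : Ck k O (fun _ : V => a).
Proof.
elim: k a => [|k IH] a.
  by split=> // x Ox; exact: cst_continuous.
split=> [x Ox|v]; first exact: cst_continuous.
split=> [x Ox|]; first exact: derivable_cst.
have -> : 'D_v (fun _ : V => a) = (fun _ => 0) by apply/funext => x; exact: derive_cst.
exact: IH.
Qed.

Lemma Ck_add V W k O (f g : V -> W) : open O -> Ck k O f -> Ck k O g ->
  Ck k O (fun x => f x + g x).
Proof.
move=> oO; elim: k f g => [|k IH] f g [fc fd] [gc gd].
  by split=> // x Ox; apply: continuousD; [exact: fc|exact: gc].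
split=> [x Ox|v]; first by apply: continuousD; [exact: fc|exact: gc].
have [fv fC] := fd v; have [gv gC] := gd v; split=> [x Ox|].
  by apply: derivableD; [exact: fv|exact: gv].
apply: Ck_ext (IH _ _ fC gC) => // x Ox.
by rewrite -deriveD //; [exact: fv|exact: gv].
Qed.

Lemma Ck_mul V k O (f g : V -> R) : open O -> Ck k O f -> Ck k O g ->
  Ck k O (fun x => f x * g x).
Proof.
move=> oO; elim: k f g => [|k IH] f g Cf Cg.
  split=> // x Ox; apply: continuousM; [exact: Ck_continuous Cf Ox|exact: Ck_continuous Cg Ox].
have [fc fd] := Cf; have [gc gd] := Cg.
split=> [x Ox|v]; first by apply: continuousM; [exact: fc|exact: gc].
have [fv fC] := fd v; have [gv gC] := gd v; split=> [x Ox|].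
  by apply: derivableM; [exact: fv|exact: gv].
apply: Ck_ext (Ck_add oO (IH _ _ (CkS Cf) gC) (IH _ _ (CkS Cg) fC)) => // x Ox.
by rewrite -[RHS]/('D_v (f * g) x) deriveM //; [exact: fv|exact: gv].
Qed.

Lemma Ck_sum V W k O (I : finType) (f : I -> V -> W) : open O ->
  (forall i, Ck k O (f i)) -> Ck k O (fun x => \sum_i f i x).
Proof.
move=> oO Cf; elim: (index_enum I) => [|i s IH].
  by apply: (@Ck_ext V W k O (fun _ => 0) _ oO _ (Ck_cst k O 0)) => x _; rewrite big_nil.
by apply: Ck_ext (Ck_add oO (Cf i) IH) => // x _; rewrite big_cons.
Qed.

Lemma Ck_opp V k O (f : V -> R) : open O -> Ck k O f -> Ck k O (fun x => - f x).
Proof.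
move=> oO Cf; have := @Ck_mul V k O (fun _ => -1) f oO (@Ck_cst V R k O (-1)) Cf.
by apply: Ck_ext => // x _; rewrite mulN1r.
Qed.

Lemma Ck_inv V k O (f : V -> R) : open O -> (forall x, O x -> f x != 0) ->
  Ck k O f -> Ck k O (fun x => (f x)^-1).
Proof.
move=> oO f0; elim: k => [|k IH] Cf.
  by split=> // x Ox; apply: continuousV; [exact: f0|exact: Ck_continuous Cf Ox].
have [fc fd] := Cf.
split=> [x Ox|v]; first by apply: continuousV; [exact: f0|exact: fc].
have [fv fC] := fd v; split=> [x Ox|].
  by apply: derivableV; [exact: f0|exact: fv].
have CI := IH (CkS Cf).
apply: Ck_ext (Ck_mul oO (Ck_opp oO (Ck_mul oO CI CI)) fC) => // x Ox.
by rewrite deriveV ?f0//; [rewrite /GRing.scale/= -exprVn expr2|exact: fv].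
Qed.

Lemma Ck_linear V W k O (f : {linear V -> W}) : open O -> continuous f -> Ck k O f.
Proof.
move=> oO cf.
have H v x : derivable f x v /\ 'D_v f x = f v.
  have df : differentiable f x by exact: linear_differentiable.
  by split; [exact: diff_derivable|rewrite deriveE// diff_lin].
case: k => [|k]; first by split=> // x _; exact: cf.
split=> [x _|v]; first exact: cf.
split=> [x _|]; first by have [] := H v x.
apply: (@Ck_ext V W k O (fun _ => f v) _ oO _ (Ck_cst k O (f v))) => x _.
by have [] := H v x.
Qed.

Lemma Ck_coord n k O (j : 'I_n) : open O -> Ck k O (fun x : 'rV[R]_n => x 0 j).
Proof.
move=> oO.
have lin : linear (fun x : 'rV[R]_n => x 0 j) by move=> a x y; rewrite !mxE.
pose fL := GRing.isLinear.Build R 'rV[R]_n R *%R _ lin.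
pose f : {linear 'rV[R]_n -> R} := HB.pack (fun x : 'rV[R]_n => x 0 j) fL.
exact: (@Ck_linear _ _ _ _ f oO (@coord_continuous_rV _ _ _)).
Qed.

Lemma continuous_rowP V n (f : V -> 'rV[R]_n) x :
  {for x, continuous f} <-> forall j, {for x, continuous (fun y => f y 0 j)}.
Proof.
split=> [fc j|fc].
  by apply: (@continuous_comp _ _ _ f (fun y : 'rV[R]_n => y 0 j) x fc); exact: coord_continuous_rV.
apply/cvgrPdist_le => e e0; near=> y.
apply: normr_rV_le; first exact: ltW.
move=> j; rewrite !mxE; move: j; near: y; apply: filter_forall => j.
by have /cvgrPdist_le := fc j; apply.
Unshelve. all: by end_near. Qed.

Lemma Ck_rowP V n k O (f : V -> 'rV[R]_n) : open O ->
  Ck k O f <-> forall j, Ck k O (fun x => f x 0 j).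
Proof.
move=> oO; elim: k f => [|k IH] f; split.
- by move=> [fc _] j; split=> // x Ox; have /continuous_rowP := fc x Ox; apply.
- by move=> H; split=> // x Ox; apply/continuous_rowP => j; have [+ _] := H j; apply.
- move=> [fc fd] j; split=> [x Ox|v].
    by have /continuous_rowP := fc x Ox; apply.
  have [fv fC] := fd v; split=> [x Ox|].
    by have /derivable_mxP := fv x Ox; apply.
  have := (IH _).1 fC j; apply: Ck_ext => // x Ox.
  by rewrite derive_mx ?mxE//; exact: fv.
- move=> H; split=> [x Ox|v].
    by apply/continuous_rowP => j; have [+ _] := H j; apply.
  have fv x : O x -> derivable f x v.
    by move=> Ox; apply/derivable_mxP => i j; rewrite ord1; exact: Ck_derivable (H j) Ox.
  split=> //; apply/IH => j; have [_ /(_ v)[_]] := H j; apply: Ck_ext => // x Ox.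
  by rewrite derive_mx ?mxE//; exact: fv.
Qed.

Lemma derive_chain V (U : normedModType R) W (f : V -> U) (g : U -> W) x v :
  derivable f x v -> differentiable g (f x) ->
  derivable (g \o f) x v /\ 'D_v (g \o f) x = 'd g (f x) ('D_v f x).
Proof.
move=> dfx dg.
have [fl1 fl2] := derive_line f x v 0; have [_ gf2] := derive_line (g \o f) x v 0.
rewrite scale0r addr0 in fl1 fl2 gf2.
pose l s := f (x + s *: v).
have dl : differentiable l 0 by apply/derivable1_diffP; exact: fl1.
have l0 : l 0 = f x by rewrite /l scale0r addr0.
have dgl : differentiable (g \o l) 0 by apply: differentiable_comp => //; rewrite l0.
split.
  apply/derivable1P; have : derivable (g \o l) 0 1 by exact: diff_derivable.
  have -> // : g \o l = (fun h => (g \o f) (h *: v + x)).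
  by apply/funext => s /=; rewrite /l addrC.
rewrite -gf2 -[LHS]/('D_1 (g \o l) 0) deriveE// diff_comp ?l0//=.
by rewrite -fl2 -[in RHS]/('D_1 l 0) deriveE.
Qed.

Lemma diff_partial n W (g : 'rV[R]_n -> W) y w : differentiable g y ->
  'd g y w = \sum_j w 0 j *: 'D_(delta_mx 0 j) g y.
Proof.
move=> dg; rewrite [in LHS](row_sum_delta w) linear_sum; apply: eq_bigr => j _.
by rewrite linearZ /= deriveE.
Qed.

(** Induction on [k]: by the chain rule the derivative is a sum of products of coordinates of
    ['D_v f] with partial derivatives of [g] composed with [f], to which the induction hypothesis
    applies. A scalar target keeps these products in [R]. *)
Lemma Ck_comp_scalar V n k O O' (f : V -> 'rV[R]_n) (g : 'rV[R]_n -> R) :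
  open O -> open O' -> (forall x, O x -> O' (f x)) ->
  Ck k O f -> Ck k O' g -> Ck k O (g \o f).
Proof.
move=> oO oO' OO'; elim: k g => [|k IH] g Cf Cg.
  split=> // x Ox; apply: continuous_comp; first exact: Ck_continuous Cf Ox.
  by apply: Ck_continuous Cg _; exact: OO'.
split=> [x Ox|v].
  apply: continuous_comp; first exact: Ck_continuous Cf Ox.
  by apply: Ck_continuous Cg _; exact: OO'.
have dg x : O x -> differentiable g (f x).
  move=> Ox; apply: (@Ck1_differentiable_scalar _ _ O'); [by []| |exact: OO'].
  by elim: (k) Cg => // k' IH' /CkS.
split=> [x Ox|].
  by have [] := derive_chain (Ck_derivable (v := v) Cf Ox) (dg _ Ox).
have CS : Ck k O (fun x => \sum_j 'D_v f x 0 j * 'D_(delta_mx 0 j) g (f x)).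
  apply: Ck_sum => // j; apply: Ck_mul => //.
    by have [_ /(_ v)[_ /(Ck_rowP _ _ oO)]] := Cf; apply.
  by apply: (IH ('D_(delta_mx 0 j) g)); [exact: CkS|have [_ /(_ (delta_mx 0 j))[]] := Cg].
apply: Ck_ext CS => // x Ox.
have [_ ->] := derive_chain (Ck_derivable (v := v) Cf Ox) (dg _ Ox).
by rewrite diff_partial//; exact: dg.
Qed.

Lemma Ck_comp V n m k O O' (f : V -> 'rV[R]_n) (g : 'rV[R]_n -> 'rV[R]_m) :
  open O -> open O' -> (forall x, O x -> O' (f x)) ->
  Ck k O f -> Ck k O' g -> Ck k O (g \o f).
Proof.
move=> oO oO' OO' Cf Cg; apply/Ck_rowP => // j.
exact: (Ck_comp_scalar oO oO' OO' Cf ((Ck_rowP _ _ oO').1 Cg j)).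
Qed.

(** The variant with [R] in the middle, which is not the type ['rV[R]_1]. *)
Lemma Ck_comp_real V k O O' (f : V -> R) (g : R -> R) : open O -> open O' ->
  (forall x, O x -> O' (f x)) -> Ck k O f -> Ck k O' g -> Ck k O (g \o f).
Proof.
move=> oO oO' OO'; elim: k g => [|k IH] g Cf Cg.
  split=> // x Ox; apply: continuous_comp; first exact: Ck_continuous Cf Ox.
  by apply: Ck_continuous Cg _; exact: OO'.
split=> [x Ox|v].
  apply: continuous_comp; first exact: Ck_continuous Cf Ox.
  by apply: Ck_continuous Cg _; exact: OO'.
have dg x : O x -> derivable g (f x) 1.
  by move=> Ox; apply: Ck_derivable Cg _; exact: OO'.
have dg' x : O x -> differentiable g (f x).
  by move=> Ox; apply/derivable1_diffP; exact: dg.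
split=> [x Ox|].
  by have [] := derive_chain (Ck_derivable (v := v) Cf Ox) (dg' _ Ox).
have [_ /(_ v)[_ Cf']] := Cf; have [_ /(_ 1)[_ Cg']] := Cg.
apply: Ck_ext (Ck_mul oO Cf' (IH _ (CkS Cf) Cg')) => // x Ox.
have [_ ->] := derive_chain (Ck_derivable (v := v) Cf Ox) (dg' _ Ox).
by rewrite deriv1E ?derive1E//; exact: dg.
Qed.

Lemma Ck_comp_curve V n k O O' (f : V -> R) (g : R -> 'rV[R]_n) : open O -> open O' ->
  (forall x, O x -> O' (f x)) -> Ck k O f -> Ck k O' g -> Ck k O (g \o f).
Proof.
move=> oO oO' OO' Cf Cg; apply/Ck_rowP => // j.
exact: (Ck_comp_real oO oO' OO' Cf ((Ck_rowP _ _ oO').1 Cg j)).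
Qed.

Lemma Ck_local V W k O (f : V -> W) :
  (forall x, O x -> exists U, [/\ open U, U x & Ck k U f]) -> Ck k O f.
Proof.
elim: k f => [|k IH] f H.
  by split=> // x /H[U [_ Ux [+ _]]]; apply.
split=> [x /H[U [_ Ux [+ _]]]|v]; first by apply.
split=> [x /H[U [_ Ux C]]|]; first exact: Ck_derivable C _.
by apply: IH => x /H[U [oU Ux [_ /(_ v)[_ C]]]]; exists U.
Qed.

Lemma Ck1_differentiable n m (O : set 'rV[R]_n) (f : 'rV[R]_n -> 'rV[R]_m) x :
  open O -> Ck 1 O f -> O x -> differentiable f x.
Proof.
move=> oO Cf Ox.
have E : f = (fun y => \sum_j f y 0 j *: delta_mx 0 j).
  by apply/funext => y; rewrite -row_sum_delta.
rewrite E; have -> : (fun y => \sum_j f y 0 j *: (delta_mx 0 j : 'rV[R]_m)) =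
   \sum_j (fun y => f y 0 j *: delta_mx 0 j).
  by apply/funext => y; rewrite fct_sumE.
apply: differentiable_sum => j; apply: differentiableZl.
by apply: (Ck1_differentiable_scalar oO) Ox; exact: (Ck_rowP _ _ oO).1.
Qed.

End CkAlgebra.

(** * A smooth bump function on the line *)

Section Flat.
Context {R : realType}.

(** All the functions [P(1/t) exp(-1/t)] are treated at once because this family is stable under
    derivation, which makes the smoothness of [exp(-1/t)] an induction. *)
Definition flat (P : {poly R}) (t : R) : R :=
  if 0 < t then P.[t^-1] * expR (- t^-1) else 0.

Lemma horner_bound (P : {poly R}) : exists2 C, 0 <= C &
  forall y, 1 <= y -> `|P.[y]| <= C * y ^+ size P.
Proof.
exists (\sum_(i < size P) `|P`_i|); first exact: sumr_ge0.
move=> y y1; rewrite horner_coef (le_trans (ler_norm_sum _ _ _))//.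
rewrite mulr_suml; apply: ler_sum => i _.
have y0 : 0 <= y by exact: le_trans y1.
rewrite normrM normrX (ger0_norm y0) ler_wpM2l//.
by rewrite ler_weXn2l// ltnW.
Qed.

(** The quadratic bound gives the derivative at [0]; it will also bound the slope of [bumpR]. *)
Lemma flat_bound P : exists2 C, 0 <= C & forall t, t <= 1 -> `|flat P t| <= C * t ^+ 2.
Proof.
have [C C0 HC] := horner_bound P.
(* With y = 1 / t, the exponential of y is at least y^k / k!, and the two powers in excess of the
   growth of [P] leave the factor t^2. *)
pose k := (size P).+2.
exists (C * k`!%:R); first by rewrite mulr_ge0.
move=> t t1; rewrite /flat; case: ltP => [t0|_]; last first.
  by rewrite normr0; apply: mulr_ge0; [rewrite mulr_ge0|rewrite sqr_ge0].
have y1 : 1 <= t^-1 by rewrite -[leLHS]invr1 lef_pV2 ?posrE.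
have y0 : 0 < t^-1 by rewrite invr_gt0.
rewrite normrM (ger0_norm (expR_ge0 _)).
apply: le_trans (ler_wpM2r (expR_ge0 _) (HC _ y1)) _.
rewrite -!mulrA; apply: ler_wpM2l => //.
rewrite expRN ler_pdivrMr ?expR_gt0//.
have H : t^-1 ^+ k / k`!%:R <= expR t^-1.
  by apply: le_trans (expR_ge1Dxn (size P).+1 (ltW y0)); rewrite lerDr.
have f0 : (k`!%:R : R) != 0 by rewrite pnatr_eq0 -lt0n fact_gt0.
have tn0 : t != 0 by rewrite gt_eqF.
apply: le_trans (_ : _ <= k`!%:R * t ^+ 2 * (t^-1 ^+ k / k`!%:R)) _; last first.
  by apply: ler_wpM2l => //; rewrite mulr_ge0// sqr_ge0.
rewrite /k -(addn2 (size P)) in f0 *; rewrite exprD.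
set f : R := _%:R in f0 *; set ys := _ ^+ size P.
have -> : f * t ^+ 2 * (ys * t^-1 ^+ 2 / f) = ys * (f / f) * (t / t) ^+ 2 by ring.
by rewrite !divff// expr1n !mulr1.
Qed.

Lemma flat_derive (P : {poly R}) (t : R) :
  is_derive t 1 (flat P) (flat ('X^2 * (P - P^`())) t).
Proof.
have [t0|t0|t0] := ltrgtP 0 t.
- have tn0 : t != 0 by rewrite gt_eqF.
  have inv_t : is_derive t 1 (fun y : R => y^-1) (- t ^- 2).
    apply: DeriveDef; first by apply: derivableV.
    by rewrite deriveV// derive_id [_ *: _]mulr1.
  have H1 : is_derive t 1 (horner P \o (fun y : R => y^-1)) (P^`().[t^-1] * - t ^- 2).
    exact: (@is_derive1_comp _ _ _ _ _ _ (is_derive_poly P t^-1)).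
  have H2 : is_derive t 1 (expR \o (- (fun y : R => y^-1))) (expR (- t^-1) * - - t ^- 2).
    exact: (@is_derive1_comp _ _ _ _ _ _ (is_derive_expR _)).
  have H3 := is_deriveM H1 H2.
  rewrite /flat t0; apply: near_eq_is_derive; last first.
    apply: (is_derive_eq H3).
    rewrite hornerM hornerXn hornerD hornerN /= /GRing.scale/= -exprVn; ring.
  near=> y; rewrite /flat ifT; last by near: y; exact: lt_nbhsr.
  by rewrite /= /GRing.mul/=.
- have H : is_derive t 1 (cst (0 : R)) 0 by exact: is_derive_cst.
  rewrite [X in is_derive _ _ _ X](_ : _ = 0); last by rewrite /flat ltNge (ltW t0).
  apply: near_eq_is_derive H; near=> y; rewrite /flat ifF//=.
  by apply/negbTE; rewrite -leNgt; apply: ltW; near: y; exact: lt_nbhsl.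
- subst t; rewrite [X in is_derive _ _ _ X](_ : _ = 0); last by rewrite /flat ltxx.
  have [C C0 HC] := flat_bound P.
  have cv : (fun h : R => h^-1 *: (flat P (h *: 1 + 0) - flat P 0)) @ 0^' --> (0 : R).
    apply/cvgrPdist_le => e e0; near=> h.
    have h0 : h != 0 by near: h; exact: nbhs_dnbhs_neq.
    rewrite sub0r normrN [h *: 1]mulr1 addr0 [X in _ - X]/flat ltxx subr0 normrM normfV.
    rewrite ler_pdivrMl ?normr_gt0//.
    have h1 : h <= 1.
      apply: le_trans (ler_norm _) _; apply: ltW; near: h; exact: dnbhs0_lt.
    apply: le_trans (HC _ h1) _; 
    rewrite -[X in C * X]real_normK ?num_real// expr2 mulrCA ler_wpM2l//.
    have hd : `|h| <= e / (C + 1).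
      by near: h; apply: dnbhs0_le; rewrite divr_gt0// ltr_wpDl.
    rewrite (le_trans (ler_wpM2l C0 hd))// mulrCA -[leRHS]mulr1 ler_wpM2l ?ltW//.
    by rewrite ltr_pdivrMr ?mul1r ?ltrDl// ltr_wpDl.
  apply: DeriveDef; first by apply/cvg_ex; exists 0.
  exact/cvg_lim.
Unshelve. all: by end_near. Qed.

Lemma flat_Ck k P : Ck k setT (flat P).
Proof.
have dflat Q t : differentiable (flat Q) t.
  by apply/derivable1_diffP; have [] := flat_derive Q t.
have cflat Q : continuous (flat Q).
  by move=> t; apply: differentiable_continuous; exact: dflat.
elim: k P => [|k IH] P; first by split=> // t _; exact: cflat.
split=> [t _|v]; first exact: cflat.
split=> [t _|]; first exact: diff_derivable.
apply: Ck_ext (Ck_mul openT (@Ck_cst _ R R k setT v) (IH ('X^2 * (P - P^`())))) => //.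
  exact: openT.
move=> t _; rewrite deriveE// deriv1E ?derive1E; last by have [] := flat_derive P t.
by have [_ ->] := flat_derive P t.
Qed.

Definition bumpR : R -> R := flat 1.

Lemma bumpR_Ck k : Ck k setT bumpR. Proof. exact: flat_Ck. Qed.

Lemma bumpR_gt0 t : 0 < t -> 0 < bumpR t.
Proof. by move=> t0; rewrite /bumpR /flat t0 hornerC mul1r expR_gt0. Qed.

Lemma bumpR_eq0 t : t <= 0 -> bumpR t = 0.
Proof. by move=> t0; rewrite /bumpR /flat ltNge t0. Qed.

Lemma bumpR_ge0 t : 0 <= bumpR t.
Proof. by have [/bumpR_gt0/ltW//|/bumpR_eq0->] := ltP 0 t. Qed.

End Flat.

(** * Charts and the Riemannian distance *)

Section Jacobian.
Context {R : realType}.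

Lemma row_jacobian n m (f : 'rV[R]_n -> 'rV[R]_m) x i :
  differentiable f x -> row i (jacobian f x) = 'D_(delta_mx 0 i) f x.
Proof. by move=> df; rewrite rowE deriveEjacobian. Qed.

Lemma jacobian_comp n m l (f : 'rV[R]_n -> 'rV[R]_m) (g : 'rV[R]_m -> 'rV[R]_l) x :
  differentiable f x -> differentiable g (f x) ->
  jacobian (g \o f) x = jacobian f x *m jacobian g (f x).
Proof.
move=> df dg; apply/row_matrixP => i; rewrite row_mul !rowE.
have dgf := differentiable_comp df dg.
rewrite -(deriveEjacobian _ dgf) -(deriveEjacobian _ df) -(deriveEjacobian _ dg).
by rewrite (deriveE _ dgf) (deriveE _ df) (deriveE _ dg) diff_comp.
Qed.

Lemma near_eq_differentiable (V W : normedModType R) (f g : V -> W) x :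
  (\near x, f x = g x) -> differentiable f x -> differentiable g x.
Proof.
move=> fg df; have fgx := nbhs_singleton fg.
have gE y : f y - f x = f y - g x by rewrite fgx.
apply: (@differentiable_littleo _ _ _ _ _ ('d f x : {linear V -> W})).
  exact: diff_continuous.
move=> e e0.
have /diff_locallyxP[_ E] := df.
have E' : (fun h => f (h + x)) = cst (f x) + 'd f x +o_ 0 id.
  by have /diff_locallyP[_] := df.
have /eqaddoP/(_ e e0) := E' => H.
have fg0 : \forall h \near 0, f (h + x) = g (h + x).
  move: fg; rewrite (near_shift 0) /= subr0.
  by apply: filterS => h; rewrite /= addrC.
near=> h.
rewrite -(near fg0 h)// -fgx.
have : `|((fun h => f (h + x)) - (cst (f x) + 'd f x)) h| <= e * `|h| by near: h.
by rewrite !fctE opprD addrA.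
Unshelve. all: by end_near. Qed.

Lemma near_eq_jacobian n m (f g : 'rV[R]_n -> 'rV[R]_m) x :
  (\near x, f x = g x) -> differentiable f x -> jacobian f x = jacobian g x.
Proof.
move=> fg df; have dg := near_eq_differentiable fg df.
apply/row_matrixP => i; apply: etrans (row_jacobian i df) _.
by apply: etrans (esym (row_jacobian i dg)); exact: near_eq_derive.
Qed.

Lemma jacobian_id n (x : 'rV[R]_n) : jacobian (@id 'rV[R]_n) x = 1%:M.
Proof.
have di : differentiable (@id 'rV[R]_n) x by apply: ex_diff.
apply/row_matrixP => i; rewrite (row_jacobian i di) derive_id rowE mulmx1.
by [].
Qed.

Definition qform n (G : 'M[R]_n) (w : 'rV[R]_n) : R := (w *m G *m w^T) 0 0.

Lemma qformE n (G : 'M[R]_n) w : qform G w = \sum_k (\sum_l w 0 l * G l k) * w 0 k.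
Proof.
rewrite /qform mxE; apply: eq_bigr => k _; rewrite !mxE.
by congr (_ * _); apply: eq_bigr => l _.
Qed.

Lemma qform_continuous (T : topologicalType) n (f : T -> 'M[R]_n) (g : T -> 'rV[R]_n) (a : T) :
  {for a, continuous f} -> {for a, continuous g} ->
  {for a, continuous (fun t => qform (f t) (g t))}.
Proof.
move=> cf cg.
have -> : (fun t => qform (f t) (g t)) =
    (fun t => \sum_k (\sum_l g t 0 l * f t l k) * g t 0 k).
  by apply/funext => t; rewrite qformE.
have cg' k : g t 0 k @[t --> a] --> g a 0 k.
  by apply: (@continuous_comp _ _ _ g (fun M : 'rV[R]_n => M 0 k) a cg); exact: coord_continuous.
suff : \sum_k (\sum_l g t 0 l * f t l k) * g t 0 k @[t --> a] -->
  \sum_k (\sum_l g a 0 l * f a l k) * g a 0 k by [].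
apply: cvg_sum_fin => k; apply: cvgM => //.
apply: cvg_sum_fin => l; apply: cvgM => //.
by apply: (@continuous_comp _ _ _ f (fun M : 'M[R]_n => M l k) a cf); exact: coord_continuous.
Qed.

Lemma qformZ n (G : 'M[R]_n) a w : qform G (a *: w) = a ^+ 2 * qform G w.
Proof.
by rewrite /qform -!scalemxAl linearZ /= -scalemxAr scalerA mxE -expr2.
Qed.

End Jacobian.

Section Charts.
Context {R : realType} {N : nat} (M : riem_data R N) (hM : is_riemannian M).
Implicit Types (i j k : idx M) (x : M).

Definition img i := phi i @` dom i.

Lemma imgP i x : dom i x -> img i (phi i x). Proof. by exists x. Qed.
Lemma img_open i : open (img i). Proof. exact: rm_img_open. Qed.
Lemma dom_open i : open (dom i). Proof. exact: rm_dom_open. Qed.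
Lemma phiK i x : dom i x -> psi i (phi i x) = x. Proof. exact: rm_phiK. Qed.
Lemma psi_dom i y : img i y -> dom i (psi i y).
Proof. by move=> [x dx <-]; rewrite phiK. Qed.
Lemma psiK i y : img i y -> phi i (psi i y) = y.
Proof. by move=> [x dx <-]; rewrite phiK. Qed.

Lemma dom_nbhs i x : dom i x -> nbhs x (dom i).
Proof. by move=> dx; apply: open_nbhs_nbhs; split=> //; exact: dom_open. Qed.

Lemma img_nbhs i y : img i y -> nbhs y (img i).
Proof. by move=> dx; apply: open_nbhs_nbhs; split=> //; exact: img_open. Qed.

Lemma phi_cont i x : dom i x -> {for x, continuous (phi i)}.
Proof.
move=> dx; have := @rm_phi_cont _ _ _ hM i.
by rewrite continuous_open_subspace; [apply; exact/mem_set|exact: dom_open].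
Qed.

Lemma psi_cont i y : img i y -> {for y, continuous (psi i)}.
Proof.
move=> dy; have := @rm_psi_cont _ _ _ hM i.
by rewrite continuous_open_subspace; [apply; exact/mem_set|exact: img_open].
Qed.

Definition overlap i j := phi i @` (dom i `&` dom j).

Lemma overlapP i j x : dom i x -> dom j x -> overlap i j (phi i x).
Proof. by move=> dx dy; exists x. Qed.

Lemma overlap_open i j : open (overlap i j).
Proof.
rewrite openE => _ [x [dx dy] <-]; near=> y.
have iy : img i y by near: y; exact/img_nbhs/imgP.
exists (psi i y); last exact: psiK.
split; first exact: psi_dom.
near: y; apply: (psi_cont (imgP dx)).
by rewrite phiK//; exact: dom_nbhs.
Unshelve. all: by end_near. Qed.

Definition trans i j : 'rV[R]_N -> 'rV[R]_N := phi j \o psi i.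

Lemma trans_smooth i j : smooth_on (overlap i j) (trans i j).
Proof. exact: rm_transition. Qed.

Lemma trans_diff i j x : dom i x -> dom j x -> differentiable (trans i j) (phi i x).
Proof.
move=> di dj; apply: Ck1_differentiable (overlapP di dj).
  exact: overlap_open.
exact: trans_smooth.
Qed.

Lemma trans_phi i j x : dom i x -> trans i j (phi i x) = phi j x.
Proof. by move=> dx; rewrite /trans /= phiK. Qed.

Definition Jac i j x := jacobian (trans i j) (phi i x).

Lemma near_phi i x (P : set M) : dom i x -> nbhs x P -> \forall y \near phi i x, P (psi i y).
Proof. by move=> dx Px; apply: (psi_cont (imgP dx)); rewrite phiK. Qed.

Lemma Jac_refl i x : dom i x -> Jac i i x = 1%:M.
Proof.
move=> dx; rewrite -(jacobian_id (phi i x)); apply: near_eq_jacobian; last exact: trans_diff.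
by near=> y; apply: psiK; near: y; exact/img_nbhs/imgP.
Unshelve. all: by end_near. Qed.

Lemma Jac_comp i j k x : dom i x -> dom j x -> dom k x -> Jac i k x = Jac i j x *m Jac j k x.
Proof.
move=> di dj dk.
have djk : differentiable (trans j k) (trans i j (phi i x)).
  by rewrite trans_phi//; exact: trans_diff.
have := jacobian_comp (trans_diff di dj) djk; rewrite (trans_phi j di) => E.
apply: etrans E; apply: near_eq_jacobian; last exact: trans_diff.
near=> y; rewrite /trans /= phiK//.
by near: y; apply: near_phi => //; exact: dom_nbhs.
Unshelve. all: by end_near. Qed.

Lemma Jac_unit i j x : dom i x -> dom j x -> Jac i j x \in unitmx.
Proof.
move=> di dj; have := Jac_comp di dj di; rewrite Jac_refl// => E.
exact: (mulmx1_unit (esym E)).1.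
Qed.

Definition Q i (y w : 'rV[R]_N) := qform (met i y) w.

Lemma Q_ge0 i y w : img i y -> 0 <= Q i y w.
Proof.
move=> [x dx <-]; have [->|w0] := eqVneq w 0.
  by rewrite /Q /qform !mul0mx mxE.
exact/ltW/(rm_met_pos hM).
Qed.

Lemma Q_gt0 i y w : img i y -> w != 0 -> 0 < Q i y w.
Proof. by move=> [x dx <-] w0; exact: (rm_met_pos hM). Qed.

Lemma Q_trans i j x w : dom i x -> dom j x -> Q i (phi i x) w = Q j (phi j x) (w *m Jac i j x).
Proof.
move=> di dj; rewrite /Q /qform (rm_met_compat hM di dj) /=.
by rewrite trmx_mul !mulmxA.
Qed.

Lemma met_cont i y : img i y -> {for y, continuous (met i)}.
Proof. by move=> iy; have [+ _] := rm_met_smooth hM i 0; apply. Qed.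

End Charts.

(** * A smooth step, and integrals through primitives *)

Section SmoothStep.
Context {R : realType}.

(** A smooth step from [0] to [1], constant outside [[0, 1]]. Curves reparametrized by it rest at
    both ends, so that concatenation preserves class [C^1]. *)
Definition eta (t : R) : R := bumpR t * (bumpR t + bumpR (1 - t))^-1.

Lemma eta_den_gt0 (t : R) : 0 < bumpR t + bumpR (1 - t).
Proof.
have [t0|t0] := ltP 0 t; first by rewrite ltr_pwDl ?bumpR_gt0// bumpR_ge0.
by rewrite ltr_wpDl ?bumpR_ge0// bumpR_gt0// subr_gt0 (le_lt_trans t0).
Qed.

Lemma Ck_id k : Ck k setT (fun t : R => t).
Proof. exact: (@Ck_linear _ _ _ k setT (idfun : {linear R -> R}) openT (fun x => cvg_id)). Qed.

Lemma onem_Ck k : Ck k setT (fun t : R => 1 - t).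
Proof.
apply: Ck_add; [exact: openT|exact: Ck_cst|].
by apply: Ck_opp; [exact: openT|exact: Ck_id].
Qed.

Lemma eta_Ck k : Ck k setT eta.
Proof.
have C1 : Ck k setT (fun t : R => bumpR (1 - t)).
  exact: (Ck_comp_real openT openT (fun _ _ => I) (onem_Ck k) (bumpR_Ck k)).
apply: Ck_mul; [exact: openT|exact: bumpR_Ck|].
apply: Ck_inv; [exact: openT|by move=> t _; rewrite gt_eqF ?eta_den_gt0|].
by apply: Ck_add; [exact: openT|exact: bumpR_Ck|].
Qed.

Lemma eta_le0 (t : R) : t <= 0 -> eta t = 0.
Proof. by move=> t0; rewrite /eta bumpR_eq0// mul0r. Qed.

Lemma eta_ge1 (t : R) : 1 <= t -> eta t = 1.
Proof.
move=> t1; rewrite /eta (bumpR_eq0 (_ : 1 - t <= 0)) ?subr_le0// addr0 divff//.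
by rewrite gt_eqF// bumpR_gt0// (lt_le_trans ltr01).
Qed.

Lemma eta_ge0 (t : R) : 0 <= eta t.
Proof. by rewrite mulr_ge0 ?bumpR_ge0// invr_ge0 ltW// eta_den_gt0. Qed.

Lemma eta_le1 (t : R) : eta t <= 1.
Proof. by rewrite ler_pdivrMr ?eta_den_gt0// mul1r lerDl bumpR_ge0. Qed.

Lemma eta_deriv (t : R) : exists d, [/\ is_derive t 1 eta d, 0 <= d
  & t <= 0 \/ 1 <= t -> d = 0].
Proof.
pose db := @flat R ('X^2 * (1 - 1^`())).
have dbE (u : R) : is_derive u 1 (@bumpR R) (db u) by exact: flat_derive.
have db0 u : 0 <= db u.
  rewrite /db /flat; case: ifP => // u0; rewrite derivC subr0 mulr1 hornerXn.
  by rewrite mulr_ge0 ?expR_ge0// sqr_ge0.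
have db00 u : u <= 0 -> db u = 0 by move=> u0; rewrite /db /flat ltNge u0.
have d1 : is_derive t 1 (fun u : R => 1 - u) (-1).
  have := is_deriveB (is_derive_cst (1 : R) t 1) (is_derive_id t (1 : R)).
  by rewrite sub0r.
have db1 : is_derive t 1 (fun u : R => bumpR (1 - u)) (- db (1 - t)).
  apply: (is_derive_eq (@is_derive1_comp _ _ (fun u : R => 1 - u) _ _ _ (dbE _) d1)).
  by rewrite mulrN1.
set D := bumpR t + bumpR (1 - t).
have D0 : D != 0 by rewrite gt_eqF ?eta_den_gt0.
exists ((db t * bumpR (1 - t) + bumpR t * db (1 - t)) / D ^+ 2); split.
- have dI := @is_deriveV R (fun u => bumpR u + bumpR (1 - u)) t _ 1 D0 (is_deriveD (dbE t) db1).
  apply: (is_derive_eq (is_deriveM (dbE t) dI)).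
  rewrite /GRing.scale/= -/D.
  have -> : bumpR (1 - t) = D - bumpR t by rewrite /D addrAC subrr add0r.
  by field.
- by rewrite divr_ge0 ?sqr_ge0// addr_ge0// mulr_ge0// bumpR_ge0.
- case=> [t0|t1]; first by rewrite (db00 t)// (bumpR_eq0 t0) !mul0r addr0 mul0r.
  by rewrite (bumpR_eq0 (_ : 1 - t <= 0)) ?subr_le0// (db00 (1 - t)) ?subr_le0// !mulr0 addr0 mul0r.
Qed.

(** Lengths are compared through this: an inequality between speeds becomes the monotonicity of a
    difference of primitives. *)
Lemma nondecreasing_from_derive (S s : R -> R) (a b : R) : a <= b ->
  (forall t : R, a <= t <= b -> is_derive t 1 S (s t)) ->
  (forall t, a <= t <= b -> 0 <= s t) -> S a <= S b.
Proof.
move=> ab dS s0.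
have [] := @MVT_segment R S s a b ab.
- by move=> x; rewrite in_itv /= => /andP[ax xb]; apply: dS; rewrite !ltW.
- by apply: derivable_within_continuous => x; rewrite in_itv /= => /dS[].
move=> c; rewrite in_itv /= => cab E.
by rewrite -subr_ge0 E mulr_ge0 ?subr_ge0// s0.
Qed.

Lemma integral_derive (S s : R -> R) : continuous s ->
  (forall t : R, 0 <= t <= 1 -> is_derive t 1 S (s t)) ->
  \int[lebesgue_measure]_(t in `[0, 1]%classic) s t = S 1 - S 0.
Proof.
move=> cs dS; rewrite /Rintegral (@continuous_FTC2 _ s S)//.
- exact: continuous_subspaceT.
- have cS t : 0 <= t <= 1 -> {for t, continuous S}.
    by move=> /dS[+ _] => /derivable1_diffP/differentiable_continuous.
  split.
  + by move=> x; rewrite in_itv /= => /andP[x0 x1]; have [] // := dS x; rewrite !ltW.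
  + by apply: cvg_at_right_filter; apply: cS; rewrite lexx ler01.
  + by apply: cvg_at_left_filter; apply: cS; rewrite lexx ler01.
- move=> x; rewrite in_itv /= => /andP[x0 x1]; rewrite derive1E.
  by have [|_ ->] := dS x; rewrite ?ltW.
Qed.

Lemma primitive_exists (s : R -> R) : continuous s ->
  exists S, forall t : R, 0 <= t <= 1 -> is_derive t 1 S (s t).
Proof.
(* Integrating from [-1], and up to [2] below, puts [[0, 1]] in the interior, so that the derivative
   at the two ends is two-sided. *)
move=> cs; exists (fun x => \int[lebesgue_measure]_(t in `[-1, x]%classic) s t) => t /andP[t0 t1].
have [] := @continuous_FTC1_closed R s (-1) t 2.
- by rewrite (le_lt_trans t1)// ltr1n.
- apply: continuous_compact_integrable; first exact: segment_compact.
  exact: continuous_subspaceT.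
- by rewrite (lt_le_trans _ t0)// ltrN10.
- exact: cs.
by move=> d1 d2; apply: DeriveDef; [exact: d1|rewrite -derive1E; exact: d2].
Qed.

End SmoothStep.

(** * Curves, their speed and their length *)

Section Curves.
Context {R : realType} {N : nat} (M : riem_data R N) (hM : is_riemannian M).
Implicit Types (i j k : idx M) (x y z : M) (c : R -> M).

Lemma preimage_dom_open c i : continuous c -> open (c @^-1` dom i).
Proof. by move=> cc; apply: open_comp => [t _|]; [exact: cc|exact: dom_open]. Qed.

Lemma curve_nbhs c i t : continuous c -> dom i (c t) -> \near t, dom i (c t).
Proof. by move=> cc di; apply: cc; exact: dom_nbhs. Qed.

Lemma derive_trans c i j t : continuous c -> derivable (phi i \o c) t 1 ->
  dom i (c t) -> dom j (c t) ->
  'D_1 (phi j \o c) t = 'D_1 (phi i \o c) t *m Jac i j (c t).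
Proof.
move=> cc dc di dj.
have dt : differentiable (trans i j) ((phi i \o c) t) by exact: trans_diff.
have [_ E] := derive_chain dc dt.
transitivity ('D_1 (trans i j \o (phi i \o c)) t).
  apply: near_eq_derive; near=> u; rewrite /= trans_phi//.
  by near: u; exact: curve_nbhs.
by rewrite E /Jac /jacobian mul_rV_lin1.
Unshelve. all: by end_near. Qed.

Lemma C1_derivable c i t : C1_curve c -> dom i (c t) -> derivable (phi i \o c) t 1.
Proof. by move=> [cc C] di; have [_ /(_ 1)[+ _]] := C i; apply. Qed.

Lemma C1_derive_cont c i t : C1_curve c -> dom i (c t) ->
  {for t, continuous ('D_1 (phi i \o c))}.
Proof. by move=> [cc C] di; have [_ /(_ 1)[_ [+ _]]] := C i; apply. Qed.

Lemma speedP c s : is_speed c s -> forall t i, dom i (c t) ->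
  s t = Num.sqrt (Q i (phi i (c t)) ('D_1 (phi i \o c) t)).
Proof. by move=> H t i di; rewrite (H t i di) derive1E. Qed.

(** By the compatibility of the metric with transition maps, one chart at each time is enough. *)
Lemma speed_in_chart c s : C1_curve c ->
  (forall t, exists2 i, dom i (c t) &
     s t = Num.sqrt (Q i (phi i (c t)) ('D_1 (phi i \o c) t))) -> is_speed c s.
Proof.
move=> Cc H t j dj; have [i di ->] := H t.
cbv zeta; rewrite derive1E; apply: (congr1 Num.sqrt).
apply: etrans (_ : Q j (phi j (c t)) ('D_1 (phi j \o c) t) = _); last by [].
rewrite (Q_trans hM _ di dj).
by rewrite -(derive_trans (proj1 Cc) (C1_derivable Cc di) di dj).
Qed.

Lemma speed_exists c : C1_curve c -> exists s, is_speed c s.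
Proof.
move=> Cc; have H t : exists i, dom i (c t) by exact: rm_dom_cover.
exists (fun t => let i := sval (cid (H t)) in
  Num.sqrt (Q i (phi i (c t)) ('D_1 (phi i \o c) t))).
apply: speed_in_chart => // t; exists (sval (cid (H t))) => //.
by case: cid.
Qed.

Lemma speed_ge0 c s t : is_speed c s -> 0 <= s t.
Proof.
move=> sp; have [i di] := rm_dom_cover hM (c t).
by rewrite (sp t i di); exact: sqrtr_ge0.
Qed.

Lemma speed_continuous c s : C1_curve c -> is_speed c s -> continuous s.
Proof.
move=> Cc sp t; have [cc _] := Cc; have [i di] := rm_dom_cover hM (c t).
have E : \near t, s t = Num.sqrt (Q i (phi i (c t)) ('D_1 (phi i \o c) t)).
  by near=> u; apply: speedP => //; near: u; exact: curve_nbhs.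
rewrite /continuous_at (nbhs_singleton E).
apply: cvg_trans.
  by apply: near_eq_cvg; apply: filterS E => u ->.
apply: (@continuous_comp _ _ _ (fun t => Q i (phi i (c t)) ('D_1 (phi i \o c) t)) Num.sqrt).
  have pc : {for t, continuous (fun u => phi i (c u))}.
    by apply: continuous_comp; [exact: cc|exact: phi_cont].
  apply: qform_continuous; last exact: C1_derive_cont.
  apply: (@continuous_comp _ _ _ (fun u => phi i (c u)) (met i)) => //.
  exact/met_cont/imgP.
exact: sqrt_continuous.
Unshelve. all: by end_near. Qed.

(** The length is recorded through a primitive [pr] of the speed, so that restriction, reversal and
    concatenation reduce to the chain rule instead of changes of variables in integrals. *)
Record curve x y (l : R) := Curve {
  cv : R -> M; sp : R -> R; pr : R -> R;
  cv_C1 : C1_curve cv; cv_speed : is_speed cv sp;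
  cv_pr : forall t : R, 0 <= t <= 1 -> is_derive t 1 pr (sp t);
  cv0 : cv 0 = x; cv1 : cv 1 = y; cv_len : pr 1 - pr 0 = l }.

Definition joined x y l := inhabited (curve x y l).

Lemma riem_distE x y : riem_dist x y = inf (joined x y).
Proof.
rewrite /riem_dist; congr inf; apply/seteqP; split=> l /=.
  move=> [c [s [Cc c0 c1 sp ->]]].
  have cs := speed_continuous Cc sp; have [S dS] := primitive_exists cs.
  by split; apply: (@Curve _ _ _ c s S) => //; rewrite (integral_derive cs).
move=> [[c s S Cc sp dS c0 c1 <-]]; exists c, s; split=> //.
by rewrite (integral_derive (speed_continuous Cc sp) dS).
Qed.

Lemma joined_ge0 x y l : joined x y l -> 0 <= l.
Proof.
move=> [[c s S Cc sp dS c0 c1 <-]]; rewrite subr_ge0.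
by apply: (nondecreasing_from_derive ler01 dS) => t _; exact: speed_ge0 sp.
Qed.

Lemma dist_le_joined x y l : joined x y l -> riem_dist x y <= l.
Proof.
by move=> a; rewrite riem_distE; apply: ge_inf => //; exists 0 => u; exact: joined_ge0.
Qed.

(** One curve is assumed because [inf] of the empty set is [0]; connectedness will supply it. *)
Lemma dist_lt_joined x y l a : joined x y l -> riem_dist x y < a -> exists2 l', joined x y l' & l' < a.
Proof.
rewrite riem_distE => al xy.
have hi : has_inf (joined x y) by split; [exists l|exists 0 => u; exact: joined_ge0].
have e0 : 0 < a - inf (joined x y) by rewrite subr_gt0.
by have [l' al'] := inf_adherent e0 hi; rewrite addrC subrK => ?; exists l'.
Qed.

Lemma dist_ge0 x y : 0 <= riem_dist x y.
Proof.
rewrite riem_distE; have [->|/set0P a0] := eqVneq (joined x y) set0; first by rewrite inf0.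
by apply: lb_le_inf => // u; exact: joined_ge0.
Qed.

(** [sg] stays in [[0, 1]] at all real times since the primitive [S] is known only there. The speed
    involves the absolute value of [dsg], the derivative of [S \o sg] does not: the sign is left to
    each use. *)
Lemma curve_reparam c s S (sg dsg : R -> R) : C1_curve c -> is_speed c s ->
  (forall t : R, 0 <= t <= 1 -> is_derive t 1 S (s t)) ->
  Ck 1 setT sg -> (forall t, 0 <= sg t <= 1) -> (forall t : R, is_derive t 1 sg (dsg t)) ->
  [/\ C1_curve (c \o sg), is_speed (c \o sg) (fun t => `|dsg t| * s (sg t))
    & forall t : R, is_derive t 1 (S \o sg) (dsg t * s (sg t))].
Proof.
move=> Cc sp dS Csg sg01 dsgE; have [cc C] := Cc.
have csg : continuous sg by move=> t; exact: Ck_continuous Csg I.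
have ccsg : continuous (c \o sg) by move=> t; apply: continuous_comp => //; [exact: csg|exact: cc].
have C1 : C1_curve (c \o sg).
  split; first exact: ccsg.
  move=> i; have oi := @preimage_dom_open c i cc.
  have oi' := @preimage_dom_open (c \o sg) i ccsg.
  apply: (@Ck_comp_curve R R N 1 _ _ sg (phi i \o c) oi' oi) => //.
  exact: Ck_subset Csg.
split=> //.
- apply: speed_in_chart => // t; have [i di] := rm_dom_cover hM (c (sg t)).
  exists i => //; rewrite (speedP sp di) /=.
  have dsgt : derivable sg t 1 by have [] := dsgE t.
  have dc : differentiable (phi i \o c) (sg t).
    by apply/derivable1_diffP; exact: C1_derivable.
  have [_ E] := derive_chain dsgt dc.
  have -> : 'D_1 (phi i \o (c \o sg)) t = dsg t *: 'D_1 (phi i \o c) (sg t).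
    rewrite -[LHS]/('D_1 ((phi i \o c) \o sg) t) E deriv1E ?derive1E; last exact: C1_derivable.
    by have [_ ->] := dsgE t.
  by rewrite /Q qformZ sqrtrM ?sqr_ge0// sqrtr_sqr.
- move=> t; apply: (is_derive_eq (@is_derive1_comp _ S sg _ _ _ (dS _ (sg01 t)) (dsgE t))).
  by rewrite mulrC.
Qed.

(** The arc from [a] to [b] is run through by [a + (b - a) * eta t], in either direction; going
    backwards changes the sign of the primitive. Symmetry of the distance is the case [a = 1],
    [b = 0]. *)
Lemma joined_sub x y l (u : curve x y l) a b : 0 <= a <= 1 -> 0 <= b <= 1 ->
  joined (cv u a) (cv u b) (if a <= b then pr u b - pr u a else pr u a - pr u b).
Proof.
move=> /andP[a0 a1] /andP[b0 b1].
pose sg t := a + (b - a) * eta t.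
have [deta detaP] : {d : R -> R | forall t : R, [/\ is_derive t 1 eta (d t), 0 <= d t
    & t <= 0 \/ 1 <= t -> d t = 0]}.
  by exists (fun t => sval (cid (eta_deriv t))) => t; case: cid.
have sgC : Ck 1 setT sg.
  apply: Ck_add; [exact: openT|exact: Ck_cst|].
  by apply: Ck_mul; [exact: openT|exact: Ck_cst|exact: eta_Ck].
have sg01 t : 0 <= sg t <= 1.
  have e0 := eta_ge0 t; have e1 := eta_le1 t; rewrite /sg; apply/andP; split; nra.
have dsg (t : R) : is_derive t 1 sg ((b - a) * deta t).
  have [dt _ _] := detaP t.
  have := is_deriveD (is_derive_cst a t 1) (is_deriveZ (b - a) dt).
  by rewrite add0r.
have [C1 sp1 dS1] := curve_reparam (cv_C1 u) (@cv_speed _ _ _ u) (@cv_pr _ _ _ u) sgC sg01 dsg.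
have sg0 : sg 0 = a by rewrite /sg eta_le0// mulr0 addr0.
have sg1 : sg 1 = b by rewrite /sg eta_ge1// mulr1 addrC subrK.
case: leP => ab.
  apply: (inhabits (@Curve _ _ _ _ _ (pr u \o sg) C1 sp1 _ _ _ _)) => //=; rewrite ?sg0 ?sg1//.
  move=> t _; apply: (is_derive_eq (dS1 t)).
  by rewrite ger0_norm// mulr_ge0 ?subr_ge0//; have [] := detaP t.
apply: (inhabits (@Curve _ _ _ _ _ (- (pr u \o sg)) C1 sp1 _ _ _ _)) => //=; rewrite ?sg0 ?sg1//.
  move=> t _; apply: (is_derive_eq (is_deriveN (dS1 t))).
  rewrite ler0_norm; first by rewrite mulNr.
  by apply: mulr_le0_ge0; [rewrite subr_le0 ltW|have [] := detaP t].
by rewrite !fctE /= sg0 sg1 opprK addrC.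
Qed.

Lemma joined_sym x y l : joined x y l -> joined y x l.
Proof.
move=> [u]; have := @joined_sub _ _ _ u 1 0.
rewrite !lexx ler01 /= ler10 (cv0 u) (cv1 u) (cv_len u); exact.
Qed.

Lemma joined_refl x : joined x x 0.
Proof.
have C1 : C1_curve (fun _ : R => x).
  split=> [t|i]; first exact: cst_continuous.
  exact: (@Ck_cst R R _ 1 _ (phi i x)).
have sp : is_speed (fun _ : R => x) (fun _ => 0).
  apply: speed_in_chart => // t; have [i di] := rm_dom_cover hM x.
  exists i => //=.
  have -> : 'D_1 (phi i \o (fun _ : R => x)) t = 0 by exact: derive_cst.
  by rewrite /Q /qform !mul0mx mxE sqrtr0.
by apply: (inhabits (@Curve x x 0 _ _ (cst 0) C1 sp _ _ _ _)) => //; rewrite subrr.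
Qed.

End Curves.

(** * Concatenation of curves *)

Section Triangle.
Context {R : realType} {N : nat} (M : riem_data R N) (hM : is_riemannian M).
Implicit Types (i j k : idx M) (x y z : M).

Lemma eta_affine (a : R) : exists d : R -> R,
  [/\ Ck 1 setT (fun t : R => eta (2 * t - a)),
      forall t : R, is_derive t 1 (fun t : R => eta (2 * t - a)) (d t),
      forall t, 0 <= d t
    & forall t, 2 * t - a <= 0 \/ 1 <= 2 * t - a -> d t = 0].
Proof.
have C1 : Ck 1 setT (fun t : R => 2 * t - a).
  apply: Ck_add; [exact: openT| |exact: Ck_cst].
  apply: (@Ck_mul _ _ 1 setT (fun _ : R => 2) (fun t : R => t) openT); first exact: Ck_cst.
  exact: Ck_id.
have d1 (t : R) : is_derive t 1 (fun t : R => 2 * t - a) 2.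
  have := is_deriveD (is_deriveZ 2 (is_derive_id t (1 : R))) (is_derive_cst (- a) t 1).
  by rewrite addr0 [2 *: 1]mulr1.
exists (fun t => sval (cid (eta_deriv (2 * t - a))) * 2); split.
- exact: (Ck_comp_real openT openT (fun _ _ => I) C1 (eta_Ck 1)).
- move=> t; case: cid => d [dd _ _] /=.
  exact: (@is_derive1_comp R eta (fun t : R => 2 * t - a) t d 2 dd (d1 t)).
- by move=> t; case: cid => d [/= _ d0 _]; rewrite mulr_ge0.
- by move=> t H; case: cid => d [/= _ _ ->//]; rewrite mul0r.
Qed.

Lemma joined_trans x y z l1 l2 : joined x y l1 -> joined y z l2 -> joined x z (l1 + l2).
Proof.
move=> [u] [v].
have eta01 (t : R) : 0 <= eta t <= 1 by rewrite eta_ge0 eta_le1.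
have [ds1 [Cs1 dds1 ds1_ge0 ds10]] := eta_affine 0.
have [ds2 [Cs2 dds2 ds2_ge0 ds20]] := eta_affine 1.
pose s1 t : R := eta (2 * t - 0); pose s2 t : R := eta (2 * t - 1).
have [C1 sp1 dS1] := curve_reparam hM (cv_C1 u) (@cv_speed _ _ _ _ _ _ u) (@cv_pr _ _ _ _ _ _ u)
  Cs1 (fun t => eta01 _) dds1.
have [C2 sp2 dS2] := curve_reparam hM (cv_C1 v) (@cv_speed _ _ _ _ _ _ v) (@cv_pr _ _ _ _ _ _ v)
  Cs2 (fun t => eta01 _) dds2.
set d1 := cv u \o _ in C1 sp1; set d2 := cv v \o _ in C2 sp2.
have d1y t : 2^-1 <= t -> d1 t = y.
  by move=> ht; rewrite /d1 /= subr0 eta_ge1 ?(cv1 u)//; lra.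
have d2y t : t <= 2^-1 -> d2 t = y.
  by move=> ht; rewrite /d2 /= eta_le0 ?(cv0 v)//; lra.
pose c t := if t < 2^-1 then d1 t else d2 t.
have cd1 t : t <= 2^-1 -> c t = d1 t.
  rewrite le_eqVlt => /orP[/eqP ->|]; rewrite /c; last by move=> ->.
  by rewrite ltxx d1y// d2y.
have cd2 t : 2^-1 <= t -> c t = d2 t by rewrite /c leNgt => /negbTE ->.
have [cc1 _] := C1; have [cc2 _] := C2.
have near1 (t : R) : t < 2^-1 -> \near t, d1 t = c t.
  by move=> ht; near=> w; rewrite cd1//; apply: ltW; near: w; exact: lt_nbhsl.
have near2 (t : R) : 2^-1 < t -> \near t, d2 t = c t.
  by move=> ht; near=> w; rewrite cd2//; apply: ltW; near: w; exact: lt_nbhsr.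
(* At every time one of the two curves rests at [y]. In a chart around [y] the concatenation is
   therefore a sum of [C^1] maps, which settles the junction without one-sided derivatives. *)
have sumE i t : phi i (d1 t) + phi i (d2 t) - phi i y = phi i (c t).
  have [ht|ht] := leP t 2^-1; first by rewrite (d2y t)// addrK cd1.
  by rewrite (d1y t) ?ltW// addrAC subrr add0r cd2// ltW.
have cc : continuous c.
  move=> t; have [ht|ht|ht] := ltgtP t 2^-1.
  - rewrite /continuous_at cd1 ?ltW//; apply: cvg_trans (cc1 t).
    exact/near_eq_cvg/near1.
  - rewrite /continuous_at cd2 ?ltW//; apply: cvg_trans (cc2 t).
    exact/near_eq_cvg/near2.
  - move=> A; rewrite /= => At.
    have c1 : nbhs t (d1 @^-1` A) by apply: cc1; rewrite -cd1// ht.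
    have c2 : nbhs t (d2 @^-1` A) by apply: cc2; rewrite -cd2// ht.
    suff : \forall w \near t, A (c w) by [].
    by near=> w; rewrite /c; case: ifP => _; near: w; [exact: c1|exact: c2].
pose OO i := (d1 @^-1` dom i) `&` (d2 @^-1` dom i).
have oO i : open (OO i).
  by apply: openI; exact: preimage_dom_open.
have Csum i : Ck 1 (OO i : set R) (phi i \o c).
  have [_ A1] := C1; have [_ A2] := C2.
  apply: (@Ck_ext _ _ _ 1 (OO i) (fun t : R => phi i (d1 t) + phi i (d2 t) - phi i y)).
  + exact: oO.
  + by move=> t _; exact: sumE.
  apply: Ck_add; [exact: oO| |exact: Ck_cst].
  apply: Ck_add; first exact: oO.
    by apply: Ck_subset (A1 i) => t [].
  by apply: Ck_subset (A2 i) => t [].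
have Cc : C1_curve c.
  split; first exact: cc.
  move=> i; apply: Ck_local => t /= dt; have [ht|ht|ht] := ltgtP t 2^-1.
  - exists ((d1 @^-1` dom i) `&` [set t | t < 2^-1]); split.
    + by apply: openI; [exact: preimage_dom_open|exact: open_lt].
    + by split=> //=; rewrite -cd1// ltW.
    + have [_ A1] := C1; apply: (@Ck_ext _ _ _ 1 _ (phi i \o d1)).
      * by apply: openI; [exact: preimage_dom_open|exact: open_lt].
      * by move=> w [_ /= hw]; rewrite cd1// ltW.
      * by apply: Ck_subset (A1 i) => w [].
  - exists ((d2 @^-1` dom i) `&` [set t | 2^-1 < t]); split.
    + by apply: openI; [exact: preimage_dom_open|exact: open_gt].
    + by split=> //=; rewrite -cd2// ltW.
    + have [_ A1] := C2; apply: (@Ck_ext _ _ _ 1 _ (phi i \o d2)).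
      * by apply: openI; [exact: preimage_dom_open|exact: open_gt].
      * by move=> w [_ /= hw]; rewrite cd2// ltW.
      * by apply: Ck_subset (A1 i) => w [].
  - exists (OO i); split; [exact: oO| |exact: Csum].
    by split; rewrite /= -?cd1 -?cd2 ?ht// -ht.
have ds10h r : 2^-1 <= r -> ds1 r = 0 by move=> hr; apply: ds10; right; lra.
have ds20h r : r <= 2^-1 -> ds2 r = 0 by move=> hr; apply: ds20; left; lra.
have spc : is_speed c (fun t => `|ds1 t| * sp u (eta (2 * t - 0)) + `|ds2 t| * sp v (eta (2 * t - 1))).
  apply: (speed_in_chart hM Cc) => t; have [i di] := rm_dom_cover hM (c t).
  exists i; first exact: di.
  have [ht|ht|ht] := ltgtP t 2^-1.
  - have di' : dom i (d1 t) by rewrite -cd1// ltW.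
    rewrite (ds20h t (ltW ht)) normr0 mul0r addr0.
    have e1 := speedP sp1 di'; cbv beta in e1; rewrite e1 (cd1 _ (ltW ht)).
    have -> // : 'D_1 (phi i \o c) t = 'D_1 (phi i \o d1) t.
    by apply: near_eq_derive; apply: filterS (near1 _ ht) => w /= ->.
  - have di' : dom i (d2 t) by rewrite -cd2// ltW.
    rewrite (ds10h t (ltW ht)) normr0 mul0r add0r.
    have e2 := speedP sp2 di'; cbv beta in e2; rewrite e2 (cd2 _ (ltW ht)).
    have -> // : 'D_1 (phi i \o c) t = 'D_1 (phi i \o d2) t.
    by apply: near_eq_derive; apply: filterS (near2 _ ht) => w /= ->.
  - have ht1 : t <= 2^-1 by rewrite ht.
    have ht2 : 2^-1 <= t by rewrite ht.
    have di1 : dom i (d1 t) by rewrite -(cd1 _ ht1).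
    have di2 : dom i (d2 t) by rewrite -(cd2 _ ht2).
    (* At the junction both speeds vanish, hence both velocities, the metric being definite. *)
    have Q0 w (y' : 'rV[R]_N) : img i y' -> Num.sqrt (Q i y' w) = 0 -> w = 0.
      move=> iy /eqP; rewrite sqrtr_eq0 => Qle; apply/eqP; apply: contraTT Qle => w0.
      by rewrite -ltNge; exact: Q_gt0.
    rewrite (ds10h _ ht2) (ds20h _ ht1) normr0 !mul0r addr0.
    have -> : 'D_1 (phi i \o c) t = 0.
      have e1 : 'D_1 (phi i \o d1) t = 0.
        apply: (Q0 _ _ (imgP di1)); have e := speedP sp1 di1; cbv beta in e; rewrite -e.
        by rewrite (ds10h _ ht2) normr0 mul0r.
      have e2 : 'D_1 (phi i \o d2) t = 0.
        apply: (Q0 _ _ (imgP di2)); have e := speedP sp2 di2; cbv beta in e; rewrite -e.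
        by rewrite (ds20h _ ht1) normr0 mul0r.
      have -> : phi i \o c = (phi i \o d1) + (phi i \o d2) + cst (- phi i y).
        by apply/funext => w /=; rewrite -sumE.
      have dd1 := C1_derivable C1 di1; have dd2 := C1_derivable C2 di2.
      rewrite deriveD; [|exact: derivableD|exact: derivable_cst].
      by rewrite deriveD// derive_cst e1 e2 !addr0.
    by rewrite /Q /qform !mul0mx mxE sqrtr0.
apply: (inhabits (@Curve _ _ _ _ _ _ _ _ ((pr u \o s1) + (pr v \o s2)) Cc spc _ _ _ _)).
- move=> t _; apply: (is_derive_eq (is_deriveD (dS1 t) (dS2 t))).
  by rewrite !ger0_norm.
- have h0 : 0 <= 2^-1 :> R by rewrite invr_ge0.
  by rewrite (cd1 _ h0) /d1 /= subr0 mulr0 eta_le0// (cv0 u).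
- have h1 : 2^-1 <= 1 :> R by lra.
  have h2 : 1 <= 2 * 1 - 1 :> R by lra.
  rewrite (cd2 _ h1) -[d2 1]/(cv v (eta (2 * 1 - 1))) (eta_ge1 h2); exact: (cv1 v).
- have e10 : s1 0 = 0 by rewrite /s1 eta_le0//; lra.
  have e11 : s1 1 = 1 by rewrite /s1 eta_ge1//; lra.
  have e20 : s2 0 = 0 by rewrite /s2 eta_le0//; lra.
  have e21 : s2 1 = 1 by rewrite /s2 eta_ge1//; lra.
  by rewrite !fctE /= e10 e11 e20 e21; have := cv_len u; have := cv_len v; lra.
Unshelve. all: by end_near. Qed.

End Triangle.

(** * The Hopf-Rinow theorem *)

Section HopfRinow.
Context {R : realType} {T : topologicalType}.
Variable d : T -> T -> R.

(** What the argument takes from a Riemannian distance: it induces the topology, points can be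
    placed almost between two others ([lm_split]), and the space is locally compact. No geodesic is
    involved. *)
Record length_metric : Prop := LengthMetric {
  lm_refl : forall x, d x x = 0;
  lm_sym : forall x y, d x y = d y x;
  lm_tri : forall x y z, d x z <= d x y + d y z;
  lm_near : forall (x : T) (e : R), 0 < e -> \forall y \near x, d x y < e;
  lm_nbhs : forall (x : T) (U : set T), nbhs x U -> exists2 e : R, 0 < e & forall y, d x y < e -> U y;
  lm_split : forall (x y : T) (a b : R), 0 < a -> 0 < b -> d x y < a + b ->
    exists2 z, d x z < a & d z y < b;
  lm_locally_compact : forall x : T, exists2 K : set T, compact K & nbhs x K }.

Context (lm : length_metric).

Lemma lm_ge0 x y : 0 <= d x y.
Proof.
have := lm_tri lm x y x; rewrite (lm_refl lm) (lm_sym lm y x); lra.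
Qed.

Lemma lm_lipschitz x y z : `|d x y - d x z| <= d y z.
Proof.
rewrite ler_norml; apply/andP; split.
  by have := lm_tri lm x y z; lra.
by have := lm_tri lm x z y; rewrite (lm_sym lm z y); lra.
Qed.

Lemma lm_continuous x : continuous (d x).
Proof.
move=> y; apply/cvgrPdist_lt => e e0; near=> z.
apply: le_lt_trans (lm_lipschitz _ _ _) _.
by near: z; exact: lm_near.
Unshelve. all: by end_near. Qed.

Lemma cball_closed x r : closed [set y | d x y <= r].
Proof.
have -> : [set y | d x y <= r] = d x @^-1` [set u | u <= r] by [].
apply: closed_comp; [by move=> y _; exact: lm_continuous|exact: closed_le].
Qed.

Lemma oball_open x r : open [set y | d x y < r].
Proof.
have -> : [set y | d x y < r] = d x @^-1` [set u | u < r] by [].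
apply: open_comp; [by move=> y _; exact: lm_continuous|exact: open_lt].
Qed.

Definition totally_bounded (A : set T) := forall e : R, 0 < e ->
  exists s : seq T, forall y, A y -> exists2 z, z \in s & d z y < e.

Lemma totally_boundedS A B : A `<=` B -> totally_bounded B -> totally_bounded A.
Proof. by move=> AB tB e /tB[s H]; exists s => y /AB; exact: H. Qed.

Lemma totally_bounded_union (s : seq T) (E : T -> R) :
  (forall z, z \in s -> totally_bounded [set y | d z y < E z]) ->
  totally_bounded [set y | exists2 z, z \in s & d z y < E z].
Proof.
elim: s => [|w s IH] H e e0; first by exists [::] => y [].
have [|s1 Hs1] := IH _ e e0; first by move=> z zs; apply: H; rewrite inE zs orbT.
have [|s2 Hs2] := H w _ e e0; first by rewrite inE eqxx.
exists (s2 ++ s1) => y [z]; rewrite inE => /orP[/eqP ->|zs] zy.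
  by have [v vs vy] := Hs2 y zy; exists v; rewrite // mem_cat vs.
have [|v vs vy] := Hs1 y; first by exists z.
by exists v; rewrite // mem_cat vs orbT.
Qed.

Lemma compact_balls (K : set T) (E : T -> R) : compact K -> (forall z, 0 < E z) ->
  exists s : seq T, forall y, K y -> exists2 z, z \in s & d z y < E z.
Proof.
move=> cK E0.
(* The filter of finite lists directed by inclusion: with it, a property of all large lists near
   each point of [K] becomes a finite subcover. *)
pose F : set_system (seq T) := [set A | exists s0 : seq T, forall s : seq T, {subset s0 <= s} -> A s].
have FF : Filter F.
  split.
  - by exists [::].
  - move=> A B [s1 H1] [s2 H2]; exists (s1 ++ s2) => s H; split.
      by apply: H1 => z zs; apply: H; rewrite mem_cat zs.
    by apply: H2 => z zs; apply: H; rewrite mem_cat zs orbT.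
  - by move=> A B AB [s H]; exists s => s' /H/AB.
have /compact_near_coveringP := cK.
move=> /(_ (seq T) F (fun s y => exists2 z, z \in s & d z y < E z) FF) [|s0 H].
  move=> x _; exists ([set y | d x y < E x], [set s : seq T | x \in s]).
    split; first by have := lm_near lm x (E0 x).
    by exists [:: x] => s; apply; rewrite inE.
  by move=> [y s] [/= h1 h2]; exists x.
by exists s0 => y; exact: (H s0 (fun z zs => zs)).
Qed.

Lemma compact_totally_bounded (K : set T) : compact K -> totally_bounded K.
Proof. by move=> cK e e0; exact: (@compact_balls K (fun _ => e)). Qed.

Lemma ultra_seq (F : set_system T) (P : T -> set T) (s : seq T) : UltraFilter F ->
  F [set y | exists2 z, z \in s & P z y] -> exists2 z, z \in s & F (P z).
Proof.
move=> UF; have PF : ProperFilter F := @ultra_proper _ _ UF.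
elim: s => [|w s IH] H.
  by have [y [z]] := filter_ex H.
have [Fw|Fw] := in_ultra_setVsetC (P w) UF; first by exists w; rewrite // inE eqxx.
have [|z zs Fz] := IH; last by exists z; rewrite // inE zs orbT.
apply: filterS (filterI H Fw) => y [[z]]; rewrite inE => /orP[/eqP ->//|zs Pz _].
by exists z.
Qed.

(** An ultrafilter on [A] contains a ball of radius [1 / (n + 1)] for each [n]. Any two of these
    balls meet, so their centres form a Cauchy sequence, and its limit is a limit of the
    ultrafilter. *)
Lemma totally_bounded_compact (A : set T) : metric_complete d -> closed A ->
  totally_bounded A -> compact A.
Proof.
move=> cd clA tA; rewrite compact_ultra => F UF FA.
have PF : ProperFilter F := @ultra_proper _ _ UF.
have H n : exists z, F [set y | d z y < n.+1%:R^-1].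
  have [|s Hs] := tA (n.+1%:R^-1); first by rewrite invr_gt0.
  have [|z _ Fz] := @ultra_seq F (fun z => [set y | d z y < n.+1%:R^-1]) s UF.
    exact: filterS FA.
  by exists z.
have [z Hz] := choice H.
have inv_small (e : R) : 0 < e -> exists K : nat, forall n, (K <= n)%N -> n.+1%:R^-1 < e :> R.
  move=> e0; exists (Num.trunc e^-1) => n Kn.
  have := truncnS_gt e^-1 => h.
  rewrite -[e]invrK ltf_pV2 ?posrE ?invr_gt0//.
  by apply: lt_le_trans h _; rewrite ler_nat.
have [l Hl] : exists l : T, forall e : R, 0 < e -> exists K : nat,
    forall n : nat, (K <= n)%N -> d (z n) l < e.
  apply: cd => e e0; have [|K HK] := inv_small (e / 2); first lra.
  exists K => m n Km Kn; have [y [/= ym yn]] := filter_ex (filterI (Hz m) (Hz n)).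
  have h1 : d (z m) y < e / 2 := lt_trans ym (HK _ Km).
  have h2 : d (z n) y < e / 2 := lt_trans yn (HK _ Kn).
  have := lm_tri lm (z m) y (z n); rewrite (lm_sym lm y (z n)); lra.
have Fl : F --> l.
  move=> U /(lm_nbhs lm)[e e0 HU].
  have [|K1 HK1] := inv_small (e / 2); first lra.
  have [|K2 HK2] := Hl (e / 2); first lra.
  pose n := maxn K1 K2.
  have h2 := HK2 n (leq_maxr _ _).
  apply: filterS (Hz n) => y /= zy; apply: HU.
  have h1 : d (z n) y < e / 2 := lt_trans zy (HK1 n (leq_maxl _ _)).
  have := lm_tri lm l (z n) y; rewrite (lm_sym lm l (z n)); lra.
exists l; split=> //; apply: clA => U Ul.
have [y Hy] := filter_ex (filterI FA (Fl _ Ul)); by exists y.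
Qed.

Lemma small_totally_bounded x : exists2 e : R, 0 < e & totally_bounded [set y | d x y < e].
Proof.
have [K cK /(lm_nbhs lm)[e e0 HK]] := lm_locally_compact lm x.
by exists e => //; apply: totally_boundedS (compact_totally_bounded cK) => y /=; exact: HK.
Qed.

Lemma min_over_seq (s : seq T) (E : T -> R) : (forall z, 0 < E z) ->
  exists2 e : R, 0 < e & forall z, z \in s -> e <= E z.
Proof.
move=> E0; elim: s => [|w s [e e0 H]]; first by exists 1.
exists (Num.min e (E w)); first by rewrite lt_min e0 E0.
by move=> z; rewrite inE => /orP[/eqP ->|/H ze]; rewrite ge_min ?ze ?lexx ?orbT.
Qed.

Lemma cball_totally_bounded x r : 0 < r ->
  totally_bounded [set y | d x y < r] -> totally_bounded [set y | d x y <= r].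
Proof.
move=> r0 tr e e0; have [|s Hs] := tr (e / 2); first lra.
exists s => y /= xy.
have [|||z xz zy] := @lm_split lm x y r (e / 2); try lra.
have [w ws wz] := Hs z xz; exists w => //.
have := lm_tri lm w z y; lra.
Qed.

(** If some radius failed, the supremum [rs] of the good radii would be finite and, by [lm_split],
    good itself. The closed ball of radius [rs] is then compact, and a finite cover of it by small
    totally bounded balls reaches beyond [rs]. *)
Lemma oball_totally_bounded x r : metric_complete d -> totally_bounded [set y | d x y < r].
Proof.
move=> cd; pose E := [set r | totally_bounded [set y | d x y < r]].
have [//|nr] := pselect (E r).
have [e0 e00 He0] := small_totally_bounded x.
have ubE : ubound E r.
  move=> u Eu; rewrite leNgt; apply/negP => ru; apply: nr.
  by apply: totally_boundedS Eu => y /= xy; exact: lt_trans ru.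
have hsE : has_sup E by split; [exists e0|exists r].
set rs := sup E.
have rs0 : 0 < rs by apply: lt_le_trans e00 _; exact: (sup_upper_bound hsE).
have Ers : E rs.
  move=> e e_gt0; pose e' := Num.min (e / 2) (rs / 2).
  have e'0 : 0 < e' by rewrite lt_min !divr_gt0.
  have e'1 : e' <= e / 2 by rewrite ge_min lexx.
  have e'2 : e' <= rs / 2 by rewrite ge_min lexx orbT.
  have [r1 Er1 hr1] := sup_adherent e'0 hsE; rewrite -/rs in hr1.
  have [|s Hs] := Er1 (e / 2); first lra.
  exists s => y /= xy.
  have [|||z xz zy] := @lm_split lm x y r1 e'; try lra.
  have [w ws wz] := Hs z xz; exists w => //.
  have := lm_tri lm w z y; lra.
have cA : compact [set y | d x y <= rs].
  by apply: (totally_bounded_compact cd); [exact: cball_closed|exact: cball_totally_bounded].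
have H z : exists e : R, 0 < e /\ totally_bounded [set y | d z y < e].
  by have [e e1 te] := small_totally_bounded z; exists e.
have [f Hf] := choice H.
(* Covering with half radii leaves room for the enlargement of [rs] by [e]. *)
have f20 z : 0 < f z / 2 by rewrite divr_gt0//; have [] := Hf z.
have [s Hs] := compact_balls cA f20.
have [e e_gt0 He] := min_over_seq s f20.
suff /(sup_upper_bound hsE) : E (rs + e) by rewrite -/rs; lra.
apply: totally_boundedS (@totally_bounded_union s f _); last by move=> z _; have [] := Hf z.
move=> y /= xy; have [|||z xz zy] := @lm_split lm x y rs e; try lra.
have [w ws wz] := Hs z (ltW xz); exists w => //.
have := lm_tri lm w z y; have := He w ws; lra.
Qed.

Lemma hopf_rinow x r : metric_complete d -> compact [set y | d x y <= r].
Proof.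
move=> cd; apply: (totally_bounded_compact cd); first exact: cball_closed.
apply: totally_boundedS (oball_totally_bounded x (r + 1) cd) => y /=; lra.
Qed.

End HopfRinow.

(** * The Riemannian distance as a length metric *)

Section LocalEstimates.
Context {R : realType} {N : nat} (M : riem_data R N) (hM : is_riemannian M).
Implicit Types (i j k : idx M) (x y z : M).

Definition msum (G : 'M[R]_N) : R := \sum_k \sum_l `|G l k|.

Lemma msum_ge0 G : 0 <= msum G.
Proof. by apply: sumr_ge0 => k _; apply: sumr_ge0. Qed.

Lemma qform_le (G : 'M[R]_N) w : `|qform G w| <= msum G * `|w| ^+ 2.
Proof.
rewrite qformE /msum mulr_suml (le_trans (ler_norm_sum _ _ _))//.
apply: ler_sum => k _; rewrite normrM expr2 mulrA ler_pM ?normr_coord//.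
rewrite mulr_suml (le_trans (ler_norm_sum _ _ _))//.
apply: ler_sum => l _; rewrite normrM mulrC ler_wpM2l//; exact: normr_coord.
Qed.

Lemma msum_continuous (T : topologicalType) (f : T -> 'M[R]_N) (a : T) :
  {for a, continuous f} -> {for a, continuous (fun t => msum (f t))}.
Proof.
move=> cf; suff : msum (f t) @[t --> a] --> msum (f a) by [].
apply: cvg_sum_fin => k; apply: cvg_sum_fin => l.
apply: cvg_norm.
by apply: (@continuous_comp _ _ _ f (fun M : 'M[R]_N => M l k) a cf); exact: coord_continuous.
Qed.

Lemma qformB (G G' : 'M[R]_N) w : qform G w - qform G' w = qform (G - G') w.
Proof. by rewrite /qform mulmxBr mulmxBl !mxE. Qed.

Lemma sphere_compact_rV n : compact [set w : 'rV[R]_n | `|w| = 1].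
Proof.
apply: bounded_closed_compact.
  exists 1; split; [exact: num_real|move=> u u1 w /= ->]; exact: ltW.
have -> : [set w : 'rV[R]_n | `|w| = 1] = Num.norm @^-1` [set 1] by [].
apply: closed_comp; [by move=> w _; exact: norm_continuous|exact: closed_eq].
Qed.

Lemma cball_compact_rV n (c : 'rV[R]_n) r : compact [set w : 'rV[R]_n | `|w - c| <= r].
Proof.
apply: bounded_closed_compact.
  exists (r + `|c|); split; [exact: num_real|move=> u u1 w /= h].
  rewrite -[w](subrK c); apply: le_trans (ler_normD _ _) _; lra.
have -> : [set w : 'rV[R]_n | `|w - c| <= r] = (fun w => `|w - c|) @^-1` [set u | u <= r] by [].
apply: closed_comp; last exact: closed_le.
move=> w _; have h : {for w, continuous (fun w : 'rV[R]_n => w - c)}.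
  by apply: continuousB; [exact: cvg_id|exact: cst_continuous].
exact: (cvg_norm h).
Qed.

Lemma metric_pinched i x : dom i x -> exists k C : R, [/\ 0 < k, 0 < C &
  \forall u \near phi i x, img i u /\
    forall w, (k * `|w|) ^+ 2 <= Q i u w /\ Q i u w <= (C * `|w|) ^+ 2].
Proof.
move=> dx; set c0 := phi i x; have ic : img i c0 by exact: imgP.
have [m m0 Hm] : exists2 m : R, 0 < m & forall w, m * `|w| ^+ 2 <= Q i c0 w.
  (* In dimension [0] there is no unit vector. *)
  have [[w0 w0n]|nw] := pselect (exists w : 'rV[R]_N, `|w| = 1); last first.
    exists 1 => // w; have [->|wn0] := eqVneq w 0.
      by rewrite normr0 expr0n mulr0 Q_ge0.
    exfalso; apply: nw; exists (`|w|^-1 *: w).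
    by rewrite normrZ normfV normr_id mulVf// normr_eq0.
  have [||w /set_mem /= wn1 wmin] := @EVT_min_rV R N (Q i c0) [set w | `|w| = 1] _ (@sphere_compact_rV N).
  - by exists w0.
  - apply: continuous_subspaceT => w; apply: (@qform_continuous R 'rV[R]_N N (fun _ => met i c0) (fun w => w) w); [exact: cst_continuous|exact: cvg_id].
  exists (Q i c0 w); first by apply: Q_gt0 => //; rewrite -normr_eq0 wn1 oner_eq0.
  move=> v; have [->|vn0] := eqVneq v 0; first by rewrite normr0 expr0n mulr0 Q_ge0.
  have vn : `|v| != 0 by rewrite normr_eq0.
  set v1 := `|v|^-1 *: v.
  have E : v = `|v| *: v1 by rewrite scalerA mulfV// scale1r.
  have n1 : `|v1| = 1 by rewrite normrZ normfV normr_id mulVf.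
  have -> : Q i c0 v = `|v| ^+ 2 * Q i c0 v1 by rewrite /Q [in LHS]E qformZ.
  by rewrite mulrC ler_wpM2l ?sqr_ge0// wmin//; apply/mem_set.
(* Chosen so that [k ^+ 2 <= m / 2] and [msum (met i c0) + 1 <= C ^+ 2], a deviation of the metric
   by at most [k] being allowed. *)
pose k := Num.min 1 (m / 2); pose C := msum (met i c0) + 2.
have k0 : 0 < k by rewrite lt_min ltr01 divr_gt0.
have C0 : 0 < C by rewrite ltr_wpDl ?msum_ge0.
exists k, C; split=> //.
have c1 : {for c0, continuous (fun u : 'rV[R]_N => msum (met i u - met i c0))}.
  apply: msum_continuous; apply: continuousB; [exact: met_cont|exact: cst_continuous].
have small : \forall u \near c0, msum (met i u - met i c0) < Num.min 1 (m / 2).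
  have /cvgrPdist_lt/(_ _ k0) := c1; apply: filterS => u.
  have -> : msum (met i c0 - met i c0) = 0.
    by rewrite subrr /msum big1// => a _; rewrite big1// => b _; rewrite mxE normr0.
  by rewrite sub0r normrN ger0_norm ?msum_ge0.
near=> u; split; first by near: u; exact: img_nbhs.
have smallu : msum (met i u - met i c0) < Num.min 1 (m / 2) by near: u.
move: smallu; rewrite lt_min => /andP[s1 s2] w.
have := qform_le (met i u - met i c0) w; rewrite -qformB -/(Q i u w) -/(Q i c0 w).
rewrite ler_norml => /andP[b1 b2].
have := Hm w; have := qform_le (met i c0) w; rewrite -/(Q i c0 w) ler_norml => /andP[_ b3] b4.
have w2 : 0 <= `|w| ^+ 2 by rewrite sqr_ge0.
have kk : k ^+ 2 <= m / 2.
  have h1 : k <= 1 by rewrite ge_min lexx.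
  have h2 : k <= m / 2 by rewrite ge_min lexx orbT.
  nra.
have CC : msum (met i c0) + 1 <= C ^+ 2.
  rewrite /C; have := msum_ge0 (met i c0); nra.
rewrite !exprMn; split; nra.
Unshelve. all: by end_near. Qed.

(** The segment in the chart is short enough, its speed being controlled by the upper bound on the
    metric. *)
Lemma joined_local_upper i x : dom i x -> exists r C : R, [/\ 0 < r, 0 < C &
  forall w, `|w| < r -> img i (phi i x + w) /\
    exists2 l, joined x (psi i (phi i x + w)) l & l <= C * `|w|].
Proof.
move=> dx; have [k [C [_ C0 H]]] := metric_pinched dx.
have [r /= r0 Hr] := (iffLR (nbhs_ballP _ _) H).
exists r, C; split=> // w wr; set c0 := phi i x.
(* [eta] keeps the segment in the ball at all real times, as curves are defined on the whole
   line. *)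
pose f (t : R) := c0 + eta t *: w.
have fb t : ball c0 r (f t).
  rewrite -ball_normE /= opprD addrA subrr sub0r normrN normrZ ger0_norm ?eta_ge0//.
  by apply: le_lt_trans wr; rewrite ler_piMl// eta_le1.
have fi t : img i (f t) by have [] := Hr _ (fb t).
have f0 : f 0 = c0 by rewrite /f eta_le0// scale0r addr0.
have f1 : f 1 = c0 + w by rewrite /f eta_ge1// scale1r.
have Cf : Ck 1 setT f.
  apply: Ck_add; [exact: openT|exact: Ck_cst|].
  apply/Ck_rowP; first exact: openT.
  move=> j; apply: (@Ck_ext _ _ _ 1 setT (fun t : R => eta t * w 0 j)).
  - exact: openT.
  - by move=> t _; rewrite mxE.
  - by apply: Ck_mul; [exact: openT|exact: eta_Ck|exact: Ck_cst].
have fc : continuous f by move=> t; exact: Ck_continuous Cf I.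
pose c t := psi i (f t).
have cc : continuous c.
  by move=> t; apply: continuous_comp; [exact: fc|apply: (psi_cont hM); exact: fi].
have Cc : C1_curve c.
  split; first exact: cc.
  move=> j; have oc := preimage_dom_open hM (i := j) cc.
  suff H1 : Ck 1 (c @^-1` dom j : set R) (trans i j \o f) by exact: H1.
  refine (@Ck_comp R R N N 1 _ _ f (trans i j) oc (@overlap_open R N M hM i j) _ _ _).
  - move=> t dt; have := overlapP (psi_dom hM (fi t)) dt.
    by rewrite (psiK hM (fi t)).
  - exact: Ck_subset Cf.
  - exact: trans_smooth.
have [s sp] := speed_exists hM Cc.
have [S dS] := primitive_exists (speed_continuous hM Cc sp).
split; first by rewrite -f1.
have j : joined x (psi i (c0 + w)) (S 1 - S 0).
  split; apply: (@Curve _ _ _ _ _ _ c s S Cc sp dS) => //.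
    by rewrite /c f0 (phiK hM).
  by rewrite /c f1.
exists (S 1 - S 0) => //.
have [deta detaP] : {d : R -> R | forall t : R, [/\ is_derive t 1 eta (d t), 0 <= d t
    & t <= 0 \/ 1 <= t -> d t = 0]}.
  by exists (fun t => sval (cid (eta_deriv t))) => t; case: cid.
have st t : s t <= C * `|w| * deta t.
  have [dt d0 _] := detaP t.
  have di : dom i (c t) by exact: (psi_dom hM (fi t)).
  rewrite (speedP sp di).
  have E : phi i \o c = f by apply/funext => u /=; rewrite /c (psiK hM (fi u)).
  rewrite E -[phi i (c t)]/((phi i \o c) t) E.
  have -> : 'D_1 f t = deta t *: w.
    rewrite derive_mx; last exact: Ck_derivable Cf I.
    apply/rowP => a; rewrite mxE mxE mulrC.
    have -> : (fun t => f t 0 a) = cst (c0 0 a) + w 0 a \*: eta.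
      by apply/funext => u; rewrite /f !mxE mulrC.
    have [_ ->] := is_deriveD (is_derive_cst (c0 0 a) t (1 : R)) (is_deriveZ (w 0 a) dt).
    by rewrite add0r.
  have [_ /(_ (deta t *: w))[_ le2]] := Hr _ (fb t).
  apply: le_trans (_ : Num.sqrt ((C * `|deta t *: w|) ^+ 2) <= _); first by rewrite ler_wsqrtr.
  have h0 : 0 <= C * (deta t * `|w|) by apply: mulr_ge0; [exact: ltW|exact: mulr_ge0].
  rewrite normrZ sqrtr_sqr (ger0_norm d0) (ger0_norm h0).
  by rewrite le_eqVlt; apply/orP; left; apply/eqP; ring.
pose g u := C * `|w| * eta u - S u.
have : g 0 <= g 1.
  apply: (@nondecreasing_from_derive R g (fun t => C * `|w| * deta t - s t) 0 1 ler01) => t ht.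
    by have [dt _ _] := detaP t; exact: is_deriveB (is_deriveZ _ dt) (dS t ht).
  by rewrite subr_ge0.
rewrite /g eta_le0// eta_ge1// mulr0 mulr1; lra.
Qed.

Lemma joined_near x (e : R) : 0 < e -> \forall y \near x, exists2 l, joined x y l & l < e.
Proof.
move=> e0; have [i di] := rm_dom_cover hM x.
have [r [C [r0 C0 H]]] := joined_local_upper di.
pose r' := Num.min r (e / C).
have r'0 : 0 < r' by rewrite lt_min r0 divr_gt0.
near=> y.
have dy : dom i y by near: y; exact: dom_nbhs.
have yr : `|phi i y - phi i x| < r'.
  near: y; have /cvgrPdist_lt/(_ _ r'0) := phi_cont hM di.
  by apply: filterS => y; rewrite distrC.
move: yr; rewrite lt_min => /andP[yr ye].
have [_ [l jl lC]] := H _ yr.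
exists l; first by move: jl; rewrite addrC subrK (phiK hM).
by apply: le_lt_trans lC _; rewrite mulrC -ltr_pdivlMr.
Unshelve. all: by end_near. Qed.

Lemma joined_local x : exists2 U : set M, open U /\ U x & forall y, U y -> exists l, joined x y l.
Proof.
have H := joined_near x ltr01; have : nbhs x (fun y => exists2 l, joined x y l & l < 1) by exact: H.
rewrite nbhsE => -[U [oU Ux] HU].
by exists U => // y /HU[l jl _]; exists l.
Qed.

(** The set of points joined to [x] is open and closed. *)
Lemma joined_exists x y : exists l, joined x y l.
Proof.
have : [set y | exists l, joined x y l] = setT.
  apply: (rm_connected hM).
  - by exists x, 0; exact: joined_refl.
  - exists [set y | exists l, joined x y l]; last by rewrite setTI.
    rewrite openE => z [l jl]; have [U [oU Uz] HU] := joined_local z.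
    apply: (@filterS _ _ _ U); last exact: open_nbhs_nbhs.
    by move=> w /HU[l' jl']; exists (l + l'); exact: joined_trans jl jl'.
  - exists [set y | exists l, joined x y l]; last by rewrite setTI.
    rewrite -openC openE => z nz; have [U [oU Uz] HU] := joined_local z.
    apply: (@filterS _ _ _ U); last exact: open_nbhs_nbhs.
    move=> w /HU[l' jl'] [l jl]; apply: nz; exists (l + l').
    exact: joined_trans jl (joined_sym hM jl').
by move=> /seteqP[_ /(_ y I)].
Qed.

Lemma dist_le x y l : joined x y l -> riem_dist x y <= l.
Proof. exact: dist_le_joined. Qed.

Lemma dist_lt x y a : riem_dist x y < a -> exists2 l, joined x y l & l < a.
Proof. by have [l jl] := joined_exists x y; exact: dist_lt_joined jl. Qed.

Lemma le_dist x y a : (forall l, joined x y l -> a <= l) -> a <= riem_dist x y.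
Proof. by move=> H; rewrite leNgt; apply/negP => /dist_lt[l /H]; rewrite leNgt => /negP. Qed.

Lemma dist_refl x : riem_dist x x = 0.
Proof. by apply/eqP; rewrite eq_le (dist_le (joined_refl hM x)) dist_ge0. Qed.

Lemma dist_sym x y : riem_dist x y = riem_dist y x.
Proof.
suff H x' y' : riem_dist x' y' <= riem_dist y' x' by apply/eqP; rewrite eq_le !H.
by apply: le_dist => l /(joined_sym hM)/dist_le.
Qed.

Lemma dist_tri x y z : riem_dist x z <= riem_dist x y + riem_dist y z.
Proof.
rewrite -lerBlDr; apply: le_dist => l1 j1; rewrite lerBlDr -lerBlDl.
by apply: le_dist => l2 j2; rewrite lerBlDl; exact: dist_le (joined_trans hM j1 j2).
Qed.

Lemma dist_split x y (a b : R) : 0 < a -> 0 < b -> riem_dist x y < a + b ->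
  exists2 z, riem_dist x z < a & riem_dist z y < b.
Proof.
move=> a0 b0 /dist_lt[l [u] lab].
have l0 : 0 <= l by exact: (joined_ge0 hM (inhabits u)).
have ab0 : 0 < a + b by lra.
have cS : {within `[0, 1], continuous (pr u)}.
  by apply: derivable_within_continuous => t; rewrite in_itv /= => /(@cv_pr _ _ _ _ _ _ u)[].
have lu := cv_len u.
pose m := l * (a / (a + b)).
have f0 : 0 <= a / (a + b) by rewrite divr_ge0// ltW.
have f1 : a / (a + b) <= 1 by rewrite ler_pdivrMr// mul1r; lra.
have ma : m < a by rewrite /m mulrA ltr_pdivrMr// mulrC ltr_pM2l.
have lb : l - m < b.
  have -> : l - m = l * b / (a + b) by rewrite /m; field; rewrite gt_eqF.
  by rewrite ltr_pdivrMr// mulrC ltr_pM2l.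
have [|t] := @IVT R (pr u) 0 1 (pr u 0 + m) ler01 cS.
  have h : pr u 0 <= pr u 1 by rewrite -subr_ge0 lu.
  rewrite (min_idPl h) (max_idPr h) /m; apply/andP; split; nra.
rewrite in_itv /= => /andP[t0 t1] E.
exists (cv u t).
  have := joined_sub hM u (a := 0) (b := t); rewrite lexx ler01 t0 t1 /= cv0 => /(_ isT isT)/dist_le; lra.
have := joined_sub hM u (a := t) (b := 1); rewrite lexx ler01 t0 t1 /= cv1 => /(_ isT isT)/dist_le; lra.
Qed.

Definition sqn n (u : 'rV[R]_n) : R := \sum_k u 0 k ^+ 2.

Lemma coord_sqn n (u : 'rV[R]_n) (k : 'I_n) : u 0 k ^+ 2 <= sqn u.
Proof. by rewrite /sqn (bigD1 k)//= lerDl sumr_ge0// => j _; exact: sqr_ge0. Qed.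

Lemma sqn_ge0 n (u : 'rV[R]_n) : 0 <= sqn u.
Proof. by apply: sumr_ge0 => j _; exact: sqr_ge0. Qed.

(* A bump function of the chart is Lipschitz, so a short curve issued from its
   centre cannot leave its support. *)
Lemma nbhs_dist x (U : set M) : nbhs x U -> exists2 e : R, 0 < e & forall y, riem_dist x y < e -> U y.
Proof.
move=> Ux; have [i di] := rm_dom_cover hM x; set c0 := phi i x.
have [k [C [k0 _ H]]] := metric_pinched di.
have H2 : nbhs (phi i x) (_ `&` _) := filterI H (near_phi hM di Ux).
have [r /= r0 Hr] := (iffLR (nbhs_ballP _ _) (H2 (nbhs_filter _))).
(* [rho <= 1] keeps the argument of the bump below [1], the range of [flat_bound]. *)
pose rho := Num.min 1 (r / 2).
have rho0 : 0 < rho by rewrite lt_min ltr01 divr_gt0.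
have rho1 : rho <= 1 by rewrite ge_min lexx.
have rho2 : rho < r by rewrite gt_min; apply/orP; right; lra.
have inb (v : 'rV[R]_N) : `|v - c0| <= rho -> ball c0 r v.
  by move=> h; rewrite -ball_normE /= distrC; exact: le_lt_trans h rho2.
pose b y : R := if pselect (dom i y) then bumpR (rho ^+ 2 - sqn (phi i y - c0)) else 0.
have [D D0 HD] := @flat_bound R ('X^2 * (1 - 1^`())).
pose K : R := D * (2 * (N%:R * k^-1)) + 1.
have K0 : 0 < K by rewrite ltr_wpDl// !mulr_ge0// invr_ge0 ltW.
have Kb c s (t : R) : C1_curve c -> is_speed c s -> exists2 db, is_derive t 1 (b \o c) db & `|db| <= K * s t.
  move=> Cc sp; have [cc _] := Cc.
  have [dt|ndt] := pselect (dom i (c t)); last first.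
    exists 0; last by rewrite normr0 mulr_ge0 ?(ltW K0)//; exact: speed_ge0 sp.
    (* The support lies in a compact, hence closed, subset of the chart. A curve outside the chart
       at time [t] misses it near [t], and there the bump is constantly [0]. *)
    pose Kc := psi i @` [set u | `|u - c0| <= rho].
    have cKc : closed Kc.
      apply: compact_closed; first exact: rm_hausdorff.
      apply: continuous_compact; last exact: cball_compact_rV.
      apply/subspace_continuousP => u /= hu; apply: cvg_within_filter; apply: (psi_cont hM).
      by have [[]] := Hr _ (inb _ hu).
    apply: (@near_eq_is_derive R R R (cst (0 : R)) (b \o c) t 1 0).
    have nK : \near t, ~ Kc (c t).
      apply: (cc t (~` Kc)); apply: open_nbhs_nbhs; split; first exact: closed_openC.
      move=> [u hu E]; apply: ndt; rewrite -E; apply: (psi_dom hM).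
      by have [[]] := Hr _ (inb _ hu).
    near=> v; rewrite /= /b; case: pselect => // dv.
    rewrite bumpR_eq0//= subr_le0 leNgt; apply/negP => hlt.
    apply: (near nK v) => //; exists (phi i (c v)); last exact: (phiK hM).
    apply: normr_rV_le; [exact: ltW|move=> j].
    rewrite -ler_sqr ?nnegrE ?(ltW rho0)// real_normK ?num_real//.
    exact: le_trans (coord_sqn _ _) (ltW hlt).
  pose g := phi i \o c.
  have dg : derivable g t 1 by exact: C1_derivable.
  have dgj (j : 'I_N) : is_derive t 1 (fun u : R => g u 0 j - c0 0 j) ('D_1 g t 0 j).
    have dgj : derivable (fun u : R => g u 0 j) t 1 by exact: (iffLR (derivable_mxP _ _ _) dg).
    have e1 : 'D_1 g t 0 j = 'D_1 (fun u => g u 0 j) t by rewrite derive_mx ?mxE.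
    have := is_deriveB (derivableP dgj) (is_derive_cst (c0 0 j) t (1 : R)).
    by rewrite subr0 -e1.
  have dsq : is_derive t 1 (fun u : R => sqn (g u - c0)) (\sum_j 2 * (g t 0 j - c0 0 j) * 'D_1 g t 0 j).
    have -> : (fun u : R => sqn (g u - c0)) = \sum_j (fun u : R => g u 0 j - c0 0 j) ^+ 2.
      apply/funext => u; rewrite fct_sumE /sqn; apply: eq_bigr => j _.
      by rewrite !mxE !expr2.
    by apply: is_derive_sum => j; apply: is_derive_eq.
  have dq : is_derive t 1 (fun u : R => rho ^+ 2 - sqn (g u - c0)) (- \sum_j 2 * (g t 0 j - c0 0 j) * 'D_1 g t 0 j).
    by have := is_deriveB (is_derive_cst (rho ^+ 2) t (1 : R)) dsq; rewrite sub0r.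
  have dbb := @is_derive1_comp R (@bumpR R) _ t _ _ (flat_derive 1 (rho ^+ 2 - sqn (g t - c0))) dq.
  eexists.
    apply: near_eq_is_derive dbb.
    near=> u; rewrite /= /b; case: pselect => //= nd; exfalso; apply: nd.
    by near: u; exact: curve_nbhs.
  set q := rho ^+ 2 - sqn (g t - c0).
  have s0 := speed_ge0 hM t sp.
  have [q0|q0] := leP q 0.
    by rewrite /flat ltNge q0/= mul0r normr0 mulr_ge0// ltW.
  have q1 : q <= 1.
    by rewrite /q; have := sqn_ge0 (g t - c0); nra.
  have gj (j : 'I_N) : `|g t 0 j - c0 0 j| <= rho.
    rewrite -ler_sqr ?nnegrE ?(ltW rho0)// real_normK ?num_real//.
    have := coord_sqn (g t - c0) j; rewrite !mxE => h; apply: le_trans h _.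
    by move: q0; rewrite /q subr_gt0 => /ltW.
  have gin : ball c0 r (g t).
    by apply: inb; apply: normr_rV_le; [exact: ltW|move=> j; rewrite !mxE; exact: gj].
  have [[_ /(_ ('D_1 g t))[lw _]] _] := Hr _ gin.
  have sk : `|'D_1 g t| <= k^-1 * s t.
    rewrite -ler_pdivrMl ?invr_gt0// invrK (speedP sp dt) -/g.
    have -> : k * `|'D_1 g t| = Num.sqrt ((k * `|'D_1 g t|) ^+ 2).
      by rewrite sqrtr_sqr ger0_norm// mulr_ge0// ltW.
    by rewrite ler_wsqrtr.
  rewrite normrM normrN.
  have f1 : `|flat ('X^2 * (1 - 1^`())) q| <= D.
    apply: le_trans (HD _ q1) _; rewrite ler_piMr// expr_le1// ltW//.
  have f2 : `|\sum_j 2 * (g t 0 j - c0 0 j) * 'D_1 g t 0 j| <= 2 * (N%:R * (k^-1 * s t)).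
    apply: le_trans (ler_norm_sum _ _ _) _.
    apply: le_trans (_ : \sum_(j < N) 2 * (k^-1 * s t) <= _).
      apply: ler_sum => j _; rewrite normrM normrM (ger0_norm (_ : 0 <= 2))// -mulrA ler_wpM2l//.
      rewrite -[leRHS]mul1r ler_pM ?normr_ge0//; first exact: le_trans (gj j) rho1.
      exact: le_trans (normr_coord _ _) sk.
    by rewrite sumr_const card_ord -mulrnAr [N%:R * _]mulr_natl.
  apply: le_trans (ler_pM (normr_ge0 _) (normr_ge0 _) f1 f2) _.
  have -> : K * s t = D * (2 * (N%:R * (k^-1 * s t))) + s t by rewrite /K; ring.
  by rewrite lerDl.
have bx : b x = bumpR (rho ^+ 2).
  rewrite /b; case: pselect => // dx; rewrite subrr.
  rewrite (_ : sqn 0 = 0) ?subr0//.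
  by rewrite /sqn big1// => j _; rewrite mxE expr0n.
have bx0 : 0 < b x by rewrite bx bumpR_gt0// exprn_gt0.
exists (b x / K); first by rewrite divr_gt0.
move=> y /dist_lt[l [u] lK].
have [db Hdb] := choice (fun t => let: ex_intro2 v p q := Kb _ _ t (cv_C1 u) (@cv_speed _ _ _ _ _ _ u) in ex_intro (fun v => _ /\ _) v (conj p q)).
(* Since [G] is nondecreasing, the bump loses at most [K * l] along the curve, so it is still
   positive at [y]. *)
pose G t := K * pr u t + b (cv u t).
have : G 0 <= G 1.
  apply: (@nondecreasing_from_derive R G (fun t => K * sp u t + db t) 0 1 ler01) => t ht.
    have [d1 _] := Hdb t.
    exact: is_deriveD (is_deriveZ K (@cv_pr _ _ _ _ _ _ u t ht)) d1.
  have [_] := Hdb t; rewrite ler_norml => /andP[h _]; lra.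
rewrite /G (cv0 u) (cv1 u) => h.
have := cv_len u => hl.
have lK' : l * K < b x by rewrite -ltr_pdivlMr.
have by0 : 0 < b y by nra.
have bE v : b v = if pselect (dom i v) then bumpR (rho ^+ 2 - sqn (phi i v - c0)) else 0 by [].
move: by0; rewrite bE; case: (pselect (dom i y)) => [dy|nd] /=; last by rewrite ltxx.
move=> b0; have hlt : 0 < rho ^+ 2 - sqn (phi i y - c0).
  by rewrite ltNge; apply/negP => /bumpR_eq0 E; move: b0; rewrite E ltxx.
have : ball c0 r (phi i y).
  apply: inb; apply: normr_rV_le; first exact: ltW.
  move=> j; rewrite -ler_sqr ?nnegrE ?(ltW rho0)// real_normK ?num_real//.
  by apply: le_trans (coord_sqn _ _) _; rewrite -subr_ge0 ltW.
by move=> /Hr[_]; rewrite (phiK hM).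
Unshelve. all: by end_near. Qed.

Lemma riem_length_metric : length_metric (@riem_dist R N M).
Proof.
split.
- exact: dist_refl.
- exact: dist_sym.
- exact: dist_tri.
- move=> x e e0; have := joined_near x e0; apply: filterS => y [l jl].
  exact: le_lt_trans (dist_le jl).
- exact: nbhs_dist.
- exact: dist_split.
- move=> x; have [i di] := rm_dom_cover hM x.
  have [r /= r0 Hr] := (iffLR (nbhs_ballP _ _) (img_nbhs hM (imgP di))).
  have hb w : `|w - phi i x| <= r / 2 -> img i w.
    by move=> h; apply: Hr; rewrite -ball_normE /= distrC; apply: le_lt_trans h _; lra.
  exists (psi i @` [set w | `|w - phi i x| <= r / 2]).
    apply: continuous_compact; last exact: cball_compact_rV.
    by apply/subspace_continuousP => u /= /hb hu; apply: cvg_within_filter; exact: (psi_cont hM).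
  near=> y; have dy : dom i y by near: y; exact: dom_nbhs.
  exists (phi i y); last exact: (phiK hM).
  apply/ltW; near: y; have r20 : 0 < r / 2 by lra.
  have /cvgrPdist_lt/(_ _ r20) := phi_cont hM di.
  by apply: filterS => y; rewrite distrC.
Unshelve. all: by end_near. Qed.

End LocalEstimates.

(** * Products with a Euclidean space *)

Section RowMx.
Context {R : realType}.

Lemma derive_row_mx (V : normedModType R) m n (f : V -> 'rV[R]_m) (g : V -> 'rV[R]_n) x v :
  derivable f x v -> derivable g x v ->
  derivable (fun y => row_mx (f y) (g y)) x v /\
  'D_v (fun y => row_mx (f y) (g y)) x = row_mx ('D_v f x) ('D_v g x).
Proof.
move=> df dg; have El j : (fun y => row_mx (f y) (g y) 0 (lshift n j)) = (fun y => f y 0 j).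
  by apply/funext => y; rewrite row_mxEl.
have Er j : (fun y => row_mx (f y) (g y) 0 (rshift m j)) = (fun y => g y 0 j).
  by apply/funext => y; rewrite row_mxEr.
have d : derivable (fun y => row_mx (f y) (g y)) x v.
  apply/derivable_mxP => i j; rewrite ord1; case: (split_ordP j) => k ->.
    by rewrite El; exact: (iffLR (derivable_mxP _ _ _) df).
  by rewrite Er; exact: (iffLR (derivable_mxP _ _ _) dg).
split=> //; rewrite derive_mx//; apply/rowP => j; rewrite mxE.
case: (split_ordP j) => k ->.
  by rewrite El row_mxEl derive_mx// mxE.
by rewrite Er row_mxEr derive_mx// mxE.
Qed.

Lemma Ck_row_mx (V : normedModType R) m n k (O : set V) (f : V -> 'rV[R]_m) (g : V -> 'rV[R]_n) :
  open O -> Ck k O f -> Ck k O g -> Ck k O (fun y => row_mx (f y) (g y)).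
Proof.
move=> oO Cf Cg; apply/Ck_rowP => // j; case: (split_ordP j) => a ->.
  have := (Ck_rowP _ _ oO).1 Cf a; apply: Ck_ext => // y _; by rewrite row_mxEl.
have := (Ck_rowP _ _ oO).1 Cg a; apply: Ck_ext => // y _; by rewrite row_mxEr.
Qed.

Lemma Ck_row_mxP (V : normedModType R) m n k (O : set V) (f : V -> 'rV[R]_m) (g : V -> 'rV[R]_n) :
  open O -> Ck k O (fun y => row_mx (f y) (g y)) -> Ck k O f /\ Ck k O g.
Proof.
move=> oO /(Ck_rowP _ _ oO) C; split; apply/Ck_rowP => // j.
  by have := C (lshift n j); apply: Ck_ext => // y _; rewrite row_mxEl.
by have := C (rshift m j); apply: Ck_ext => // y _; rewrite row_mxEr.
Qed.

End RowMx.

Section Product.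
Context {R : realType} {N n : nat} (X : riem_data R N) (hX : is_riemannian X).
Notation Z := (riem_prod X (euclidean n)).

Lemma Q_prod (i : idx X) (a v : 'rV[R]_N) (b w : 'rV[R]_n) :
  Q (M := Z) (i, tt) (row_mx a b) (row_mx v w) = Q i a v + sqn w.
Proof.
rewrite /Q /qform /= row_mxKl mul_row_block !mulmx0 addr0 add0r mulmx1.
rewrite tr_row_mx mul_row_col mxE; congr (_ + _).
by rewrite mxE; apply: eq_bigr => k _; rewrite mxE expr2.
Qed.

Lemma prod_curve (c : R -> Z) : C1_curve c ->
  C1_curve (fun t => (c t).1 : X) /\ Ck 1 setT (fun t : R => (c t).2 : 'rV[R]_n).
Proof.
move=> [cc C].
have c1 : continuous (fun t => (c t).1 : X).
  by move=> t; apply: (@continuous_comp _ _ _ c fst) => //; [exact: cc|exact: cvg_fst].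
have oi (i : idx X) : open ((fun t => (c t).1 : X) @^-1` dom i) by exact: preimage_dom_open.
have E (i : idx X) : (c @^-1` dom (r := Z) (i, tt)) = (fun t => (c t).1 : X) @^-1` dom i.
  by apply/seteqP; split=> [t [di _] //|t di]; split.
have H (i : idx X) := C (i, tt).
have {}H (i : idx X) : Ck 1 ((fun t => (c t).1 : X) @^-1` dom i : set R)
    (fun t : R => row_mx (phi i (c t).1) (c t).2).
  by have := H i; rewrite E.
split.
  split; first exact: c1.
  by move=> i; have [] := Ck_row_mxP (oi i) (H i).
apply: Ck_local => t _; have [i di] := rm_dom_cover hX (c t).1.
exists ((fun t => (c t).1 : X) @^-1` dom i); split; [exact: oi|exact: di|].
by have [] := Ck_row_mxP (oi i) (H i).
Qed.

Lemma prod_curve_inv (c : R -> X) (v : R -> 'rV[R]_n) : C1_curve c -> Ck 1 setT v ->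
  C1_curve (M := Z) (fun t => (c t, v t)).
Proof.
move=> [cc C] Cv.
have cv : continuous v by move=> t; exact: Ck_continuous Cv I.
have ccv : continuous (fun t => (c t, v t) : Z).
  by move=> t; exact: (cvg_pair (cc t) (cv t)).
split; first exact: ccv.
move=> [i u]; destruct u; have oi : open (c @^-1` dom i) by exact: preimage_dom_open.
have -> : (fun t => (c t, v t) : Z) @^-1` dom (r := Z) (i, tt) = c @^-1` dom i.
  by apply/seteqP; split=> [t [di _] //|t di]; split.
suff : Ck 1 (c @^-1` dom i : set R) (fun t : R => row_mx (phi i (c t)) (v t)) by [].
by apply: Ck_row_mx; [exact: oi|exact: C|exact: Ck_subset Cv].
Qed.

Lemma prod_speed (c : R -> Z) (s1 : R -> R) t (i : idx X) : C1_curve c ->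
  is_speed (fun t => (c t).1 : X) s1 -> dom i (c t).1 ->
  Num.sqrt (Q (M := Z) (i, tt) (phi (r := Z) (i, tt) (c t)) (derive1 (phi (r := Z) (i, tt) \o c) t)) =
  Num.sqrt (s1 t ^+ 2 + sqn ('D_1 (fun t : R => (c t).2 : 'rV[R]_n) t)).
Proof.
move=> Cc sp di; have [C1 C2] := prod_curve Cc.
have [_ E] := derive_row_mx (C1_derivable C1 di) (Ck_derivable (v := (1 : R)) C2 I : derivable (fun t : R => (c t).2 : 'rV[R]_n) t 1).
have E1 : derive1 (phi (r := Z) (i, tt) \o c) t = row_mx ('D_1 (phi i \o (fun t => (c t).1 : X)) t) ('D_1 (fun t : R => (c t).2 : 'rV[R]_n) t).
  by rewrite derive1E -E.
rewrite E1; have := Q_prod i (phi i (c t).1) ('D_1 (phi i \o (fun t => (c t).1 : X)) t) (c t).2 ('D_1 (fun t : R => (c t).2 : 'rV[R]_n) t).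
move=> E2; apply: (congr1 Num.sqrt); apply: etrans E2 _; congr (_ + _).
by rewrite (speedP sp di) sqr_sqrtr// Q_ge0//; exact: imgP.
Qed.

Lemma sqn_continuous (T : topologicalType) (f : T -> 'rV[R]_n) (a : T) :
  {for a, continuous f} -> {for a, continuous (fun t => sqn (f t))}.
Proof.
move=> cf; suff : sqn (f t) @[t --> a] --> sqn (f a) by [].
apply: cvg_sum_fin => k.
have ck : {for a, continuous (fun t => f t 0 k)}.
  by apply: (@continuous_comp _ _ _ f (fun M : 'rV[R]_n => M 0 k) a cf); exact: coord_continuous.
exact: (continuousM ck ck).
Qed.

(** The speed in the product is the square root of a sum of squares, so it dominates the speed in
    [X] and every coordinate of the Euclidean velocity. *)
Lemma prod_dist_aux (c : R -> Z) (s : R -> R) : C1_curve c -> is_speed c s ->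
  let l := \int[lebesgue_measure]_(t in `[0, 1]%classic) s t in
  riem_dist (c 0).1 (c 1).1 <= l /\ forall k, `|(c 1).2 0 k - (c 0).2 0 k| <= l.
Proof.
move=> Cc sp l; have [C1 C2] := prod_curve Cc.
have [s1 sp1] := speed_exists hX C1.
have cs1 := speed_continuous hX C1 sp1.
pose w := 'D_1 (fun t : R => (c t).2 : 'rV[R]_n).
have sE t : s t = Num.sqrt (s1 t ^+ 2 + sqn (w t)).
  have [i di] := rm_dom_cover hX (c t).1.
  rewrite -(prod_speed Cc sp1 di).
  by apply: (sp t (i, tt)).
have cw : continuous w.
  by move=> t; have [_ /(_ 1)[_ [+ _]]] := C2; apply.
have cs : continuous s.
  have -> : s = (fun t => Num.sqrt (s1 t ^+ 2 + sqn (w t))) by apply/funext.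
  move=> t; apply: (@continuous_comp _ _ _ (fun t => s1 t ^+ 2 + sqn (w t)) Num.sqrt); last exact: sqrt_continuous.
  apply: continuousD; last by apply: sqn_continuous; exact: cw.
  exact: (continuousM (cs1 t) (cs1 t)).
have [S dS] := primitive_exists cs; have [S1 dS1] := primitive_exists cs1.
rewrite /l (integral_derive cs dS); split.
  apply: (@le_trans _ _ (S1 1 - S1 0)).
    apply: (dist_le_joined hX); split.
    exact: (@Curve _ _ _ _ _ _ (fun t => (c t).1 : X) s1 S1 C1 sp1 dS1).
  have : (S - S1) 0 <= (S - S1) 1.
    apply: (@nondecreasing_from_derive R _ (fun t => s t - s1 t) 0 1 ler01) => t ht.
      exact: is_deriveB (dS t ht) (dS1 t ht).
    have h := speed_ge0 hX t sp1.
    by rewrite subr_ge0 sE -[leLHS](ger0_norm h) -sqrtr_sqr ler_wsqrtr// lerDl sqn_ge0.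
  rewrite !fctE; lra.
move=> k.
have dk (t : R) : is_derive t 1 (fun t : R => (c t).2 0 k) (w t 0 k).
  have d := Ck_derivable (v := (1 : R)) C2 I : derivable (fun t : R => (c t).2 : 'rV[R]_n) t 1.
  have dd : derivable (fun t : R => (c t).2 0 k) t 1 by exact: (iffLR (derivable_mxP _ _ _) d).
  by apply: DeriveDef => //; rewrite /w derive_mx// mxE.
have ws t : `|w t 0 k| <= s t.
  rewrite sE -sqrtr_sqr ler_wsqrtr// (le_trans (coord_sqn _ _))// lerDr sqr_ge0//.
have h1 : S 0 - (c 0).2 0 k <= S 1 - (c 1).2 0 k.
  apply: (@nondecreasing_from_derive R (fun t => S t - (c t).2 0 k) (fun t => s t - w t 0 k) 0 1 ler01) => t ht.
    exact: is_deriveB (dS t ht) (dk t).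
  by have := ws t; rewrite ler_norml => /andP[_]; rewrite subr_ge0.
have h2 : S 0 + (c 0).2 0 k <= S 1 + (c 1).2 0 k.
  apply: (@nondecreasing_from_derive R (fun t => S t + (c t).2 0 k) (fun t => s t + w t 0 k) 0 1 ler01) => t ht.
    exact: is_deriveD (dS t ht) (dk t).
  by have := ws t; rewrite ler_norml => /andP[h _]; lra.
rewrite ler_norml; apply/andP; split; lra.
Qed.

Lemma prod_curve_exists (z z' : Z) : exists (c : R -> Z) s,
  [/\ C1_curve c, c 0 = z, c 1 = z' & is_speed c s].
Proof.
have [l [u]] := joined_exists hX z.1 z'.1.
pose v (t : R) : 'rV[R]_n := z.2 + t *: (z'.2 - z.2).
have Cv : Ck 1 setT v.
  apply: Ck_add; [exact: openT|exact: Ck_cst|].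
  apply/Ck_rowP; first exact: openT.
  move=> j; apply: (@Ck_ext _ _ _ 1 setT (fun t : R => t * (z'.2 - z.2) 0 j)).
  - exact: openT.
  - by move=> t _; rewrite [RHS]mxE.
  - by apply: Ck_mul; [exact: openT|exact: Ck_id|exact: Ck_cst].
have Cc := prod_curve_inv (cv_C1 u) Cv.
exists (fun t => (cv u t, v t)), (fun t => Num.sqrt (sp u t ^+ 2 + sqn ('D_1 v t))); split.
- exact: Cc.
- by rewrite (cv0 u) /v scale0r addr0 -surjective_pairing.
- by rewrite (cv1 u) /v scale1r addrC subrK -surjective_pairing.
- move=> t [i w] [di _]; destruct w.
  exact: esym (prod_speed Cc (@cv_speed _ _ _ _ _ _ u) di).
Qed.

(** The distance of the product enters the final estimate through these bounds. They are read off
    the defining infimum, whose set has to be nonempty as [inf] of the empty set is [0]. *)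
Lemma prod_dist (z z' : Z) : riem_dist z.1 z'.1 <= riem_dist z z' /\
  `|z.2 - z'.2| <= riem_dist z z'.
Proof.
have ne : [set l : R | exists (c : R -> Z) (s : R -> R),
    [/\ C1_curve c, c 0 = z, c 1 = z', is_speed c s
      & l = \int[lebesgue_measure]_(t in `[0, 1]%classic) s t]] !=set0.
  have [c [s [Cc c0 c1 sp]]] := prod_curve_exists z z'.
  by exists (\int[lebesgue_measure]_(t in `[0, 1]%classic) s t), c, s.
split.
  apply: lb_le_inf => // l [c [s [Cc c0 c1 sp ->]]].
  by have [+ _] := prod_dist_aux Cc sp; rewrite c0 c1.
have H k : `|z.2 0 k - z'.2 0 k| <= riem_dist z z'.
  apply: lb_le_inf => // l [c [s [Cc c0 c1 sp ->]]].
  by have [_ /(_ k)] := prod_dist_aux Cc sp; rewrite c0 c1 distrC.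
(* Nonnegativity is a separate goal: for [n = 0] there is no coordinate to give it. *)
apply: normr_rV_le; last by move=> k; rewrite !mxE; exact: H.
apply: lb_le_inf => // l [c [s [Cc c0 c1 sp ->]]].
by have [+ _] := prod_dist_aux Cc sp; apply: le_trans; exact: dist_ge0.
Qed.

End Product.

(** * Orientability of uniformly contractible manifolds *)

Section Signs.
Context {R : realType}.

Lemma det_continuous (T : topologicalType) n (f : T -> 'M[R]_n) (a : T) :
  {for a, continuous f} -> {for a, continuous (fun t => \det (f t))}.
Proof.
move=> cf; suff : \det (f t) @[t --> a] --> \det (f a) by [].
apply: cvg_sum_fin => s; apply: cvgM; first exact: cvg_cst.
elim: (index_enum _) => [|i l IH].
  rewrite big_nil; under eq_cvg do rewrite big_nil; exact: cvg_cst.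
rewrite big_cons; under eq_cvg do rewrite big_cons; apply: cvgM; last exact: IH.
move: (perm.fun_of_perm.body s i) => j.
by apply: (@continuous_comp _ _ _ f (fun M : 'M[R]_n => M i j) a cf); exact: coord_continuous.
Qed.

Lemma continuous_mx (T : topologicalType) m n (f : T -> 'M[R]_(m, n)) (x : T) :
  (forall a b, {for x, continuous (fun y => f y a b)}) -> {for x, continuous f}.
Proof.
move=> fc; apply/cvgrPdist_le => e e0; near=> y.
rewrite [leLHS]/Num.Def.normr/= mx_normrE; apply/bigmax_le; first exact: ltW.
move=> [a b] _ /=; rewrite !mxE.
move: a b; near: y; apply: filter_forall => a; apply: filter_forall => b.
by have /cvgrPdist_le := fc a b; apply.
Unshelve. all: by end_near. Qed.

Lemma near_eq_continuous (T U : topologicalType) (f g : T -> U) (x : T) :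
  {for x, continuous f} -> (\forall y \near x, f y = g y) -> {for x, continuous g}.
Proof.
move=> cf fg; suff : g y @[y --> x] --> g x by [].
by rewrite -(nbhs_singleton fg); apply: cvg_trans cf; exact: near_eq_cvg.
Qed.

Lemma sgz_locally_constant (T : topologicalType) (f : T -> R) (a : T) :
  {for a, continuous f} -> f a != 0 -> \forall b \near a, sgz (f b) = sgz (f a).
Proof.
move=> cf; rewrite neq_lt => /orP[f0|f0].
  have H : \forall b \near a, f b < 0 by apply: (cf [set u | u < 0]); exact: lt_nbhsl.
  by apply: filterS H => b fb; rewrite !ltr0_sgz.
have H : \forall b \near a, 0 < f b by apply: (cf [set u | 0 < u]); exact: lt_nbhsr.
by apply: filterS H => b fb; rewrite !gtr0_sgz.
Qed.

Lemma sgz_pm (x : R) : x != 0 -> sgz x = 1 \/ sgz x = -1.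
Proof. by rewrite neq_lt => /orP[/ltr0_sgz ->|/gtr0_sgz ->]; [right|left]. Qed.

(** Connectedness of [[0, 1]] for a property that spreads locally. The boolean selects the end to
    start from, as both directions will occur; the infimum of the times reached is shown to be
    [0]. *)
Lemma interval_propagate (P : R -> Prop) (b : bool) : P b%:R ->
  (forall t, 0 <= t <= 1 -> exists2 e : R, 0 < e & forall u v, 0 <= u <= 1 -> 0 <= v <= 1 ->
     `|u - t| < e -> `|v - t| < e -> P u -> P v) -> P (~~ b)%:R.
Proof.
wlog -> : b P / b = true => [wl|].
  case: b => [|P0 H]; first exact: wl.
  have := wl true (fun t => P (1 - t)) erefl; rewrite /= subrr subr0; apply=> // t t01.
  have [|e e0 He] := H (1 - t); first by lra.
  exists e => // u v u01 v01 h1 h2; apply: He; try lra.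
    by rewrite (_ : 1 - u - (1 - t) = - (u - t)) ?normrN//; ring.
  by rewrite (_ : 1 - v - (1 - t) = - (v - t)) ?normrN//; ring.
move=> P1 H; pose E := [set t : R | 0 <= t <= 1 /\ P t].
have hE : has_inf E by split; [exists 1; rewrite /E /= ler01 lexx|exists 0 => t [/andP[]]].
set m := inf E.
have m0 : 0 <= m by apply: lb_le_inf; [case: hE|move=> t [/andP[]]].
have m1 : m <= 1 by apply: ge_inf; [case: hE|rewrite /E /= ler01 lexx].
have [|e e0 He] := H m; first by rewrite m0.
have [u [u01 Pu] um] := inf_adherent e0 hE; rewrite -/m in um.
have mu : m <= u by apply: ge_inf; [case: hE|].
pose v := Num.max 0 (m - e / 2).
have v01 : 0 <= v <= 1 by rewrite le_max lexx /= ge_max ler01 /=; lra.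
have vm : `|v - m| < e.
  have vlem : v <= m by rewrite ge_max m0 /=; lra.
  have : m - e / 2 <= v by rewrite le_max lexx orbT.
  rewrite ler0_norm ?subr_le0//; lra.
have Pv : P v.
  by apply: (He u v) => //; rewrite ger0_norm ?subr_ge0//; lra.
have mv : m <= v by apply: ge_inf; [case: hE|].
have v0 : v = 0.
  have : m <= Num.max 0 (m - e / 2) := mv.
  rewrite /v; case: (leP 0 (m - e / 2)) => // h; lra.
have -> // : (~~ true)%:R = v by rewrite v0.
Qed.

End Signs.

Section Orientation.
Context {R : realType} {N : nat} (M : riem_data R N) (hM : is_riemannian M).
Implicit Types (i j k : idx M) (x y z : M).

(* sealed, so that unification never unfolds a Jacobian *)
Fact sg_key : {f : idx M -> idx M -> M -> int | forall i j x, f i j x = sgz (\det (Jac i j x))}.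
Proof. by exists (fun i j x => sgz (\det (Jac i j x))). Qed.

Definition sg : idx M -> idx M -> M -> int := sval sg_key.

Lemma sgE i j x : sg i j x = sgz (\det (Jac i j x)).
Proof. exact: (svalP sg_key). Qed.

Lemma detJ_neq0 i j x : dom i x -> dom j x -> \det (Jac i j x) != 0.
Proof. by move=> di dj; have := Jac_unit hM di dj; rewrite unitmxE unitfE. Qed.

Lemma sg_pm i j x : dom i x -> dom j x -> sg i j x = 1 \/ sg i j x = -1.
Proof. by move=> di dj; rewrite sgE; apply: sgz_pm; exact: detJ_neq0. Qed.

Lemma sg_comp i j k x : dom i x -> dom j x -> dom k x -> sg i k x = sg i j x * sg j k x.
Proof. by move=> di dj dk; rewrite !sgE (Jac_comp hM di dj dk) det_mulmx sgzM. Qed.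

Lemma sg_near i j x : dom i x -> dom j x -> \forall y \near x, sg i j y = sg i j x.
Proof.
move=> di dj; have -> : sg i j = (fun y => sgz (\det (Jac i j y))) by apply/funext => y; rewrite sgE.
apply: sgz_locally_constant; last exact: detJ_neq0.
apply: det_continuous.
have pc : {for x, continuous (phi i)} by exact: phi_cont.
apply: continuous_mx => a b.
have E z : dom i z -> dom j z -> Jac i j z a b = 'D_(delta_mx 0 a) (trans i j) (phi i z) 0 b.
  move=> di' dj'; have := row_jacobian a (trans_diff hM di' dj').
  by move=> /rowP/(_ b); rewrite mxE.
have [_ /(_ (delta_mx 0 a))[_ C]] := @trans_smooth _ _ _ hM i j 1%N.
have [cD _] := C; have := cD _ (overlapP di dj).
move=> /continuous_rowP/(_ b) c1.
have c2 : {for x, continuous (fun y => 'D_(delta_mx 0 a) (trans i j) (phi i y) 0 b)}.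
  exact: (@continuous_comp _ _ _ (phi i) (fun u => 'D_(delta_mx 0 a) (trans i j) u 0 b) x pc c1).
apply: (near_eq_continuous c2).
near=> y; apply: esym; apply: E; near: y; exact: dom_nbhs.
Unshelve. all: by end_near. Qed.

Definition orient_along (T : topologicalType) (h : T -> M) (W : set T) (a : T -> idx M -> int) :=
  forall w, W w -> [/\ forall i, dom i (h w) -> a w i = 1 \/ a w i = -1,
    forall i j, dom i (h w) -> dom j (h w) -> a w i = sg i j (h w) * a w j
  & forall i, dom i (h w) -> \forall w' \near w, W w' -> a w' i = a w i].

Definition cont_on (T : topologicalType) (h : T -> M) (W : set T) :=
  forall w, W w -> forall V : set M, nbhs (h w) V -> \forall w' \near w, W w' -> V (h w').

Lemma orient_along_sub (T : topologicalType) (h : T -> M) (W W' : set T) a :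
  W' `<=` W -> orient_along h W a -> orient_along h W' a.
Proof.
move=> WW Ha w /WW/Ha[H1 H2 H3]; split=> // i di; apply: filterS (H3 i di) => w' H /WW; exact: H.
Qed.

Lemma cont_on_sub (T : topologicalType) (h : T -> M) (W W' : set T) :
  W' `<=` W -> cont_on h W -> cont_on h W'.
Proof.
by move=> WW Ha w /WW/Ha H V /H; apply: filterS => w' {}H /WW; exact: H.
Qed.

(** In a single chart both orientations are locally constant along the path, so their agreement
    spreads from one end to the other. *)
Lemma orient_along_unique (T : topologicalType) (h : T -> M) (W : set T) a a' (c : R -> T) (b : bool) :
  cont_on h W -> orient_along h W a -> orient_along h W a' ->
  continuous c -> (forall t, 0 <= t <= 1 -> W (c t)) ->
  (forall i, dom i (h (c b%:R)) -> a (c b%:R) i = a' (c b%:R) i) ->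
  forall i, dom i (h (c (~~ b)%:R)) -> a (c (~~ b)%:R) i = a' (c (~~ b)%:R) i.
Proof.
move=> ch Ha Ha' cc cW Hb.
apply: (@interval_propagate R (fun t => forall i, dom i (h (c t)) -> a (c t) i = a' (c t) i) b Hb) => t t01.
have [i di] := rm_dom_cover hM (h (c t)).
have [_ _ H1] := Ha _ (cW t t01); have [_ _ H2] := Ha' _ (cW t t01).
have H : \forall u \near t, W (c u) -> [/\ dom i (h (c u)), a (c u) i = a (c t) i & a' (c u) i = a' (c t) i].
  have h1 : nbhs (c t) (fun w => W w -> dom i (h w)) := ch _ (cW t t01) _ (dom_nbhs hM di).
  have h2 : nbhs (c t) (fun w => W w -> a w i = a (c t) i) := H1 i di.
  have h3 : nbhs (c t) (fun w => W w -> a' w i = a' (c t) i) := H2 i di.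
  have g1 : \forall u \near t, W (c u) -> dom i (h (c u)) := cc t _ h1.
  have g2 : \forall u \near t, W (c u) -> a (c u) i = a (c t) i := cc t _ h2.
  have g3 : \forall u \near t, W (c u) -> a' (c u) i = a' (c t) i := cc t _ h3.
  by near=> u => Wu; split; [apply: (near g1 u)|apply: (near g2 u)|apply: (near g3 u)].
have [e /= e0 He] := (iffLR (nbhs_ballP _ _) H).
exists e => // u v u01 v01 ut vt Pu j dj.
have [du au a'u] : [/\ dom i (h (c u)), a (c u) i = a (c t) i & a' (c u) i = a' (c t) i].
  by apply: He; [rewrite /ball /= distrC|exact: cW].
have [dv av a'v] : [/\ dom i (h (c v)), a (c v) i = a (c t) i & a' (c v) i = a' (c t) i].
  by apply: He; [rewrite /ball /= distrC|exact: cW].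
have [_ C1 _] := Ha _ (cW v v01); have [_ C2 _] := Ha' _ (cW v v01).
by rewrite (C1 j i dj dv) (C2 j i dj dv) av a'v -au -a'u Pu.
Unshelve. all: by end_near. Qed.

Lemma mul_pm (x y : int) : x = 1 \/ x = -1 -> y = 1 \/ y = -1 -> x * y = 1 \/ x * y = -1.
Proof. by move=> [->|->] [->|->]; [left|right|right|left]. Qed.

(** The pull-back is oriented by the chart [ip] at time [1], where the homotopy is constant, and the
    orientation is extended down to time [0] over a tube around [y0] that shrinks finitely often. *)
Lemma tube_orientation (h : R * M -> M) (A : set M) (p y0 : M) (ip : idx M) :
  cont_on h (`[0, 1]%classic `*` A) -> (forall y, A y -> h (1, y) = p) -> dom ip p -> A y0 ->
  exists2 U : set M, nbhs y0 U & exists a, orient_along h (`[0, 1]%classic `*` (U `&` A)) a /\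
    forall y, U y -> A y -> forall i, dom i p -> a (1, y) i = sg i ip p.
Proof.
move=> ch h1 dp Ay0.
pose WW (t : R) (U : set M) := `[t, 1]%classic `*` (U `&` A) : set (R * M).
pose P (t : R) := exists2 U : set M, nbhs y0 U & exists a, orient_along h (WW t U) a /\
    forall y, U y -> A y -> forall i, dom i p -> a (1, y) i = sg i ip p.
suff : P (~~ true)%:R by [].
apply: interval_propagate.
  exists setT; first exact: filterT.
  exists (fun _ i => sg i ip p); split=> // -[s y] [/= s1 [_ Ay]].
  have hp : h (s, y) = p.
    by move: s1; rewrite in_itv /= => s1; rewrite (_ : s = 1) ?h1//; apply/eqP; rewrite eq_le andbC.
  split=> [i|i j|i]; rewrite ?hp => di.
  - exact: sg_pm.
  - by move=> dj; exact: sg_comp.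
  - by near=> w'.
move=> t t01; have W0t : (`[0, 1]%classic `*` A) (t, y0) by split; rewrite //= in_itv.
have [i di] := rm_dom_cover hM (h (t, y0)).
have := ch _ W0t _ (dom_nbhs hM di).
move=> [[V1 U1] /= [tV1 yU1] HVU].
have [e /= e0 He] := (iffLR (nbhs_ballP _ _) tV1).
exists e => // u v /andP[u0 u1] /andP[v0 v1] ut vt [U yU [a [Ha na]]].
have dz s y : v <= s -> s <= u -> (U `&` U1) y -> A y -> dom i (h (s, y)).
  move=> vs su [_ U1y] Ay; apply: (HVU (s, y)).
    split=> //; apply: He; rewrite /ball /= distrC.
    by move: ut vt; rewrite !ltr_norml => /andP[? ?] /andP[? ?]; apply/andP; split; lra.
  by split=> //=; rewrite in_itv /=; apply/andP; split; lra.
have [uv|vu] := leP u v.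
  exists U => //; exists a; split=> //; apply: orient_along_sub Ha.
  by move=> [s y] [/= ]; rewrite !in_itv /= => /andP[h2 h3] h4; split=> //=; rewrite in_itv /= h3 andbT; exact: le_trans h2.
exists (U `&` U1); first exact: filterI.
(* Below time [u] the added part of the tube is mapped into the chart [i], in which the sign known
   at time [u] is kept. *)
exists (fun w j => if u <= w.1 then a w j else sg j i (h w) * a (u, w.2) i); split; last first.
  by move=> y [Uy _] Ay j dj; rewrite /= u1; exact: na.
move=> [s y] [/=]; rewrite in_itv /= => /andP[vs s1] [[Uy U1y] Ay].
have Wu : WW u U (u, y) by split; rewrite //= in_itv /= lexx.
have dui : dom i (h (u, y)) by apply: dz => //; exact: ltW.
have [a1 a2 a3] := Ha _ Wu.
have W0s : (`[0, 1]%classic `*` A) (s, y).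
  by split=> //=; rewrite in_itv /= s1 andbT; exact: le_trans vs.
split=> [j dj|j k dj dk|j dj]; rewrite /=.
- case: (leP u s) => us.
    have [|b1 _ _] := Ha (s, y); last exact: b1.
    by split; rewrite //= in_itv /= us.
  have dsi : dom i (h (s, y)) by apply: dz => //; exact: ltW.
  by apply: mul_pm; [exact: sg_pm|exact: a1].
- case: (leP u s) => us.
    have [|_ b2 _] := Ha (s, y); last exact: b2.
    by split; rewrite //= in_itv /= us.
  have dsi : dom i (h (s, y)) by apply: dz => //; exact: ltW.
  by rewrite (sg_comp dj dk dsi) -mulrA.
- have F1 : u <= s -> \forall w' \near (s, y), WW v (U `&` U1) w' -> u <= w'.1 -> a w' j = a (s, y) j.
    move=> us; have [|_ _ b3] := Ha (s, y); first by split; rewrite //= in_itv /= us.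
    have := b3 j dj; apply: filterS => -[s' y'] H [/=]; rewrite in_itv /= => /andP[_ s'1] [[Uy' _] Ay'] us'.
    by apply: H; split; rewrite //= in_itv /= us'.
  have F2 : s <= u -> \forall w' \near (s, y), WW v (U `&` U1) w' -> w'.1 < u ->
      sg j i (h w') * a (u, w'.2) i = sg j i (h (s, y)) * a (u, y) i.
    move=> su; have dsi : dom i (h (s, y)) by exact: dz.
    have n1 := ch _ W0s _ (sg_near dj dsi).
    have n2 : \forall w' \near (s, y), WW u U (u, w'.2) -> a (u, w'.2) i = a (u, y) i.
      have [[B1 B2] /= [uB1 yB2] HB] := a3 i dui.
      exists (setT, B2) => /=; first by split=> //; exact: filterT.
      by move=> [s' y'] [_ /= By']; apply: (HB (u, y')); split=> //=; exact: nbhs_singleton.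
    near=> w' => Ww' lu.
    have [w1 [[w2 w3] w4]] := Ww'; rewrite /= in_itv /= in w1; have /andP[w5 w6] := w1.
    congr (_ * _); first by apply: (near n1 w') => //; split=> //=; rewrite in_itv /= w6 andbT; exact: le_trans w5.
    by apply: (near n2 w') => //; split; rewrite //= in_itv /= lexx.
  have [us|su|us] := ltgtP u s.
  + have n3 : \forall w' \near (s, y), u < w'.1.
      exists ([set r | u < r], setT) => /=; first by split; [exact: lt_nbhsr|exact: filterT].
      by move=> [s' y'] [].
    near=> w' => Ww'; have lt' : u < w'.1 by apply: (near n3 w').
    by rewrite (ltW lt'); apply: (near (F1 (ltW us)) w') => //; exact: ltW.
  + have n3 : \forall w' \near (s, y), w'.1 < u.
      exists ([set r | r < u], setT) => /=; first by split; [exact: lt_nbhsl|exact: filterT].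
      by move=> [s' y'] [].
    near=> w' => Ww'; have lt' : w'.1 < u by apply: (near n3 w').
    by rewrite leNgt lt' /=; apply: (near (F2 (ltW su)) w').
  (* At time [u] the two formulas agree, by the compatibility of [a] with changes of chart. *)
  + have us1 : u <= s by rewrite us. have us2 : s <= u by rewrite us.
    near=> w' => Ww'; case: (leP u w'.1) => lu.
      by apply: (near (F1 us1) w').
    rewrite (near (F2 us2) w')//; rewrite -us -a2//.
    by rewrite us.
Unshelve. all: by end_near. Qed.

(** The tubes give orientations near each point. They agree with each other because they all start
    from the same signs at time [1] and can be compared along [t |-> (t, z)]. *)
Lemma contractible_orientable (A B : set M) : open A -> contractible_inside (R := R) A B ->
  exists a, orient_along id A a.
Proof.
move=> oA [p [h [hc _ _ h0 h1]]].
have [ip dp] := rm_dom_cover hM p.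
pose h' (w : R * M) := h w.1 w.2.
have ch : cont_on h' (`[0, 1]%classic `*` A).
  move=> w Ww V hV; have /subspace_continuousP := hc.
  by move=> /(_ w Ww)/(_ V hV).
have H y : exists a : R * M -> idx M -> int, A y -> exists2 U : set M, nbhs y U &
    orient_along h' (`[0, 1]%classic `*` (U `&` A)) a /\
    forall z, U z -> A z -> forall i, dom i p -> a (1, z) i = sg i ip p.
  have [Ay|nA] := pselect (A y); last by exists (fun _ _ => 0).
  by have [U yU [a Ha]] := tube_orientation ch h1 dp Ay; exists a => _; exists U.
have [f Hf] := choice H.
exists (fun y => f y (0, y)) => y Ay; have [U yU [Ha na]] := Hf y Ay.
have Wy : (`[0, 1]%classic `*` (U `&` A)) ((0 : R), y).
  by split; [rewrite /= in_itv /= lexx ler01|split=> //; exact: nbhs_singleton].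
have h'0 z : A z -> h' (0, z) = z by move=> Az; exact: h0.
have [a1 a2 a3] := Ha _ Wy; rewrite h'0// in a1 a2 a3.
split=> // i di.
have n1 : \forall z \near y, (U `&` A) z -> f y (0, z) i = f y (0, y) i.
  have [[B1 B2] /= [uB1 yB2] HB] := a3 i di.
  apply: filterS yB2 => z Bz UAz; apply: (HB (0, z)); first by split=> //=; exact: nbhs_singleton.
  by split=> //=; rewrite in_itv /= lexx ler01.
near=> z => Az; have Uz : U z by near: z.
have diz : dom i z by near: z; exact: dom_nbhs.
rewrite -(near n1 z)//.
have [U' zU' [Ha' na']] := Hf z Az.
pose W := `[0, 1]%classic `*` [set z] : set (R * M).
have W1 : W `<=` `[0, 1]%classic `*` (U `&` A) by move=> [s z'] [/= ? ->].
have W2 : W `<=` `[0, 1]%classic `*` (U' `&` A).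
  by move=> [s z'] [/= ? ->]; split=> //; split=> //; exact: nbhs_singleton zU'.
have W3 : W `<=` `[0, 1]%classic `*` A by move=> [s z'] [/= ? ->].
apply: (@orient_along_unique _ h' W (f z) (f y) (fun t => (t, z)) true).
- exact: cont_on_sub ch.
- exact: orient_along_sub Ha'.
- exact: orient_along_sub Ha.
- by move=> t; apply: (cvg_pair cvg_id (cvg_cst _)).
- by move=> t t01; split=> //=; rewrite in_itv.
- move=> j dj; have dj' : dom j p by rewrite -(h1 z Az); exact: dj.
  apply: etrans (na' z _ Az j dj') (esym (na z Uz Az j dj')).
  exact: nbhs_singleton zU'.
- by rewrite -[h' _]/(h 0 z) h0.
Unshelve. all: by end_near. Qed.

Lemma orient_along_scale (T : topologicalType) (h : T -> M) (W : set T) a (e : int) :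
  e = 1 \/ e = -1 -> orient_along h W a -> orient_along h W (fun w i => e * a w i).
Proof.
move=> e1 Ha w /Ha[H1 H2 H3]; split=> [i di|i j di dj|i di].
- exact: mul_pm e1 (H1 i di).
- by rewrite (H2 i j di dj) mulrCA.
- by apply: filterS (H3 i di) => w' H /H ->.
Qed.

(** The balls around [x0] exhaust the manifold, and each is oriented by its contraction. Once
    normalized at [x0] these orientations are compatible. *)
Lemma orientable : uniformly_contractible (@riem_dist R N M) ->
  exists o : idx M -> M -> int, is_orientation o.
Proof.
move=> [S [S0 HS]]; have [x0 _] := rm_nonempty hM; have [i0 d0] := rm_dom_cover hM x0.
have lm := riem_length_metric hM.
pose B (n : nat) := dball (@riem_dist R N M) x0 n.+1%:R.
have Bx0 n : B n x0 by rewrite /B /dball /= (dist_refl hM).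
have H n : exists a, orient_along id (B n) a /\ a x0 i0 = 1.
  have [||a Ha] := @contractible_orientable (B n) (dball (@riem_dist R N M) x0 (S n.+1%:R)).
  - exact: (oball_open lm).
  - by apply: HS; exact: ler0n.
  have [H1 _ _] := Ha _ (Bx0 n); have e1 := H1 i0 d0.
  exists (fun w i => a x0 i0 * a w i); split; first exact: orient_along_scale.
  by case: e1 => ->.
have [f Hf] := choice H.
have agree n m x : B n x -> B m x -> forall i, dom i x -> f n x i = f m x i.
  (* A curve from [x0] shorter than both radii stays in both balls. *)
  move=> Bn Bm; have [l [u] lnm] : exists2 l, joined x0 x l & l < Num.min n.+1%:R m.+1%:R.
    by apply: (dist_lt hM); rewrite lt_min; apply/andP.
  have ul := cv_len u.
  have [[Hn n1] [Hm m1]] := (Hf n, Hf m).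
  have H0 i : dom i x0 -> f n x0 i = f m x0 i.
    move=> di; have [_ c1 _] := Hn _ (Bx0 n); have [_ c2 _] := Hm _ (Bx0 m).
    by rewrite (c1 i i0 di d0) (c2 i i0 di d0) n1 m1.
  have := @orient_along_unique _ id (B n `&` B m) (f n) (f m) (cv u) false.
  rewrite /= (cv0 u) (cv1 u); apply.
  - by move=> w _ V; apply: filterS => w' ? _.
  - by apply: orient_along_sub Hn => y [].
  - by apply: orient_along_sub Hm => y [].
  - by have [] := cv_C1 u.
  - move=> t t01; have /andP[t0 t1] := t01.
    have j1 := joined_sub hM u (a := 0) (b := t); rewrite lexx ler01 t0 t1 /= (cv0 u) in j1.
    have j2 := joined_sub hM u (a := t) (b := 1); rewrite lexx ler01 t0 t1 /= in j2.
    have h1 := dist_le_joined hM (j1 isT isT); have h2 := joined_ge0 hM (j2 isT isT).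
    move: lnm; rewrite lt_min => /andP[ln lm'].
    by split; rewrite /B /dball /=; lra.
  - exact: H0.
pose n x := Num.trunc (riem_dist x0 x).
have Bn x : B (n x) x by exact: truncnS_gt.
exists (fun i x => f (n x) x i); split.
- by move=> i x di; have [/(_ _ (Bn x))[H1 _ _] _] := Hf (n x); exact: H1.
- move=> i x di; have [/(_ _ (Bn x))[_ _ H3] _] := Hf (n x).
  have oB : nbhs x (B (n x)).
    by apply: open_nbhs_nbhs; split; [exact: (oball_open lm)|exact: Bn].
  near=> y; have By : B (n x) y by near: y.
  rewrite (agree _ (n x))//; last by near: y; exact: dom_nbhs.
  by apply: (near (H3 i di) y).
- move=> i j x di dj; have [/(_ _ (Bn x))[_ H2 _] _] := Hf (n x).
  by rewrite (H2 i j di dj) sgE.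
Unshelve. all: by end_near. Qed.

Lemma orientation_opp (o : idx M -> M -> int) : is_orientation o -> is_orientation (fun i x => - o i x).
Proof.
move=> [H1 H2 H3]; split=> [i x di|i x di|i j x di dj].
- by case: (H1 i x di) => ->; [right|left; rewrite opprK].
- by apply: filterS (H2 i x di) => y ->.
- by rewrite (H3 i j x di dj) mulrN.
Qed.

End Orientation.

Section ProductOrientation.
Context {R : realType} {N n : nat} (X : riem_data R N) (hX : is_riemannian X).
Notation Z := (riem_prod X (euclidean n)).

Lemma lsubmx_Ck k (O : set 'rV[R]_(N + n)) : open O -> Ck k O (fun y : 'rV[R]_(N + n) => lsubmx y).
Proof.
move=> oO; apply/Ck_rowP => // j; have := Ck_coord k (lshift n j) oO.
by apply: Ck_ext => // y _; rewrite mxE.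
Qed.

Lemma rsubmx_Ck k (O : set 'rV[R]_(N + n)) : open O -> Ck k O (fun y : 'rV[R]_(N + n) => rsubmx y).
Proof.
move=> oO; apply/Ck_rowP => // j; have := Ck_coord k (rshift N j) oO.
by apply: Ck_ext => // y _; rewrite mxE.
Qed.

Definition ztrans (i j : idx X) (y : 'rV[R]_(N + n)) := row_mx (trans i j (lsubmx y)) (rsubmx y).

Definition zoverlap (i j : idx X) : set 'rV[R]_(N + n) := [set y | overlap i j (lsubmx y)].

Lemma zoverlap_open i j : open (zoverlap i j).
Proof.
apply: (@open_comp _ _ (fun y : 'rV[R]_(N + n) => lsubmx y)); last exact: overlap_open.
by move=> y _; exact: Ck_continuous (@lsubmx_Ck 0 setT openT) I.
Qed.

Lemma ztrans_Ck k i j : Ck k (zoverlap i j) (ztrans i j).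
Proof.
have oz := @zoverlap_open i j.
apply: Ck_row_mx => //; last exact: rsubmx_Ck.
apply: (@Ck_comp R _ N N k _ _ (fun y : 'rV[R]_(N + n) => lsubmx y) (trans i j) oz (@overlap_open _ _ _ hX i j)) => //.
  exact: lsubmx_Ck.
exact: (@trans_smooth _ _ _ hX i j k).
Qed.

Lemma ztrans_diff i j x v : dom i x -> dom j x -> differentiable (ztrans i j) (row_mx (phi i x) v).
Proof.
move=> di dj; apply: (Ck1_differentiable (@zoverlap_open i j) (ztrans_Ck 1 i j)).
by rewrite /zoverlap /= row_mxKl; exact: overlapP.
Qed.

Lemma ztrans_jacobian i j x v : dom i x -> dom j x ->
  jacobian (ztrans i j) (row_mx (phi i x) v) = block_mx (Jac i j x) 0 0 1%:M.
Proof.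
move=> di dj; apply/row_matrixP => k; apply: etrans (row_jacobian k (ztrans_diff v di dj)) _.
set w := delta_mx 0 k; set y := row_mx _ _.
have yl : lsubmx y = phi i x by rewrite row_mxKl.
have lin_l : linear (fun u : 'rV[R]_(N + n) => lsubmx u).
  by move=> a b c; apply/rowP => q; rewrite !mxE.
have lin_r : linear (fun u : 'rV[R]_(N + n) => rsubmx u).
  by move=> a b c; apply/rowP => q; rewrite !mxE.
have dl : derivable (fun u : 'rV[R]_(N + n) => lsubmx u) y w.
  exact: Ck_derivable (@lsubmx_Ck 1 setT openT) I.
have dr : derivable (fun u : 'rV[R]_(N + n) => rsubmx u) y w.
  exact: Ck_derivable (@rsubmx_Ck 1 setT openT) I.
have Dl : 'D_w (fun u : 'rV[R]_(N + n) => lsubmx u) y = lsubmx w.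
  rewrite derive_mx//; apply/rowP => q; rewrite !mxE.
  have -> : (fun t : 'rV[R]_(N + n) => lsubmx t 0 q) = (fun t => t 0 (lshift n q)).
    by apply/funext => t; rewrite mxE.
  by have := derive_id y w; rewrite derive_mx => [/rowP/(_ (lshift n q))|]; [rewrite !mxE|exact: derivable_id].
have Dr : 'D_w (fun u : 'rV[R]_(N + n) => rsubmx u) y = rsubmx w.
  rewrite derive_mx//; apply/rowP => q; rewrite !mxE.
  have -> : (fun t : 'rV[R]_(N + n) => rsubmx t 0 q) = (fun t => t 0 (rshift N q)).
    by apply/funext => t; rewrite mxE.
  by have := derive_id y w; rewrite derive_mx => [/rowP/(_ (rshift N q))|]; [rewrite !mxE|exact: derivable_id].
have dt : differentiable (trans i j) (lsubmx y) by rewrite yl; exact: trans_diff.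
have [dc Dc] := derive_chain dl dt.
have [_ E] := derive_row_mx dc dr.
apply: etrans E _; rewrite Dc Dl Dr rowE -/w -(hsubmxK w) mul_row_block !mulmx0 mulmx1 addr0 add0r.
rewrite row_mxKl row_mxKr; congr row_mx.
by rewrite /Jac -yl /jacobian mul_rV_lin1.
Qed.

Lemma prod_orientation (o : idx X -> X -> int) : is_orientation o ->
  is_orientation (fun (i : idx Z) (z : Z) => o i.1 z.1).
Proof.
move=> [H1 H2 H3]; split.
- by move=> i z [di _]; exact: H1.
- by move=> i z [di _]; have := H2 i.1 z.1 di; exact: cvg_fst.
- move=> i j z [di _] [dj _].
  have -> : jacobian (phi j \o psi i) (phi i z) = block_mx (Jac i.1 j.1 z.1) 0 0 1%:M.
    exact: (@ztrans_jacobian i.1 j.1 z.1 z.2 di dj).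
  by rewrite det_ublock det1 mulr1 (H3 i.1 j.1 z.1 di dj).
Qed.

End ProductOrientation.

(** * Normalization onto the sphere *)

Section AngularDistance.
Context {R : realType}.

Definition dotr n (x y : 'rV[R]_n) : R := (x *m y^T) 0 0.

Lemma dotrE n (x y : 'rV[R]_n) : dotr x y = \sum_k x 0 k * y 0 k.
Proof. by rewrite /dotr mxE; apply: eq_bigr => k _; rewrite mxE. Qed.

Lemma dotrC n (x y : 'rV[R]_n) : dotr x y = dotr y x.
Proof. by rewrite !dotrE; apply: eq_bigr => k _; rewrite mulrC. Qed.

Lemma dotrDl n (x y z : 'rV[R]_n) : dotr (x + y) z = dotr x z + dotr y z.
Proof. by rewrite /dotr mulmxDl mxE. Qed.

Lemma dotrNl n (x z : 'rV[R]_n) : dotr (- x) z = - dotr x z.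
Proof. by rewrite /dotr mulNmx mxE. Qed.

Lemma dotrZl n a (x z : 'rV[R]_n) : dotr (a *: x) z = a * dotr x z.
Proof. by rewrite /dotr -scalemxAl mxE. Qed.

Lemma dotr_ge0 n (x : 'rV[R]_n) : 0 <= dotr x x.
Proof. by rewrite dotrE sumr_ge0// => k _; rewrite -expr2 sqr_ge0. Qed.

Lemma dotr_coord n (x : 'rV[R]_n) k : x 0 k ^+ 2 <= dotr x x.
Proof.
by rewrite dotrE (bigD1 k)//= -expr2 lerDl sumr_ge0// => j _; rewrite -expr2 sqr_ge0.
Qed.

Lemma dotrDD n (x y : 'rV[R]_n) : dotr (x + y) (x + y) = dotr x x + dotr y y + 2 * dotr x y.
Proof.
rewrite dotrDl (dotrC x (x + y)) (dotrC y (x + y)) !dotrDl (dotrC y x); ring.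
Qed.

Lemma dotrBB n (x y : 'rV[R]_n) : dotr (x - y) (x - y) = dotr x x + dotr y y - 2 * dotr x y.
Proof.
rewrite dotrDD dotrNl (dotrC y (- y)) dotrNl (dotrC x (- y)) dotrNl (dotrC y x); ring.
Qed.

Lemma dotr_sphere n (x y : 'rV[R]_n.+1) : sphere x -> sphere y -> -1 <= dotr x y <= 1.
Proof.
rewrite /sphere /= -/(dotr x x) -/(dotr y y) => sx sy.
have h1 := dotr_ge0 (x + y); have h2 := dotr_ge0 (x - y).
rewrite dotrDD in h1; rewrite dotrBB in h2; apply/andP; split; lra.
Qed.

Lemma dotr_norm n (x : 'rV[R]_n) : `|x| <= Num.sqrt (dotr x x).
Proof.
rewrite [leLHS]/Num.Def.normr/= mx_normrE; apply/bigmax_le; first exact: sqrtr_ge0.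
move=> [i j] _ /=; rewrite ord1 -sqrtr_sqr; apply: ler_wsqrtr; exact: dotr_coord.
Qed.

Lemma dotr_le n (x : 'rV[R]_n) : dotr x x <= n%:R * `|x| ^+ 2.
Proof.
rewrite dotrE; apply: le_trans (_ : \sum_(k < n) `|x| ^+ 2 <= _); last first.
  by rewrite sumr_const card_ord mulr_natl.
apply: ler_sum => k _; rewrite -expr2 -real_normK ?num_real// lerXn2r ?nnegrE//.
rewrite [leRHS]/Num.Def.normr/= mx_normrE.
exact: (le_bigmax _ (fun ij : 'I_1 * 'I_n => `|x ij.1 ij.2|) (0, k)).
Qed.

(** With ph half of the angle, 1 - z is twice the square of sin ph. If cos ph is at least 1/2, then
    sin ph is at least ph / 2; otherwise the square of sin ph is at least 3/4 while the angle is at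
    most 4. The constant is not sharp. *)
Lemma acos_sqr_le (z : R) : -1 <= z <= 1 -> acos z ^+ 2 <= 32 * (1 - z).
Proof.
move=> z1; have z1' : z \in `[-1, 1] by rewrite in_itv.
set th := acos z; have th0 : 0 <= th by exact: acos_ge0.
have thpi : th <= pi by exact: acos_lepi.
have cth : cos th = z by exact: acosK.
pose ph := th / 2.
have ph0 : 0 <= ph by rewrite divr_ge0.
have ph1 : ph <= pi / 2 by rewrite ler_wpM2r.
have pi4 : (pi : R) <= 4 by have := @pihalf_lt2 R; lra.
have E : 1 - z = 2 * sin ph ^+ 2.
  have -> : z = cos (ph + ph) by rewrite -cth /ph -splitr.
  have := cos2Dsin2 ph; rewrite cosD; lra.
have cph0 : 0 <= cos ph by apply: cos_ge0_pihalf; apply/andP; split=> //; lra.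
have sph0 : 0 <= sin ph by apply: sin_ge0_pi; apply/andP; split=> //; lra.
have cs : cos ph ^+ 2 + sin ph ^+ 2 = 1 by exact: cos2Dsin2.
have [c2|c2] := leP (1 / 2) (cos ph).
  have [xi xi1 xiE] : exists2 xi, xi \in `[0, ph] & sin ph - sin 0 = cos xi * (ph - 0).
    by apply: (MVT_segment ph0); exact/continuous_subspaceT/continuous_sin.
  move: xi1; rewrite in_itv /= => /andP[xi0 xiph].
  have cxi : cos ph <= cos xi.
    rewrite leNgt; apply/negP => h.
    have pi0 := @pi_ge0 R.
    have : ph < xi.
      by rewrite -ltr_cos ?in_itv //=; apply/andP; split=> //; lra.
    by rewrite ltNge xiph.
  move: xiE; rewrite sin0 !subr0 => xiE.
  have th2 : th = 2 * ph by rewrite /ph; lra.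
  have c4 : 0 <= cos xi ^+ 2 - 1 / 4 by nra.
  have := mulr_ge0 c4 (sqr_ge0 ph); have := sqr_ge0 ph.
  rewrite E th2 xiE !exprMn; lra.
have s2 : 3 / 4 <= sin ph ^+ 2 by nra.
have t16 : th ^+ 2 <= 16 by nra.
rewrite E; lra.
Qed.

Lemma sphere_dist_le n (x y : 'rV[R]_n.+1) : sphere x -> sphere y ->
  sphere_dist x y ^+ 2 <= 32 * (1 - dotr x y).
Proof.
by move=> sx sy; apply: acos_sqr_le; exact: dotr_sphere.
Qed.

Definition nrm n (Y : 'rV[R]_n) : 'rV[R]_n := (Num.sqrt (dotr Y Y))^-1 *: Y.

Lemma dotr_gt0 n (Y : 'rV[R]_n) : Y != 0 -> 0 < dotr Y Y.
Proof.
move=> Y0; rewrite lt_def dotr_ge0 andbT; apply: contra Y0 => /eqP E.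
apply/eqP/rowP => k; rewrite mxE; apply/eqP; rewrite -sqrf_eq0 eq_le sqr_ge0 andbT -E.
exact: dotr_coord.
Qed.

Lemma nrm_sphere n (Y : 'rV[R]_n.+1) : Y != 0 -> sphere (nrm Y).
Proof.
move=> /dotr_gt0 Y0; rewrite /sphere /= -/(dotr _ _) /nrm dotrZl dotrC dotrZl mulrA -expr2.
by rewrite exprVn sqr_sqrtr ?ltW// mulVf// gt_eqF.
Qed.

Lemma nrm_id n (Y : 'rV[R]_n.+1) : sphere Y -> nrm Y = Y.
Proof. by rewrite /sphere /= -/(dotr Y Y) /nrm => ->; rewrite sqrtr1 invr1 scale1r. Qed.

Lemma nrm_scale n a (Y : 'rV[R]_n.+1) : 0 < a -> sphere Y -> nrm (a *: Y) = Y.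
Proof.
rewrite /sphere /= -/(dotr Y Y) /nrm => a0 sY.
rewrite dotrZl dotrC dotrZl sY mulr1 -expr2 sqrtr_sqr gtr0_norm// scalerA mulVf ?scale1r//.
by rewrite gt_eqF.
Qed.

(** With [a] and [b] the Euclidean norms, [a * b - dotr Y Y'] is at most half of
    [dotr (Y - Y') (Y - Y')], and [a * b] is at least [k ^+ 2]. The factor [n.+1] comes from the sup
    norm. *)
Lemma nrm_dist n (Y Y' : 'rV[R]_n.+1) (k : R) : 0 < k -> k <= `|Y| -> k <= `|Y'| ->
  sphere_dist (nrm Y) (nrm Y') <= 4 * n.+1%:R * k^-1 * `|Y - Y'|.
Proof.
move=> k0 kY kY'.
have nz (Z : 'rV[R]_n.+1) : k <= `|Z| -> Z != 0.
  by move=> kZ; rewrite -normr_gt0; exact: lt_le_trans kZ.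
have Y0 := dotr_gt0 (nz _ kY); have Y'0 := dotr_gt0 (nz _ kY').
have rhs0 : 0 <= 4 * n.+1%:R * k^-1 * `|Y - Y'|.
  by rewrite !mulr_ge0// invr_ge0 ltW.
have d0 : 0 <= sphere_dist (nrm Y) (nrm Y').
  by apply: acos_ge0; apply: dotr_sphere; apply: nrm_sphere; exact: nz.
rewrite -ler_sqr ?nnegrE//.
apply: le_trans (sphere_dist_le (nrm_sphere (nz _ kY)) (nrm_sphere (nz _ kY'))) _.
set a := Num.sqrt (dotr Y Y); set b := Num.sqrt (dotr Y' Y').
have a2 : a ^+ 2 = dotr Y Y by rewrite sqr_sqrtr// ltW.
have b2 : b ^+ 2 = dotr Y' Y' by rewrite sqr_sqrtr// ltW.
have ka : k <= a := le_trans kY (dotr_norm _).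
have kb : k <= b := le_trans kY' (dotr_norm _).
have -> : dotr (nrm Y) (nrm Y') = dotr Y Y' / (a * b).
  by rewrite /nrm dotrZl dotrC dotrZl (dotrC Y') invfM -/a -/b; ring.
have E : dotr (Y - Y') (Y - Y') = a ^+ 2 + b ^+ 2 - 2 * dotr Y Y'.
  by rewrite a2 b2 dotrBB.
have h := dotr_le (Y - Y'); rewrite E in h.
have a0 : 0 < a := lt_le_trans k0 ka.
have b0 : 0 < b := lt_le_trans k0 kb.
have ab0 : 0 < a * b by rewrite mulr_gt0.
have h2 : 1 - dotr Y Y' / (a * b) <= n.+1%:R * `|Y - Y'| ^+ 2 / (2 * k ^+ 2).
  rewrite ler_pdivlMr ?mulr_gt0 ?exprn_gt0//.
  have -> : 1 - dotr Y Y' / (a * b) = (a * b - dotr Y Y') / (a * b).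
    by field; rewrite !gt_eqF.
  rewrite mulrAC ler_pdivrMr//.
  have kab : k ^+ 2 <= a * b by rewrite expr2 ler_pM// ltW.
  have p0 : 0 <= n.+1%:R * `|Y - Y'| ^+ 2 by rewrite mulr_ge0// sqr_ge0.
  have ab2 := sqr_ge0 (a - b).
  apply: le_trans (_ : n.+1%:R * `|Y - Y'| ^+ 2 * k ^+ 2 <= _); last by rewrite ler_wpM2l.
  rewrite mulrA ler_wpM2r ?sqr_ge0//; nra.
apply: le_trans (ler_wpM2l _ h2) _ => //.
have -> : 32 * (n.+1%:R * `|Y - Y'| ^+ 2 / (2 * k ^+ 2)) = 16 * n.+1%:R * (k^-1 * `|Y - Y'|) ^+ 2.
  by field; rewrite gt_eqF.
have -> : (4 * n.+1%:R * k^-1 * `|Y - Y'|) ^+ 2 = 16 * n.+1%:R * (k^-1 * `|Y - Y'|) ^+ 2 * n.+1%:R by ring.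
by rewrite ler_peMr ?ler1n// mulr_ge0 ?sqr_ge0// mulr_ge0.
Qed.

Lemma nrm_continuous n (Y : 'rV[R]_n) : Y != 0 -> {for Y, continuous (@nrm n)}.
Proof.
move=> Y0; have dc : {for Y, continuous (fun Y : 'rV[R]_n => dotr Y Y)}.
  have -> : (fun Y : 'rV[R]_n => dotr Y Y) = (fun Y => \sum_k Y 0 k * Y 0 k).
    by apply/funext => Z; rewrite dotrE.
  suff : \sum_k Z 0 k * Z 0 k @[Z --> Y] --> \sum_k Y 0 k * Y 0 k by [].
  apply: cvg_sum_fin => k; apply: cvgM; exact: coord_continuous.
apply: continuousZ; last exact: cvg_id.
apply: continuousV; first by rewrite gt_eqF// sqrtr_gt0 dotr_gt0.
by apply: (@continuous_comp _ _ _ (fun Y : 'rV[R]_n => dotr Y Y) Num.sqrt) => //; exact: sqrt_continuous.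
Qed.

End AngularDistance.

(** * Covers of finite asymptotic dimension *)

Lemma subr_coord (V : zmodType) n (A B : 'rV[V]_n) k : (A - B) 0 k = A 0 k - B 0 k.
Proof. by rewrite !mxE. Qed.

Lemma near_normr (R : realType) n (v : 'rV[R]_n) (e : R) : 0 < e -> nbhs v [set w | `|v - w| < e].
Proof.
move=> e0; rewrite (_ : [set w | _] = ball v e); first exact: nbhsx_ballx.
by rewrite -ball_normE.
Qed.

Section Clamp.
Context {R : realType}.

Definition clamp01 (t : R) : R := Num.max 0 (Num.min 1 t).

Lemma max_lip (a b c d : R) : `|Num.max a b - Num.max c d| <= Num.max `|a - c| `|b - d|.
Proof.
have h1 := ler_norm (a - c); have h2 := ler_norm (b - d).
have h3 := ler_norm (c - a); have h4 := ler_norm (d - b).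
rewrite (distrC c a) in h3; rewrite (distrC d b) in h4.
rewrite le_max !ler_norml.
by case: (leP a b) => ?; case: (leP c d) => ?; apply/orP;
  (have [?|?] := leP `|b - d| `|a - c|; [left|right]; apply/andP; split; lra).
Qed.

Lemma min_lip (a b c d : R) : `|Num.min a b - Num.min c d| <= Num.max `|a - c| `|b - d|.
Proof.
have h1 := ler_norm (a - c); have h2 := ler_norm (b - d).
have h3 := ler_norm (c - a); have h4 := ler_norm (d - b).
rewrite (distrC c a) in h3; rewrite (distrC d b) in h4.
rewrite le_max !ler_norml.
by case: (leP a b) => ?; case: (leP c d) => ?; apply/orP;
  (have [?|?] := leP `|b - d| `|a - c|; [left|right]; apply/andP; split; lra).
Qed.

Lemma clamp01_lip (a b : R) : `|clamp01 a - clamp01 b| <= `|a - b|.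
Proof.
apply: le_trans (max_lip _ _ _ _) _; rewrite subrr normr0 ge_max normr_ge0 /=.
by apply: le_trans (min_lip _ _ _ _) _; rewrite subrr normr0 ge_max normr_ge0 lexx.
Qed.

Lemma clamp01P (t : R) : 0 <= clamp01 t <= 1.
Proof. by rewrite /clamp01 le_max lexx /= ge_max ler01 ge_min lexx. Qed.

Lemma clamp01_le0 (t : R) : t <= 0 -> clamp01 t = 0.
Proof. by move=> t0; rewrite /clamp01 min_r ?max_l// (le_trans t0). Qed.

Lemma clamp01_ge1 (t : R) : 1 <= t -> clamp01 t = 1.
Proof. by move=> t1; rewrite /clamp01 min_l// max_r. Qed.

Lemma clamp01_continuous : continuous clamp01.
Proof.
move=> t; apply/cvgrPdist_le => e e0; near=> u.
apply: le_trans (clamp01_lip _ _) _; near: u.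
have /cvgrPdist_le := @cvg_id R (nbhs t); exact.
Unshelve. all: by end_near. Qed.

Definition ramp (t : R) : R := 2 * clamp01 t - 1.

Lemma ramp_lip (a b : R) : `|ramp a - ramp b| <= 2 * `|a - b|.
Proof.
rewrite /ramp (_ : _ - _ = 2 * (clamp01 a - clamp01 b)); last by ring.
by rewrite normrM (ger0_norm (_ : 0 <= 2))// ler_wpM2l// clamp01_lip.
Qed.

Lemma ramp_bound t : -1 <= ramp t <= 1.
Proof. by have /andP[? ?] := clamp01P t; rewrite /ramp; apply/andP; split; lra. Qed.

Lemma ramp_le0 t : t <= 0 -> ramp t = -1.
Proof. by move=> t0; rewrite /ramp clamp01_le0// mulr0 sub0r. Qed.

Lemma ramp_ge1 t : 1 <= t -> ramp t = 1.
Proof. by move=> t1; rewrite /ramp clamp01_ge1//; lra. Qed.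

Lemma ramp_lt1 t : `|ramp t| < 1 -> 0 < t < 1.
Proof.
have [t0|t0] := leP t 0; first by rewrite ramp_le0// normrN1 ltxx.
by have [t1|t1] := leP 1 t; [rewrite ramp_ge1// normr1 ltxx|].
Qed.

Definition mix (l a b : R) : R := (1 - l) * a + l * b.

Lemma mix_bound l a b : 0 <= l <= 1 -> -1 <= a <= 1 -> -1 <= b <= 1 -> -1 <= mix l a b <= 1.
Proof. by move=> /andP[? ?] /andP[? ?] /andP[? ?]; rewrite /mix; apply/andP; split; nra. Qed.

Lemma mix_lip l a b a' b' e : 0 <= l <= 1 -> `|a - a'| <= e -> `|b - b'| <= e ->
  `|mix l a b - mix l a' b'| <= e.
Proof.
move=> /andP[l0 l1]; rewrite !ler_norml /mix => /andP[? ?] /andP[? ?].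
by apply/andP; split; nra.
Qed.

Lemma mix_lip_param l l' a b : -1 <= a <= 1 -> -1 <= b <= 1 ->
  `|mix l a b - mix l' a b| <= 2 * `|l - l'|.
Proof.
move=> /andP[? ?] /andP[? ?].
rewrite /mix (_ : _ - _ = (l - l') * (b - a)); last by ring.
rewrite normrM mulrC ler_wpM2r// ler_norml; apply/andP; split; lra.
Qed.

End Clamp.

(* The sup-convolution of [w] is the least Lipschitz majorant of [w]. *)
Section SupConvolution.
Context {R : realType} {T : Type} (d : T -> T -> R).
Context (d_refl : forall x, d x x = 0) (d_sym : forall x y, d x y = d y x)
  (d_tri : forall x y z, d x z <= d x y + d y z) (d_ge0 : forall x y, 0 <= d x y).

Definition supconv (w : T -> R) (L : R) (x : T) : R := sup [set r | exists y, r = w y - L * d x y].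

Context (w : T -> R) (L B : R) (L0 : 0 <= L) (wB : forall y, w y <= B).

Lemma supconv_has_sup x : has_sup [set r | exists y, r = w y - L * d x y].
Proof.
split; first by exists (w x - L * d x x), x.
exists B => r [y ->]; have := wB y; have := mulr_ge0 L0 (d_ge0 x y); lra.
Qed.

Lemma supconv_ge x y : w y - L * d x y <= supconv w L x.
Proof. by apply: (sup_upper_bound (supconv_has_sup x)); exists y. Qed.

Lemma supconv_ge_self x : w x <= supconv w L x.
Proof. by have := supconv_ge x x; rewrite d_refl mulr0 subr0. Qed.

Lemma supconv_le x c : (forall y, w y - L * d x y <= c) -> supconv w L x <= c.
Proof.
move=> H; apply: ge_sup; first by have [] := supconv_has_sup x.
by move=> r [y ->].
Qed.

Lemma supconv_leB x : supconv w L x <= B.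
Proof.
apply: supconv_le => y; have := wB y; have := mulr_ge0 L0 (d_ge0 x y); lra.
Qed.

Lemma supconv_lip x x' : `|supconv w L x - supconv w L x'| <= L * d x x'.
Proof.
have H a b : supconv w L a <= supconv w L b + L * d a b.
  apply: supconv_le => y; have := supconv_ge b y.
  have := ler_wpM2l L0 (d_tri b a y); rewrite mulrDr (d_sym b a); lra.
have h1 := H x x'; have h2 := H x' x; rewrite (d_sym x' x) in h2.
by rewrite ler_norml; apply/andP; split; lra.
Qed.

Lemma supconv_gt x c : c < supconv w L x -> exists y, c < w y - L * d x y.
Proof.
move=> h; apply: contrapT => H; move: h; rewrite ltNge => /negP; apply.
by apply: supconv_le => y; rewrite leNgt; apply/negP => ?; apply: H; exists y.
Qed.

End SupConvolution.

(** * From a coloured cover to the maps [Theta] *)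

Section Colours.
Context {R : realType} {T : topologicalType} (d : T -> T -> R) (lm : length_metric d).
Context (sc : @second_countable T).
Context (n : nat) (U : 'I_n.+1 -> set (set T)) (l D : R) (l0 : 0 < l).
Context (Ucov : forall x, exists i, exists2 V, U i V & V x)
  (Ubd : forall i V, U i V -> forall x y, V x -> V y -> d x y <= D)
  (Usep : forall i, d_disjoint d (4 * l) (U i)).

Let d_refl := lm_refl lm.
Let d_sym := lm_sym lm.
Let d_tri := lm_tri lm.
Let d_ge0 := lm_ge0 lm.

Lemma same_member i V V' x x' : U i V -> U i V' -> V x -> V' x' -> d x x' <= 4 * l -> V = V'.
Proof.
move=> UV UV' Vx V'x' h; apply: contrapT => VV; have := Usep UV UV' VV.
apply/negP; rewrite -leNgt; apply: le_trans (_ : (d x x')%:E <= _)%E; last by rewrite lee_fin.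
by apply: ereal_inf_lbound; exists x => //; exists x'.
Qed.

Definition near_member i x V := U i V /\ exists2 y, V y & d x y < l.

(** The disjointness [4 * l] pays for two steps of length [l] to the blocks and one of [2 * l]
    between the points. *)
Lemma near_member_unique i x x' V V' : near_member i x V -> near_member i x' V' ->
  d x x' < 2 * l -> V = V'.
Proof.
move=> [UV [y Vy xy]] [UV' [y' Vy' xy']] xx.
apply: (same_member UV UV' Vy Vy').
have := d_tri y x y'; have := d_tri x x' y'; rewrite (d_sym y x); lra.
Qed.

Definition Ublock i : set T := [set x | exists2 V, U i V & V x].

(** This is max(0, 1 - d(x, [Ublock i]) / l), with value 0 when the colour [i] is empty. *)
Definition level i : T -> R := supconv d (fun x => (`[< Ublock i x >])%:R) l^-1.

Let ind_le i y : (`[< Ublock i y >])%:R <= 1 :> R.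
Proof. by case: (`[< _ >]); rewrite ?ler01. Qed.
Let li0 : 0 <= l^-1. Proof. by rewrite invr_ge0 ltW. Qed.

Lemma level_le1 i x : level i x <= 1.
Proof. exact: (supconv_leB d_ge0 li0 (ind_le i)). Qed.

Lemma level_lip i x x' : `|level i x - level i x'| <= l^-1 * d x x'.
Proof. exact: (supconv_lip d_sym d_tri d_ge0 li0 (ind_le i)). Qed.

Lemma level_eq1 x : exists i, level i x = 1.
Proof.
have [i [V UV Vx]] := Ucov x; exists i; apply/eqP; rewrite eq_le level_le1 /=.
apply: le_trans (supconv_ge_self d_refl d_ge0 li0 (ind_le i) x).
by rewrite (asboolT (_ : Ublock i x)) //; exists V.
Qed.

Lemma level_gt0 i x : 0 < level i x -> exists V, near_member i x V.
Proof.
move=> /(supconv_gt d_ge0 li0 (ind_le i))[y]; case: asboolP => [[V UV Vy]|nU] h.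
  exists V; split=> //; exists y => //.
  by move: h; rewrite subr_gt0 mulrC ltr_pdivrMr// mul1r.
by move: h; rewrite sub0r oppr_gt0 ltNge mulr_ge0.
Qed.

Definition member i x : set T := xget set0 [set V | near_member i x V].

Lemma memberP i x : 0 < level i x -> near_member i x (member i x).
Proof. by move=> /level_gt0[V HV]; rewrite /member; case: xgetP => [V' -> //|/(_ V)]. Qed.

Lemma member_eq i x x' : 0 < level i x -> 0 < level i x' -> d x x' < 2 * l ->
  member i x = member i x'.
Proof. by move=> /memberP h1 /memberP h2; exact: near_member_unique h1 h2. Qed.

(** Distinct blocks of one colour have disjoint [l]-neighbourhoods. Choosing a nonempty basic open
    set in each of these numbers the blocks, by second countability. *)
Lemma member_index : exists j : set T -> nat, forall i x x',
  0 < level i x -> 0 < level i x' -> j (member i x) = j (member i x') -> member i x = member i x'.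
Proof.
have [B cB [oB bB]] := sc; have /countable_injP[f fB] := cB.
pose O V : set T := [set x | exists2 y, V y & d x y < l].
pose pick V := xget set0 [set b | [/\ B b, b !=set0 & b `<=` O V]].
have pickP i x : 0 < level i x -> [/\ B (pick (member i x)), pick (member i x) !=set0
    & pick (member i x) `<=` O (member i x)].
  move=> /memberP; set V := member i x => -[UV [y Vy xy]].
  rewrite /pick; case: xgetP => [b -> //|H]; exfalso.
  have : nbhs y (O V).
    by apply: filterS (lm_near lm y l0) => z yz; exists y => //; rewrite d_sym.
  by move=> /bB[b [Bb bz] bO]; apply: (H b); split=> //; exists y.
exists (f \o pick) => i x x' lx lx' /= E.
have [B1 [z bz] O1] := pickP i x lx; have [B2 _ O2] := pickP i x' lx'.
have bb : pick (member i x) = pick (member i x') by apply: fB => //; exact/mem_set.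
have [U1 _] := memberP lx; have [U2 _] := memberP lx'.
apply: (@near_member_unique i z z).
- by split=> //; exact: O1.
- by split=> //; apply: O2; rewrite -bb.
- by rewrite d_refl mulr_gt0.
Qed.

Lemma level_continuous i : continuous (level i).
Proof.
move=> x; apply/cvgrPdist_le => e e0; near=> y.
apply: le_trans (level_lip _ _ _) _; rewrite mulrC ler_pdivrMr//; apply: ltW.
by near: y; apply: (lm_near lm); rewrite mulr_gt0.
Unshelve. all: by end_near. Qed.

Context (j : set T -> nat) (jinj : forall i x x', 0 < level i x -> 0 < level i x' ->
  j (member i x) = j (member i x') -> member i x = member i x').

Notation dim := (n.+1 + n.+1)%N.
Definition ca (v : 'rV[R]_dim) (i : 'I_n.+1) : R := v 0 (lshift n.+1 i).
Definition cb (v : 'rV[R]_dim) (i : 'I_n.+1) : R := v 0 (rshift n.+1 i).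

(** [lam] grows while the level goes from [1 / 2] to [1], and [mu] while it goes from [0] to
    [1 / 2]. So the index of the block is fully recorded before [lam] leaves [0], and its jumps
    happen where [mu] is [0]. *)
Definition lam i x : R := clamp01 (2 * level i x - 1).
Definition mu i x : R := clamp01 (2 * level i x).
Definition jr i x : R := (j (member i x))%:R.
Definition ThA i x (a : R) := mix (lam i x) (ramp a) (ramp (a - 2)).
Definition ThB i x (b : R) := mix (mu i x) (ramp b) (ramp (b - jr i x)).
(* The first half of the coordinates tells whether the level of [x] exceeds [1 / 2], the second half
   records the index of the block near [x]: both can be read off [v] where [Theta x v] is small. *)
Definition Theta x (v : 'rV[R]_dim) : 'rV[R]_dim :=
  row_mx (\row_i ThA i x (ca v i)) (\row_i ThB i x (cb v i)).

Lemma Theta_l x v i : Theta x v 0 (lshift _ i) = ThA i x (ca v i).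
Proof. by rewrite row_mxEl mxE. Qed.

Lemma Theta_r x v i : Theta x v 0 (rshift _ i) = ThB i x (cb v i).
Proof. by rewrite row_mxEr mxE. Qed.

Lemma ThA_lipx i x x' a : `|ThA i x a - ThA i x' a| <= 4 * l^-1 * d x x'.
Proof.
apply: le_trans (mix_lip_param _ _ (ramp_bound _) (ramp_bound _)) _.
have := clamp01_lip (2 * level i x - 1) (2 * level i x' - 1).
rewrite (_ : _ - _ - (_ - _) = 2 * (level i x - level i x')); last by ring.
rewrite normrM (ger0_norm (_ : 0 <= 2))//; have := level_lip i x x'; rewrite /lam -mulrA; lra.
Qed.

Lemma ThB_bound i x b : -1 <= ThB i x b <= 1.
Proof. by apply: mix_bound; [exact: clamp01P|exact: ramp_bound|exact: ramp_bound]. Qed.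

Lemma ThA_bound i x b : -1 <= ThA i x b <= 1.
Proof. by apply: mix_bound; [exact: clamp01P|exact: ramp_bound|exact: ramp_bound]. Qed.

Lemma ThB_lipx i x x' b : `|ThB i x b - ThB i x' b| <= 4 * l^-1 * d x x'.
Proof.
have same c : `|mix (mu i x) (ramp b) (ramp (b - c)) - mix (mu i x') (ramp b) (ramp (b - c))|
    <= 4 * l^-1 * d x x'.
  apply: le_trans (mix_lip_param _ _ (ramp_bound _) (ramp_bound _)) _.
  have := clamp01_lip (2 * level i x) (2 * level i x').
  rewrite (_ : 2 * level i x - 2 * level i x' = 2 * (level i x - level i x')); last by ring.
  rewrite normrM (ger0_norm (_ : 0 <= 2))//; have := level_lip i x x'; rewrite /mu -mulrA; lra.
(* Where [mu] vanishes, the index can be replaced by that of the other point. *)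
have zero y c : level i y <= 0 -> ThB i y b = mix (mu i y) (ramp b) (ramp (b - c)).
  by move=> h; rewrite /ThB /mix /mu clamp01_le0 ?mul0r//; lra.
have [lx|lx] := leP (level i x) 0; first by rewrite (zero x (jr i x') lx); exact: same.
have [lx'|lx'] := leP (level i x') 0; first by rewrite (zero x' (jr i x) lx'); exact: same.
have [dd|dd] := ltP (d x x') (2 * l).
  have -> : ThB i x b = mix (mu i x) (ramp b) (ramp (b - jr i x')).
    by rewrite /ThB /jr (member_eq lx lx' dd).
  exact: same.
(* Points at distance at least [2 * l] may have different indices, but two values in [[-1, 1]]
   differ by at most [2]. *)
have /andP[? ?] := ThB_bound i x b; have /andP[? ?] := ThB_bound i x' b.
have h : 2 <= l^-1 * d x x' by rewrite mulrC ler_pdivlMr.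
by rewrite ler_norml -mulrA; apply/andP; split; lra.
Qed.

Lemma Theta_lipx x x' v : `|Theta x v - Theta x' v| <= 4 * l^-1 * d x x'.
Proof.
apply: normr_rV_le; first by rewrite !mulr_ge0.
move=> k; rewrite subr_coord; case: (split_ordP k) => i ->.
  by rewrite !Theta_l; exact: ThA_lipx.
by rewrite !Theta_r; exact: ThB_lipx.
Qed.

Lemma Theta_lipv x v v' : `|Theta x v - Theta x v'| <= 2 * `|v - v'|.
Proof.
have lc k : `|v 0 k - v' 0 k| <= `|v - v'|.
  by have := normr_coord (v - v') k; rewrite !mxE.
have lr k c : `|ramp (v 0 k - c) - ramp (v' 0 k - c)| <= 2 * `|v - v'|.
  apply: le_trans (ramp_lip _ _) _; rewrite ler_wpM2l//.
  by rewrite (_ : _ - _ - (_ - _) = v 0 k - v' 0 k) ?lc//; ring.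
apply: normr_rV_le; first by rewrite mulr_ge0.
move=> k; rewrite subr_coord; case: (split_ordP k) => i ->.
  rewrite !Theta_l; apply: mix_lip; [exact: clamp01P| |exact: lr].
  by have := lr (lshift n.+1 i) 0; rewrite !subr0.
rewrite !Theta_r; apply: mix_lip; [exact: clamp01P| |exact: lr].
by have := lr (rshift n.+1 i) 0; rewrite !subr0.
Qed.

Lemma Theta_bound x v : `|Theta x v| <= 1.
Proof.
apply: normr_rV_le => // k; rewrite ler_norml; case: (split_ordP k) => i ->.
  by rewrite Theta_l; exact: ThA_bound.
by rewrite Theta_r; exact: ThB_bound.
Qed.

Lemma Theta_continuous : continuous (fun w : T * 'rV[R]_dim => Theta w.1 w.2).
Proof.
move=> [x v]; apply/cvgrPdist_le => e e0 /=.
have n1 : \forall w \near (x, v), d x w.1 < l * (e / 8).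
  exists ([set y | d x y < l * (e / 8)], setT) => /=; last by move=> [y w] [].
  by split; [apply: (lm_near lm); rewrite mulr_gt0// divr_gt0|exact: filterT].
have n2 : \forall w \near (x, v), `|v - w.2| < e / 4.
  exists (setT, [set w | `|v - w| < e / 4]) => /=; last by move=> [y w] [].
  split; first exact: filterT.
  by apply: near_normr; rewrite divr_gt0.
near=> w.
have h1 := Theta_lipx x w.1 v; have h2 := Theta_lipv w.1 v w.2.
have g1 : d x w.1 < l * (e / 8) by near: w.
have g2 : `|v - w.2| < e / 4 by near: w.
have g3 : l^-1 * d x w.1 <= e / 8 by rewrite mulrC ler_pdivrMr// mulrC ltW.
rewrite -[X in `|X|](subrKA (Theta w.1 v)).
apply: le_trans (ler_normD _ _) _; rewrite -mulrA in h1; lra.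
Unshelve. all: by end_near. Qed.

(** In each of these ranges [lam] or [mu] is [0] or [1], so the coordinate is a single ramp, and a
    ramp avoids [-1] and [1] only over an open unit interval. *)
Lemma Theta_info x v i : `|Theta x v| < 1 ->
  [/\ level i x <= 1 / 2 -> 0 < ca v i < 1,
      1 / 2 < level i x -> jr i x < cb v i < jr i x + 1
    & level i x = 1 -> 2 < ca v i].
Proof.
move=> Th; have h1 : `|ThA i x (ca v i)| < 1.
  by rewrite -Theta_l; exact: le_lt_trans (normr_coord _ _) Th.
have h2 : `|ThB i x (cb v i)| < 1.
  by rewrite -Theta_r; exact: le_lt_trans (normr_coord _ _) Th.
split=> hl.
- apply: ramp_lt1; move: h1; rewrite /ThA /mix /lam clamp01_le0; last by lra.
  by rewrite subr0 mul1r mul0r addr0.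
- have : 0 < cb v i - jr i x < 1.
    apply: ramp_lt1; move: h2; rewrite /ThB /mix /mu clamp01_ge1; last by lra.
    by rewrite subrr mul0r mul1r add0r.
  by move=> /andP[? ?]; apply/andP; split; lra.
- have : 0 < ca v i - 2 < 1.
    apply: ramp_lt1; move: h1; rewrite /ThA /mix /lam hl clamp01_ge1; last by lra.
    by rewrite subrr mul0r mul1r add0r.
  by move=> /andP[? ?]; lra.
Qed.

Lemma Theta_neg x (v : 'rV[R]_dim) k : v 0 k <= 0 -> Theta x v 0 k = -1.
Proof.
move=> vk; have E (m : R) : mix m (-1) (-1) = -1 by rewrite /mix; ring.
case: (split_ordP k) vk => i -> vk.
  by rewrite Theta_l /ThA !ramp_le0 ?E// /ca; lra.
rewrite Theta_r /ThB (ramp_le0 (vk : cb v i <= 0)) ramp_le0 ?E//.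
by have : 0 <= jr i x := ler0n _ _; rewrite /cb; lra.
Qed.

(** The constant [3] is where the ramp shifted by [2] saturates. *)
Lemma Theta_pos x (v : 'rV[R]_dim) k (J : R) : 0 <= J -> (forall i, 0 < level i x -> jr i x <= J) ->
  J + 3 <= v 0 k -> Theta x v 0 k = 1.
Proof.
move=> J0 HJ vk; have E (m : R) : mix m 1 1 = 1 by rewrite /mix; ring.
case: (split_ordP k) vk => i -> vk.
  by rewrite Theta_l /ThA !ramp_ge1 ?E// /ca; lra.
rewrite Theta_r /ThB (_ : ramp (cb v i) = 1); last by rewrite ramp_ge1// /cb; lra.
have [lx|lx] := leP (level i x) 0.
  by rewrite /mix /mu clamp01_le0 ?mul0r ?subr0 ?mul1r ?addr0//; lra.
by rewrite ramp_ge1 ?E// /cb; have := HJ i lx; lra.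
Qed.

(** Finitely many balls of radius [l] cover [K], and in each of them at most one block of each
    colour occurs. *)
Lemma jr_bounded (K : set T) : compact K -> exists2 J : R, 0 <= J &
  forall x, K x -> forall i, 0 < level i x -> jr i x <= J.
Proof.
move=> cK; have [s Hs] := compact_balls lm cK (fun _ => l0).
have H z i : exists m : nat, forall x, d z x < l -> 0 < level i x -> (j (member i x) <= m)%N.
  have [[x [zx lx]]|nx] := pselect (exists x, d z x < l /\ 0 < level i x); last first.
    by exists 0%N => x zx lx; exfalso; apply: nx; exists x.
  exists (j (member i x)) => y zy ly; rewrite (@member_eq i y x)//.
  have := d_tri y z x; rewrite (d_sym y z); lra.
have [f Hf] := choice (fun zi : T * 'I_n.+1 => H zi.1 zi.2).
pose J := \max_(z <- s) \max_(i < n.+1) f (z, i).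
exists J%:R => // x Kx i lx; have [z zs zx] := Hs x Kx.
rewrite ler_nat; apply: leq_trans (Hf (z, i) x zx lx) _.
apply: leq_trans (@leq_bigmax _ (fun i => f (z, i)) i) _.
by rewrite /J (big_rem z)//= leq_maxl.
Qed.

Context (S : R -> R) (S0 : forall r, 0 <= r -> 0 <= S r)
  (Sc : forall x r, 0 <= r -> contractible_inside (R := R) (dball d x r) (dball d x (S r))) (x0 : T).

(** Clamping the time and restricting to the open ball turn continuity on a subspace into continuity
    at points, which composes more easily. *)
Lemma contraction_exists : exists h : T * R -> R -> T -> T, forall c r, 0 <= r -> exists p,
  [/\ forall t y, d c y < r -> {for (t, y), continuous (fun u : R * T => h (c, r) (clamp01 u.1) u.2)},
      forall t y, d c y < r -> d c (h (c, r) (clamp01 t) y) < S r,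
      forall y, d c y < r -> h (c, r) 0 y = y & forall y, d c y < r -> h (c, r) 1 y = p].
Proof.
have H (cr : T * R) : exists h : R -> T -> T, 0 <= cr.2 -> exists p,
  [/\ forall t y, d cr.1 y < cr.2 -> {for (t, y), continuous (fun u : R * T => h (clamp01 u.1) u.2)},
      forall t y, d cr.1 y < cr.2 -> d cr.1 (h (clamp01 t) y) < S cr.2,
      forall y, d cr.1 y < cr.2 -> h 0 y = y & forall y, d cr.1 y < cr.2 -> h 1 y = p].
  have [r0|r0] := leP 0 cr.2; last by exists (fun _ y => y).
  have [p [h [hc _ hB h0 h1]]] := Sc cr.1 r0; exists h => _; exists p; split=> //.
  - move=> t y cy V hV.
    have Wt : (`[0, 1]%classic `*` dball d cr.1 cr.2) (clamp01 t, y).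
      by split; rewrite //= in_itv /=; exact: clamp01P.
    have /subspace_continuousP/(_ _ Wt)/(_ V hV) := hc.
    move=> [[A B] /= [tA yB] HAB].
    exists (clamp01 @^-1` A, B `&` dball d cr.1 cr.2) => /=.
      split; first exact: clamp01_continuous.
      by apply: filterI => //; apply: open_nbhs_nbhs; split; [exact: (oball_open lm)|].
    move=> [u z] [/= Au [Bz Dz]]; apply: (HAB (clamp01 u, z)) => //.
    by split; rewrite //= in_itv /=; exact: clamp01P.
  - by move=> t y cy; apply: hB => //; exact: clamp01P.
have [h Hh] := choice H; exists h => c r r0; exact: (Hh (c, r) r0).
Qed.

End Colours.

Lemma continuous_pair (T U V : topologicalType) (f : T -> U) (g : T -> V) (x : T) :
  {for x, continuous f} -> {for x, continuous g} -> {for x, continuous (fun y => (f y, g y))}.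
Proof. by move=> cf cg; exact: cvg_pair. Qed.

(* [Th x] is homotopic to the identity through maps which do not vanish at infinity ([md_neg] and
   [md_pos]); it varies slowly with [x], and yet [P 1 x v] forgets [x] where [Th x v] is small. *)
Record is_model {R : realType} {T : topologicalType} (d : T -> T -> R) (m : nat) (l : R)
    (Th : T -> 'rV[R]_m -> 'rV[R]_m) (P : R -> T -> 'rV[R]_m -> T) (E : R) : Prop := IsModel {
  md_lipx : forall x x' v, `|Th x v - Th x' v| <= 4 * l^-1 * d x x';
  md_lipv : forall x v v', `|Th x v - Th x v'| <= 2 * `|v - v'|;
  md_bound : forall x v, `|Th x v| <= 1;
  md_cont : continuous (fun w : T * 'rV[R]_m => Th w.1 w.2);
  md_neg : forall x (v : 'rV[R]_m) k, v 0 k <= 0 -> Th x v 0 k = -1;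
  md_pos : forall K : set T, compact K -> exists2 J : R, 0 < J &
    forall x (v : 'rV[R]_m) k, K x -> J <= v 0 k -> Th x v 0 k = 1;
  md_near : forall t x v, d x (P t x v) < E;
  md_P0 : forall x v, P 0 x v = x;
  md_P1 : forall x x' v, `|Th x v| < 1 -> `|Th x' v| < 1 -> P 1 x v = P 1 x' v;
  md_Pcont : forall t x v, `|Th x v| < 1 ->
    {for (t, (x, v)), continuous (fun w : R * (T * 'rV[R]_m) => P w.1 w.2.1 w.2.2)}
}.

(** * Contracting the blocks one colour after the other *)

Section Chain.
Context {R : realType} {T : topologicalType} (d : T -> T -> R) (lm : length_metric d).
Context (n : nat) (U : 'I_n.+1 -> set (set T)) (l D : R) (l0 : 0 < l).
Context (Ucov : forall x, exists i, exists2 V, U i V & V x)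
  (Ubd : forall i V, U i V -> forall x y, V x -> V y -> d x y <= D)
  (Usep : forall i, d_disjoint d (4 * l) (U i)).
Context (j : set T -> nat) (jinj : forall i x x', 0 < level d U l i x -> 0 < level d U l i x' ->
  j (member d U l i x) = j (member d U l i x') -> member d U l i x = member d U l i x').
Context (S : R -> R) (S0 : forall r, 0 <= r -> 0 <= S r) (x0 : T).
Context (hc : T * R -> R -> T -> T) (Hhc : forall c (r : R), 0 <= r -> exists p : T,
  [/\ forall (t : R) y, d c y < r ->
        {for (t, y), continuous (fun u : R * T => hc (c, r) (clamp01 u.1) u.2)},
      forall (t : R) y, d c y < r -> d c (hc (c, r) (clamp01 t) y) < S r,
      forall y, d c y < r -> hc (c, r) 0 y = y
    & forall y, d c y < r -> hc (c, r) 1 y = p]).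

Notation dim := (n.+1 + n.+1)%N.
Notation Th := (Theta d U l j).
Notation lev := (level d U l).
Notation mem := (member d U l).

Let E0 : R := l + `|D|.

(** Bounds the displacement caused by the colours in [s], the last of the list acting first. The
    centre of a block near [x] is within [E0] of [x], the point already moved within [E0 + reach s']
    of that centre, and the contraction keeps it within [S] of this radius. The initial [1] makes
    the bound strict. *)
Fixpoint reach (s : seq 'I_n.+1) : R :=
  if s is i :: s' then reach s' + (E0 + S (E0 + reach s')) else 1.

Lemma E0_ge0 : 0 <= E0.
Proof. by rewrite addr_ge0// ltW. Qed.

Lemma reach_gt0 s : 0 < reach s.
Proof.
elim: s => [|i s IH] //=; rewrite ltr_wpDr// addr_ge0 ?E0_ge0// S0// addr_ge0 ?E0_ge0//.
exact: ltW.
Qed.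

Definition centre (V : set T) : T := xget x0 V.
Definition tm (v : 'rV[R]_dim) (t : R) i : R := clamp01 t * clamp01 (ca v i - 1).

(* Assume [`|Th x v| < 1]. If the level of [x] for the colour [i] is [1], then so is [tm v 1 i], and
   the contraction of the block near [x] is run to its end; if the level is at most [1 / 2], it is not
   started. *)
Fixpoint chain (s : seq 'I_n.+1) (t : R) (x : T) (v : 'rV[R]_dim) : T :=
  if s is i :: s' then
    if 1 / 2 < lev i x then
      hc (centre (mem i x), E0 + reach s') (clamp01 (tm v t i)) (chain s' t x v)
    else chain s' t x v
  else x.

Lemma half_gt0 i x : 1 / 2 < lev i x -> 0 < lev i x.
Proof. by move=> h; lra. Qed.

Lemma centre_near i x y s : 1 / 2 < lev i x -> d x y < reach s ->
  d (centre (mem i x)) y < E0 + reach s.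
Proof.
move=> /half_gt0 h xy; have [UV [z Vz xz]] := memberP lm l0 h.
have Vc : mem i x (centre (mem i x)) by rewrite /centre; case: xgetP => [y' _ //|/(_ z)].
have := Ubd UV Vc Vz; have := ler_norm D; have := lm_tri lm (centre (mem i x)) z y.
have := lm_tri lm z x y; rewrite (lm_sym lm z x) /E0; lra.
Qed.

Lemma centre_dist i x : 1 / 2 < lev i x -> d x (centre (mem i x)) < E0.
Proof.
move=> /half_gt0 h; have [UV [z Vz xz]] := memberP lm l0 h.
have Vc : mem i x (centre (mem i x)) by rewrite /centre; case: xgetP => [y' _ //|/(_ z)].
have := Ubd UV Vz Vc; have := ler_norm D; have := lm_tri lm x z (centre (mem i x)).
rewrite /E0; lra.
Qed.

Lemma radius_ge0 s : 0 <= E0 + reach s.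
Proof. by rewrite addr_ge0 ?E0_ge0 ?ltW ?reach_gt0. Qed.

Lemma chain_near s t x v : d x (chain s t x v) < reach s.
Proof.
elim: s => [|i s IH] /=; first by rewrite (lm_refl lm).
have SE : 0 <= S (E0 + reach s) by apply: S0; exact: radius_ge0.
have := E0_ge0; have := reach_gt0 s.
case: ifPn => h; last by lra.
have [p [_ H _ _]] := Hhc (centre (mem i x)) (radius_ge0 s).
have := H (tm v t i) _ (centre_near h IH); have := centre_dist h.
have := lm_tri lm x (centre (mem i x))
  (hc (centre (mem i x), E0 + reach s) (clamp01 (tm v t i)) (chain s t x v)).
lra.
Qed.

Lemma step_id s i x v t : 1 / 2 < lev i x -> tm v t i = 0 ->
  hc (centre (mem i x), E0 + reach s) (clamp01 (tm v t i)) (chain s t x v) = chain s t x v.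
Proof.
move=> h ->; have [p [_ _ H _]] := Hhc (centre (mem i x)) (radius_ge0 s).
by rewrite clamp01_le0//; apply: H; apply: centre_near => //; exact: chain_near.
Qed.

Lemma chain0 s x v : chain s 0 x v = x.
Proof.
elim: s => [|i s IH] //=; case: ifPn => h; last exact: IH.
by rewrite step_id// /tm clamp01_le0// mul0r.
Qed.

Lemma level_of_time x v i : `|Th x v| < 1 -> 1 <= ca v i -> 1 / 2 < lev i x.
Proof.
move=> /(Theta_info i)[H _ _] h; rewrite ltNge; apply/negP => /H /andP[_]; lra.
Qed.

Lemma member_of_time x x' v i : `|Th x v| < 1 -> `|Th x' v| < 1 -> 1 <= ca v i ->
  mem i x = mem i x'.
Proof.
move=> h h' hv; have l1 := level_of_time h hv; have l2 := level_of_time h' hv.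
apply: jinj; [exact: half_gt0|exact: half_gt0|].
have [_ /(_ l1)/andP[a1 a2] _] := Theta_info i h; have [_ /(_ l2)/andP[b1 b2] _] := Theta_info i h'.
(* Both indices are the integer part of the same coordinate of [v]. *)
have E (p q : nat) (b : R) : p%:R < b -> b < q%:R + 1 -> (p <= q)%N.
  by move=> pb bq; rewrite -ltnS -(ltr_nat R) -natr1; exact: lt_trans bq.
by apply/eqP; rewrite eqn_leq (E _ _ _ a1 b2) (E _ _ _ b1 a2).
Qed.

(** For the colour [i] the contraction runs to its end, a point fixed by the block, which [v]
    determines. Each later step is determined by [v] too: either its time is [0], or both points
    have level above [1 / 2] for it and the same block. *)
Lemma chain1 s x x' v i : `|Th x v| < 1 -> `|Th x' v| < 1 -> i \in s -> lev i x = 1 ->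
  chain s 1 x v = chain s 1 x' v.
Proof.
move=> h h'; elim: s => [//|k s IH] /=; rewrite in_cons => si li.
have tmE : tm v 1 k = clamp01 (ca v k - 1) by rewrite /tm clamp01_ge1// mul1r.
have [k1|k1] := leP (ca v k) 1.
  have t0 : tm v 1 k = 0 by rewrite tmE clamp01_le0//; lra.
  have ski : i \in s.
    move: si => /orP[/eqP E|//]; have [_ _ H] := Theta_info i h.
    by have := H li; rewrite E; lra.
  have E y : (if 1 / 2 < lev k y then
      hc (centre (mem k y), E0 + reach s) (clamp01 (tm v 1 k)) (chain s 1 y v)
    else chain s 1 y v) = chain s 1 y v by case: ifPn => hy //; rewrite step_id.
  by rewrite !E; exact: IH.
have k1' := ltW k1.
rewrite (level_of_time h k1') (level_of_time h' k1') (member_of_time h h' k1').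
have [k2|k2] := leP 2 (ca v k).
  have -> : clamp01 (tm v 1 k) = 1 by rewrite tmE !clamp01_ge1//; lra.
  have [p [_ _ _ H]] := Hhc (centre (mem k x')) (radius_ge0 s).
  have d' := centre_near (level_of_time h' k1') (chain_near s 1 x' v).
  have := centre_near (level_of_time h k1') (chain_near s 1 x v).
  by rewrite (member_of_time h h' k1') => d1; rewrite (H _ d1) (H _ d').
rewrite IH//; move: si => /orP[/eqP E|//].
by have [_ _ H] := Theta_info i h; have := H li; rewrite E; lra.
Qed.

Lemma ca_continuous i : continuous (fun w : R * (T * 'rV[R]_dim) => ca w.2.2 i).
Proof.
move=> w; apply: (@continuous_comp _ _ _ (fun w : R * (T * 'rV[R]_dim) => w.2.2) (fun v => ca v i)).
  by apply: (@continuous_comp _ _ _ snd snd); exact: cvg_snd.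
exact: coord_continuous.
Qed.

Lemma tm_continuous i : continuous (fun w : R * (T * 'rV[R]_dim) => tm w.2.2 w.1 i).
Proof.
move=> w; apply: cvgM.
  by apply: (@continuous_comp _ _ _ fst clamp01); [exact: cvg_fst|exact: clamp01_continuous].
apply: (@continuous_comp _ _ _ (fun w : R * (T * 'rV[R]_dim) => ca w.2.2 i - 1) clamp01).
  by apply: cvgB; [exact: ca_continuous|exact: cvg_cst].
exact: clamp01_continuous.
Qed.

(** The jump of the conditional is invisible. Where the level exceeds [1 / 2] the block is locally
    constant; elsewhere the smallness of [Th] forces [ca v i < 1], so nearby steps take time [0] and
    are the identity. *)
Lemma chain_continuous s t x v : `|Th x v| < 1 ->
  {for (t, (x, v)), continuous (fun w : R * (T * 'rV[R]_dim) => chain s w.1 w.2.1 w.2.2)}.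
Proof.
move=> h; elim: s => [|i s IH] /=.
  by apply: (@continuous_comp _ _ _ snd fst); [exact: cvg_snd|exact: cvg_fst].
pose w0 := (t, (x, v)) : R * (T * 'rV[R]_dim).
have cx : {for w0, continuous (fun w : R * (T * 'rV[R]_dim) => w.2.1)}.
  by apply: (@continuous_comp _ _ _ snd fst); [exact: cvg_snd|exact: cvg_fst].
have [lx|lx] := ltP (1 / 2) (lev i x).
  have [p [H _ _ _]] := Hhc (centre (mem i x)) (radius_ge0 s).
  have cH := H (tm v t i) _ (centre_near lx (chain_near s t x v)).
  have c2 := @continuous_comp _ _ _
    (fun w : R * (T * 'rV[R]_dim) => (tm w.2.2 w.1 i, chain s w.1 w.2.1 w.2.2))
    (fun u : R * T => hc (centre (mem i x), E0 + reach s) (clamp01 u.1) u.2) w0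
    (continuous_pair (@tm_continuous i w0) IH) cH.
  refine (@near_eq_continuous _ _ _ _ w0 c2 _).
  have n1 : \forall w \near w0, 1 / 2 < lev i w.2.1.
    apply: (cx [set y | 1 / 2 < lev i y]).
    by apply: (@level_continuous _ _ _ lm _ _ _ l0 i x [set u | 1 / 2 < u]); exact: lt_nbhsr.
  have n2 : \forall w \near w0, d x w.2.1 < 2 * l.
    by apply: (cx [set y | d x y < 2 * l]); apply: (lm_near lm); rewrite mulr_gt0.
  near=> w => /=.
  have hw : 1 / 2 < lev i w.2.1 by near: w.
  have hd : d x w.2.1 < 2 * l by near: w.
  by rewrite hw (member_eq lm l0 Usep (half_gt0 lx) (half_gt0 hw) hd).
refine (@near_eq_continuous _ _ _ _ w0 IH _).
have [H _ _] := Theta_info i h; have /andP[_ c1] := H lx.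
have n1 : \forall w \near w0, ca w.2.2 i < 1.
  by apply: (@ca_continuous i w0 [set u | u < 1]); exact: lt_nbhsl.
near=> w; case: ifPn => hw //; rewrite step_id//.
have hw1 : ca w.2.2 i < 1 by near: w.
by rewrite /tm (@clamp01_le0 _ (ca _ _ - 1)) ?mulr0//; lra.
Unshelve. all: by end_near. Qed.

Lemma chain_is_model :
  is_model d l Th (chain (enum 'I_n.+1)) (reach (enum 'I_n.+1)).
Proof.
split.
- exact: (Theta_lipx lm l0 Usep).
- exact: Theta_lipv.
- exact: Theta_bound.
- exact: (@Theta_continuous _ _ _ lm _ _ _ l0 Usep).
- by move=> x v k; exact: Theta_neg.
- move=> K cK; have [J J0 HJ] := jr_bounded lm l0 Usep j cK.
  exists (J + 3) => [|x v k Kx]; first by lra.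
  by apply: Theta_pos => // i; exact: HJ.
- by move=> t x v; exact: chain_near.
- by move=> x v; exact: chain0.
- move=> x x' v h h'; have [i li] := level_eq1 lm l0 Ucov x.
  by apply: (@chain1 _ _ _ _ i) => //; rewrite mem_enum.
- by move=> t x v; exact: chain_continuous.
Qed.

End Chain.

Lemma model_exists (R : realType) (T : topologicalType) (d : T -> T -> R) (n : nat) (l : R) :
  length_metric d -> @second_countable T -> (exists x : T, True) ->
  uniformly_contractible d -> asdim_le d n -> 0 < l ->
  exists (Th : T -> 'rV[R]_(n.+1 + n.+1) -> 'rV[R]_(n.+1 + n.+1)) P E, is_model d l Th P E.
Proof.
move=> lm sc [x0 _] [S [S0 Sc]] ad l0.
have l4 : 0 < 4 * l by rewrite mulr_gt0.
have [U [Ucov [D Ubd] Usep]] := ad _ l4.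
have [j jinj] := member_index lm sc l0 Usep.
have [hc Hhc] := contraction_exists lm Sc.
do 3!eexists; exact: (chain_is_model lm l0 Ucov Ubd Usep jinj S0 x0 Hhc).
Qed.

(** * Homotopies relative to infinity *)

Section Homotopy.
Context {R : realType} {Z : topologicalType} {m : nat} (p : 'rV[R]_m.+1).

Definition homotopic (f g : Z -> 'rV[R]_m.+1) : Prop :=
  exists H : R -> one_point_compactification Z -> 'rV[R]_m.+1,
    [/\ continuous (fun u : R * one_point_compactification Z => H u.1 u.2),
        forall t w, sphere (H t w), H 0 = extend f p, H 1 = extend g p
      & forall t, H t None = p].

(** Off the closed compact set [K] the normalized map is constantly [p], which gives continuity at
    infinity. *)
Lemma homotopic_nrm (Y : R -> Z -> 'rV[R]_m.+1) (K : set Z) : sphere p ->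
  compact K -> closed K -> continuous (fun u : R * Z => Y u.1 u.2) ->
  (forall t z, Y t z != 0) -> (forall t z, ~ K z -> exists2 s, 0 < s & Y t z = s *: p) ->
  homotopic (fun z => nrm (Y 0 z)) (fun z => nrm (Y 1 z)).
Proof.
move=> sp cK clK cY Y0 YK; exists (fun t => extend (fun z => nrm (Y t z)) p); split=> //.
- move=> [t [z|]] V /= HV.
    have cn : {for (t, z), continuous (fun u : R * Z => nrm (Y u.1 u.2))}.
      exact: (@continuous_comp _ _ _ _ (@nrm R _) (t, z) (cY (t, z)) (nrm_continuous (Y0 t z))).
    have [[A B] /= [tA zB] HAB] := cn V HV.
    exists (A, Some @` B) => /=.
      by split=> //; exact: one_point_compactification_some_nbhs.
    by move=> [u w] [/= Au [y By <-]] /=; exact: (HAB (u, y)).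
  have Vp : V p := nbhs_singleton HV.
  exists (setT, (Some @` (~` K)) `|` [set None]) => /=.
    by split; [exact: filterT|exists K].
  move=> [u w] [/= _ [[y Ky <-]|->]] //=.
  by have [s s0 ->] := YK u y Ky; rewrite nrm_scale.
- by move=> t [z|] //=; apply: nrm_sphere.
Qed.

Lemma continuous_either (T U : topologicalType) (f g h : T -> U) (x : T) :
  {for x, continuous f} -> {for x, continuous g} -> f x = g x ->
  (forall y, h y = f y \/ h y = g y) -> {for x, continuous h}.
Proof.
move=> cf cg fg hfg V HV.
have hx : h x = f x by case: (hfg x) => [//|]; rewrite fg.
have n1 : \forall y \near x, V (f y) by apply: cf; rewrite -hx.
have n2 : \forall y \near x, V (g y) by apply: cg; rewrite -fg -hx.
suff : \forall y \near x, V (h y) by [].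
by near=> y; case: (hfg y) => ->; near: y.
Unshelve. all: by end_near. Qed.

Lemma homotopic_trans f g h : homotopic f g -> homotopic g h -> homotopic f h.
Proof.
move=> [H1 [c1 s1 H10 H11 H1p]] [H2 [c2 s2 H20 H21 H2p]].
pose O := one_point_compactification Z.
pose F (u : R * O) := H1 (clamp01 (2 * u.1)) u.2.
pose G (u : R * O) := H2 (clamp01 (2 * u.1 - 1)) u.2.
have cF : continuous F.
  move=> u; apply: (@continuous_comp _ _ _ (fun u : R * O => (clamp01 (2 * u.1), u.2))
    (fun u : R * O => H1 u.1 u.2)); last exact: c1.
  apply: continuous_pair; last exact: cvg_snd.
  apply: (@continuous_comp _ _ _ (fun u : R * O => 2 * u.1) clamp01); last exact: clamp01_continuous.
  by apply: cvgM; [exact: cvg_cst|exact: cvg_fst].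
have cG : continuous G.
  move=> u; apply: (@continuous_comp _ _ _ (fun u : R * O => (clamp01 (2 * u.1 - 1), u.2))
    (fun u : R * O => H2 u.1 u.2)); last exact: c2.
  apply: continuous_pair; last exact: cvg_snd.
  apply: (@continuous_comp _ _ _ (fun u : R * O => 2 * u.1 - 1) clamp01); last exact: clamp01_continuous.
  by apply: cvgB; [apply: cvgM; [exact: cvg_cst|exact: cvg_fst]|exact: cvg_cst].
exists (fun t w => if t <= 1 / 2 then F (t, w) else G (t, w)); split.
- move=> [t w]; have c0 : {for (t, w), continuous (fun u : R * O => u.1)} by exact: cvg_fst.
  have [tl|tr|te] := ltgtP t (1 / 2).
  + apply: (near_eq_continuous (cF (t, w))).
    have n1 : \forall u \near (t, w), u.1 < 1 / 2.
      by apply: (c0 [set s | s < 1 / 2]); exact: lt_nbhsl.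
    near=> u => /=; rewrite ifT; first by rewrite -surjective_pairing.
    by apply: ltW; near: u.
  + apply: (near_eq_continuous (cG (t, w))).
    have n1 : \forall u \near (t, w), 1 / 2 < u.1.
      by apply: (c0 [set s | 1 / 2 < s]); exact: lt_nbhsr.
    near=> u => /=; rewrite ifF; first by rewrite -surjective_pairing.
    by apply/negP/negP; rewrite -ltNge; near: u.
  + apply: (continuous_either (cF (t, w)) (cG (t, w))).
      rewrite /F /G /= te clamp01_ge1 ?clamp01_le0 ?H11 ?H20//; lra.
    by move=> [u y] /=; case: ifP => _; [left|right].
- by move=> t w; case: ifP => _; [exact: s1|exact: s2].
- by apply/funext => w; rewrite ifT /F /= ?mulr0 ?clamp01_le0 ?H10//; lra.
- apply/funext => w; rewrite ifF; first by rewrite /G /= clamp01_ge1 ?H21//; lra.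
  by apply/negP/negP; rewrite -ltNge; lra.
- by move=> t; case: ifP => _; [exact: H1p|exact: H2p].
Unshelve. all: by end_near. Qed.

Lemma homotopic_continuous f g : homotopic f g -> continuous (extend f p).
Proof.
move=> [H [c _ <- _ _]] w.
apply: (@continuous_comp _ _ _ (fun w => (0, w)) (fun u : R * one_point_compactification Z => H u.1 u.2)).
  by apply: continuous_pair; [exact: cst_continuous|exact: cvg_id].
exact: c.
Qed.

End Homotopy.

Section Build.
Context {R : realType} {N D : nat}.
Implicit Types (w q : 'rV[R]_N) (th : 'rV[R]_D) (e z t : R).

(** The factor [2] makes the map constant where the norm of [th] is at least [1 / 2], leaving a
    margin below [1], the bound under which [w] and [e] will be continuous. *)
Definition cutoff th e z : R := Num.min 1 (Num.max (2 * `|th|) (Num.max e z)).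

Definition polar t (u : 'rV[R]_(N + D)) : 'rV[R]_(N + D).+1 := row_mx t%:M u : 'rV[R]_(1 + (N + D)).

Definition pole : 'rV[R]_(N + D).+1 := polar 1 0.

(* [build] vanishes only where [w] and [th] do and the larger of [e] and [z] is [1 / 2]. *)
Definition build w th e z : 'rV[R]_(N + D).+1 :=
  let t := cutoff th e z in polar (2 * t - 1) ((1 - t) *: row_mx w th).

Lemma polar_head t u : polar t u 0 0 = t.
Proof.
have -> : (0 : 'I_(N + D).+1) = lshift (N + D) (0 : 'I_1) by apply: val_inj.
apply: etrans (@row_mxEl R 1 1 (N + D) t%:M u 0 0) _.
by rewrite mxE eqxx mulr1n.
Qed.

Lemma polar_tail t u k : polar t u 0 (rshift 1 k) = u 0 k.
Proof. exact: (@row_mxEr R 1 1 (N + D) t%:M u 0 k). Qed.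

Lemma polar_norm_le (u : 'rV[R]_(N + D).+1) c : `|u 0 0| <= c ->
  (forall k, `|u 0 (rshift 1 k)| <= c) -> `|u| <= c.
Proof.
move=> h0 hk; apply: normr_rV_le => [|k]; first exact: le_trans h0.
case: (@split_ordP 1 (N + D) k) => a ->; last exact: hk.
by rewrite (_ : lshift (N + D) a = 0 :> 'I_(N + D).+1)//; apply: val_inj; rewrite /= ord1.
Qed.

Lemma pole_sphere : sphere pole.
Proof.
rewrite /sphere /= -/(dotr pole pole) dotrE (@big_split_ord _ _ _ 1 (N + D)) /= big_ord1.
rewrite (_ : lshift (N + D) (0 : 'I_1) = 0 :> 'I_(N + D).+1); last exact: val_inj.
rewrite polar_head mulr1 big1 ?addr0// => k _.
by rewrite polar_tail mxE mulr0.
Qed.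

Lemma cutoff01 th e z : 0 <= cutoff th e z <= 1.
Proof.
by rewrite /cutoff ge_min lexx andbT le_min ler01 le_max mulr_ge0.
Qed.

Lemma cutoff_lip th th' e e' z z' :
  `|cutoff th e z - cutoff th' e' z'| <= 2 * `|th - th'| + `|e - e'| + `|z - z'|.
Proof.
have := normr_ge0 (th - th'); have := normr_ge0 (e - e'); have := normr_ge0 (z - z') => h1 h2 h3.
apply: le_trans (min_lip _ _ _ _) _; rewrite subrr normr0 ge_max; apply/andP; split; first by lra.
apply: le_trans (max_lip _ _ _ _) _; rewrite ge_max; apply/andP; split.
  rewrite -mulrBr normrM (ger0_norm (_ : 0 <= 2))//; have := ler_dist_dist th th'; lra.
by apply: le_trans (max_lip _ _ _ _) _; rewrite ge_max; apply/andP; split; lra.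
Qed.

Lemma cutoff_eq1 th e z : 1 <= 2 * `|th| \/ 1 <= e \/ 1 <= z -> cutoff th e z = 1.
Proof. by move=> h; apply: min_l; rewrite !le_max; case: h => [->|[->|->]]; rewrite ?orbT. Qed.

Lemma build_pole w th e z : 1 <= 2 * `|th| \/ 1 <= e \/ 1 <= z -> build w th e z = pole.
Proof.
move=> h; rewrite /build cutoff_eq1// subrr scale0r /pole; congr polar; ring.
Qed.

Lemma build_head w th e z : build w th e z 0 0 = 2 * cutoff th e z - 1.
Proof. exact: polar_head. Qed.

Lemma build_l w th e z k :
  build w th e z 0 (rshift 1 (lshift D k)) = (1 - cutoff th e z) * w 0 k.
Proof. by rewrite /build polar_tail mxE row_mxEl. Qed.

Lemma build_r w th e z k :
  build w th e z 0 (rshift 1 (rshift N k)) = (1 - cutoff th e z) * th 0 k.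
Proof. by rewrite /build polar_tail mxE row_mxEr. Qed.

(** If the vector were small, the cutoff would be near [1 / 2] with [w] and [th] small, hence equal
    to the larger of [e'] and [z]. For [z > 0] this is impossible since [e'] is near [1]; for
    [z = 0] it puts [e] near [1 / 2] and the norm of [q] near [1 / 4], far from that of [w]. No
    assumption is made on [th], which can thus be deformed freely. *)
Lemma build_nonvanish q w th e e' z : 0 <= e <= 1 -> `|q| = e * (1 - e) ->
  `|w - q| <= 1 / 32 -> `|e' - e| <= 1 / 32 -> 0 <= z -> (0 < z -> e = 1) ->
  1 / 100 <= `|build w th e' z|.
Proof.
move=> /andP[e0 e1] qe wq ee z0 ze; rewrite leNgt; apply/negP => Y1.
set t := cutoff th e' z; set Y := build w th e' z in Y1.
have /andP[t0 t1] := cutoff01 th e' z; rewrite -/t in t0 t1.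
have ht : `|2 * t - 1| < 1 / 100.
  by apply: le_lt_trans Y1; rewrite -[2 * t - 1](build_head w); exact: normr_coord.
have hw : (1 - t) * `|w| < 1 / 100.
  apply: le_lt_trans Y1; rewrite -[1 - t]ger0_norm ?subr_ge0// -normrZ.
  by apply: normr_rV_le => // k; rewrite mxE -(build_l _ th); exact: normr_coord.
have hth : (1 - t) * `|th| < 1 / 100.
  apply: le_lt_trans Y1; rewrite -[1 - t]ger0_norm ?subr_ge0// -normrZ.
  by apply: normr_rV_le => // k; rewrite mxE -(build_r w); exact: normr_coord.
move: ht; rewrite ltr_norml => /andP[ht1 ht2].
have w1 : `|w| < 1 / 40 by have := normr_ge0 w; nra.
have th1 : `|th| < 1 / 40 by have := normr_ge0 th; nra.
have tE : t = Num.max e' z.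
  have : t = Num.min 1 (Num.max (2 * `|th|) (Num.max e' z)) by [].
  have [a1|a1] := leP 1 (Num.max (2 * `|th|) (Num.max e' z)); first by lra.
  by have [b1|b1] := leP (2 * `|th|) (Num.max e' z); lra.
move: ee; rewrite ler_norml => /andP[ee1 ee2].
have [zp|zn] := ltP 0 z.
  by have E := ze zp; have : e' <= t by [rewrite tE le_max lexx]; lra.
have tE' : t = e' by move: tE; case: leP => h1 h2; lra.
have qw : `|q| <= `|w| + 1 / 32.
  have := ler_normD w (q - w); rewrite (addrC w) subrK distrC; lra.
nra.
Qed.

Lemma build_lip w w' th th' e e' z z' :
  `|build w th e z - build w' th' e' z'| <= `|w - w'| + `|th - th'| +
    (2 + `|w'| + `|th'|) * (2 * `|th - th'| + `|e - e'| + `|z - z'|).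
Proof.
set d := 2 * _ + _ + _; have /andP[t0 t1] := cutoff01 th e z.
have tl : `|cutoff th e z - cutoff th' e' z'| <= d := cutoff_lip _ _ _ _ _ _.
have d0 : 0 <= d := le_trans (normr_ge0 _) tl.
have a1 := normr_ge0 (w - w'); have a2 := normr_ge0 (th - th').
have a3 := mulr_ge0 (normr_ge0 w') d0; have a4 := mulr_ge0 (normr_ge0 th') d0.
rewrite !mulrDl.
have H n (u u' : 'rV[R]_n) k : `|(1 - cutoff th e z) * u 0 k - (1 - cutoff th' e' z') * u' 0 k|
    <= `|u - u'| + `|u'| * d.
  rewrite (_ : _ - _ = (1 - cutoff th e z) * (u - u') 0 k
    - (cutoff th e z - cutoff th' e' z') * u' 0 k); last by rewrite !mxE; ring.
  apply: le_trans (ler_normB _ _) _; rewrite !normrM lerD//.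
    apply: le_trans (normr_coord (u - u') k).
    by rewrite ler_piMl// ger0_norm ?subr_ge0// gerBl.
  by rewrite mulrC; apply: ler_pM => //; exact: normr_coord.
apply: polar_norm_le => [|k]; rewrite subr_coord.
  rewrite !build_head (_ : _ - _ = 2 * (cutoff th e z - cutoff th' e' z')); last by ring.
  by rewrite normrM (ger0_norm (_ : 0 <= 2))//; lra.
case: (split_ordP k) => a ->.
  by rewrite !build_l; apply: le_trans (H _ _ _ _) _; lra.
by rewrite !build_r; apply: le_trans (H _ _ _ _) _; lra.
Qed.

(** Where the norm of [th] is at least [1], it stays above [1 / 2] nearby and the value is the pole,
    whatever [w] and [e] do. *)
Lemma build_continuous (T : topologicalType) (w : T -> 'rV[R]_N) (th : T -> 'rV[R]_D)
    (e z : T -> R) (x : T) :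
  {for x, continuous th} -> {for x, continuous z} ->
  (`|th x| < 1 -> {for x, continuous w} /\ {for x, continuous e}) ->
  {for x, continuous (fun y => build (w y) (th y) (e y) (z y))}.
Proof.
move=> cth cz H; have [t1|t1] := ltP `|th x| 1; last first.
  have cc : {for x, continuous (fun _ : T => pole)} by exact: cst_continuous.
  apply: (near_eq_continuous cc).
  have n1 : \forall y \near x, `|th x - th y| < 1 / 2.
    by apply: cth [set u | `|th x - u| < 1 / 2] _; apply: near_normr.
  near=> y; apply: esym; apply: build_pole; left.
  have h : `|th x - th y| < 1 / 2 by near: y.
  by have := ler_normD (th x - th y) (th y); rewrite subrK; lra.
have [cw ce] := H t1; apply/cvgrPdist_le => ep ep0.
pose C : R := 2 + `|w x| + `|th x|.
have C0 : 0 < C by rewrite /C; have := normr_ge0 (w x); have := normr_ge0 (th x); lra.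
pose dl : R := ep / (2 + 4 * C).
have dl0 : 0 < dl by rewrite divr_gt0//; lra.
have n1 : \forall y \near x, `|th x - th y| < dl.
  by apply: cth [set u | `|th x - u| < dl] _; apply: near_normr.
have n2 : \forall y \near x, `|w x - w y| < dl.
  by apply: cw [set u | `|w x - u| < dl] _; apply: near_normr.
have n3 : \forall y \near x, `|z x - z y| < dl by move/cvgrPdist_lt : cz; apply.
have n4 : \forall y \near x, `|e x - e y| < dl by move/cvgrPdist_lt : ce; apply.
near=> y; rewrite distrC; apply: le_trans (build_lip _ _ _ _ _ _ _ _) _.
have h1 : `|th y - th x| < dl by rewrite distrC; near: y.
have h2 : `|w y - w x| < dl by rewrite distrC; near: y.
have h3 : `|z y - z x| < dl by rewrite distrC; near: y.
have h4 : `|e y - e x| < dl by rewrite distrC; near: y.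
have -> : ep = dl + dl + C * (2 * dl + dl + dl) by rewrite /dl; field; lra.
apply: lerD; first by lra.
by apply: ler_pM; rewrite -/C ?(ltW C0)//; have := normr_ge0 (th y - th x);
  have := normr_ge0 (e y - e x); have := normr_ge0 (z y - z x); lra.
Unshelve. all: by end_near. Qed.

End Build.

(** * Lipschitz approximation *)

Section Approximation.
Context {R : realType} {D : nat}.
Implicit Types v : 'rV[R]_D.

Definition near_on (C : set 'rV[R]_D) (F : 'rV[R]_D -> R) := forall v, C v ->
  forall e : R, 0 < e -> \forall v' \near v, C v' -> `|F v - F v'| < e.

(** Compactness is used as a near-covering property with the filter of small positive [dl]. *)
Lemma unif_continuous_on (C : set 'rV[R]_D) (F : 'rV[R]_D -> R) (h : R) :
  compact C -> near_on C F -> 0 < h ->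
  exists2 dl : R, 0 < dl & forall v v', C v -> C v' -> `|v - v'| < dl -> `|F v - F v'| <= h.
Proof.
move=> /compact_near_coveringP cC nF h0.
pose P (dl : R) v := C v -> forall v', C v' -> `|v - v'| < dl -> `|F v - F v'| <= h.
have h2 : 0 < h / 2 by rewrite divr_gt0.
have loc v : C v -> \forall v' \near v & dl \near 0^'+, P dl v'.
  move=> Cv; have /nbhs_ballP[r /= r0 Hr] := nF v Cv _ h2.
  exists ([set v' | `|v - v'| < r / 2], [set dl | dl < r / 2]) => /=.
    split; first by apply: near_normr; rewrite divr_gt0.
    by apply: nbhs_right_lt; rewrite divr_gt0.
  move=> [v1 dl] [/= vv1 dlr] Cv1 v2 Cv2 v12.
  have B u : `|v - u| < r -> ball v r u by rewrite -ball_normE.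
  have vr : `|v - v1| < r by lra.
  have vr2 : `|v - v2| < r.
    have := ler_normD (v - v1) (v1 - v2); rewrite addrA subrK; lra.
  have H1 := Hr _ (B _ vr) Cv1; have H2 := Hr _ (B _ vr2) Cv2.
  have := ler_normB (F v - F v2) (F v - F v1).
  rewrite (_ : F v - F v2 - (F v - F v1) = F v1 - F v2); last by ring.
  lra.
have H : \forall dl \near 0^'+, C `<=` P dl by exact: cC.
have pos : \forall dl \near (0 : R)^'+, 0 < dl by exact: nbhs_right_gt.
have [dl [Hd d0]] : exists dl : R, (C `<=` P dl) /\ 0 < dl.
  have HH : \forall dl \near 0^'+, C `<=` P dl /\ 0 < dl by apply: filterI.
  have [dl Hdl] := @filter_ex R (at_right (0 : R)) _ _ HH; by exists dl.
by exists dl => // v v' Cv Cv'; apply: Hd.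
Qed.

(** The sup-convolution of [F], extended by its lower bound [-1], with slope [2 / dl]: beyond
    distance [dl] the penalty exceeds the oscillation [2], and within it uniform continuity
    applies. *)
Lemma lipschitz_approx (C : set 'rV[R]_D) (F : 'rV[R]_D -> R) (h : R) :
  compact C -> near_on C F -> (forall v, C v -> `|F v| <= 1) -> 0 < h -> h <= 1 ->
  exists (L : R) (G : 'rV[R]_D -> R), [/\ 0 <= L, forall v v', `|G v - G v'| <= L * `|v - v'|,
    forall v, C v -> `|G v - F v| <= h & forall v, `|G v| <= 1].
Proof.
move=> cC nF F1 h0 h1; have [dl d0 Hd] := unif_continuous_on cC nF h0.
pose w v : R := if `[< C v >] then F v else -1.
pose dist v v' : R := `|v - v'|.
have d_refl v : dist v v = 0 by rewrite /dist subrr normr0.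
have d_sym v v' : dist v v' = dist v' v by rewrite /dist distrC.
have d_tri u v z : dist u z <= dist u v + dist v z.
  by have := ler_normD (u - v) (v - z); rewrite addrA subrK.
have d_ge0 u v : 0 <= dist u v by exact: normr_ge0.
have w1 v : w v <= 1.
  rewrite /w; case: asboolP => [/F1|_]; last by lra.
  by rewrite ler_norml => /andP[].
have w1' v : -1 <= w v.
  rewrite /w; case: asboolP => [/F1|_]; last by lra.
  by rewrite ler_norml => /andP[].
pose L := 2 / dl; have L0 : 0 <= L by rewrite divr_ge0// ltW.
have Gge v := supconv_ge_self d_refl d_ge0 L0 w1 v.
exists L, (supconv dist w L); split=> //.
- by move=> v v'; exact: (supconv_lip d_sym d_tri d_ge0 L0 w1).
- move=> v Cv; have wv : w v = F v by rewrite /w asboolT.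
  have := Gge v; rewrite wv => g1.
  have g2 : supconv dist w L v <= F v + h.
    apply: (supconv_le d_ge0 L0 w1) => y.
    have := F1 v Cv; rewrite ler_norml => /andP[Fv1 Fv2].
    have [dy|dy] := ltP (dist v y) dl; last first.
      have : 2 <= L * dist v y by rewrite /L mulrAC ler_pdivlMr// ler_wpM2l.
      by have := w1 y; lra.
    have := mulr_ge0 L0 (d_ge0 v y); rewrite /w; case: asboolP => [Cy|_]; last by lra.
    have := Hd v y Cv Cy dy; rewrite ler_norml => /andP[? ?]; lra.
  by rewrite ler_norml; apply/andP; split; lra.
- move=> v; rewrite ler_norml; apply/andP; split.
    exact: le_trans (w1' v) (Gge v).
  exact: (supconv_leB d_ge0 L0 w1).
Qed.

Lemma lipschitz_approx_rV N (C : set 'rV[R]_D) (F : 'rV[R]_D -> 'rV[R]_N) (h : R) :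
  compact C -> (forall v, C v -> forall e : R, 0 < e -> \forall v' \near v, C v' -> `|F v - F v'| < e) ->
  (forall v, C v -> `|F v| <= 1) -> 0 < h -> h <= 1 ->
  exists (L : R) (G : 'rV[R]_D -> 'rV[R]_N), [/\ 0 <= L,
    forall v v', `|G v - G v'| <= L * `|v - v'|,
    forall v, C v -> `|G v - F v| <= h & forall v, `|G v| <= 1].
Proof.
move=> cC nF F1 h0 h1.
have H (k : 'I_N) : exists LG : R * ('rV[R]_D -> R), [/\ 0 <= LG.1,
    forall v v', `|LG.2 v - LG.2 v'| <= LG.1 * `|v - v'|,
    forall v, C v -> `|LG.2 v - F v 0 k| <= h & forall v, `|LG.2 v| <= 1].
  have [||L [G ?]] := @lipschitz_approx C (fun v => F v 0 k) h cC _ _ h0 h1; last by exists (L, G).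
    move=> v Cv e e0; apply: filterS (nF v Cv e e0) => v' FF Cv'.
    by apply: le_lt_trans (FF Cv'); have := normr_coord (F v - F v') k; rewrite !mxE.
  by move=> v Cv; apply: le_trans (F1 v Cv); exact: normr_coord.
have [LG HLG] := choice H.
pose L := \sum_k (LG k).1.
have L0 : 0 <= L by apply: sumr_ge0 => k _; have [] := HLG k.
exists L, (fun v => \row_k (LG k).2 v); split=> //.
- move=> v v'; apply: normr_rV_le => [|k]; first by rewrite mulr_ge0.
  rewrite !mxE; have [_ H1 _ _] := HLG k; apply: le_trans (H1 v v') _.
  rewrite ler_wpM2r// /L (bigD1 k)//= lerDl sumr_ge0// => k' _; have [] := HLG k'; by [].
- move=> v Cv; apply: normr_rV_le => [|k]; first exact: ltW.
  by rewrite !mxE; have [_ _ H1 _] := HLG k; exact: H1.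
- by move=> v; apply: normr_rV_le => // k; rewrite mxE; have [_ _ _ H1] := HLG k.
Qed.

End Approximation.

(** * The collapse of a chart *)

Section InverseStereographic.
Context {R : realType} {N D : nat} (a : 'rV[R]_(N + D)) (r : R) (r0 : 0 < r).
Implicit Types u : 'rV[R]_(N + D).

Let s u := dotr (u - a) (u - a).
Let b u := bumpR (r ^+ 2 - s u).
Let den u := s u + b u * b u.

(** Denominators are cleared, so that the formula remains smooth where [b] vanishes; [den] is
    positive as [s] and [b] have no common zero. *)
Definition stereo_head u : R := (s u - b u * b u) * (den u)^-1.
Definition stereo_scale u : R := 2 * b u * (den u)^-1.

(* inverse stereographic projection from the pole of [(u - a) / b u], where [b] vanishes off the
   ball of radius [r] *)
Definition stereo u : 'rV[R]_(N + D).+1 := polar (stereo_head u) (stereo_scale u *: (u - a)).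

Let s_ge0 u : 0 <= s u. Proof. exact: dotr_ge0. Qed.

Lemma stereo_centre_s : s a = 0.
Proof. by rewrite /s subrr dotrE big1// => k _; rewrite mxE mul0r. Qed.

Let ba : 0 < b a.
Proof. by rewrite /b stereo_centre_s subr0 bumpR_gt0// exprn_gt0. Qed.

Lemma stereo_den u : 0 < den u.
Proof.
rewrite /den; have [->|ua] := eqVneq u a.
  by rewrite stereo_centre_s add0r mulr_gt0.
by rewrite ltr_pwDl ?dotr_gt0 ?subr_eq0// mulr_ge0 ?bumpR_ge0.
Qed.

Lemma dotr_polar (t : R) u : dotr (polar t u) (polar t u) = t ^+ 2 + dotr u u.
Proof.
rewrite dotrE (@big_split_ord _ _ _ 1 (N + D)) /= big_ord1.
rewrite (_ : lshift (N + D) (0 : 'I_1) = 0 :> 'I_(N + D).+1); last exact: val_inj.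
by rewrite polar_head -expr2 dotrE; congr (_ + _); apply: eq_bigr => k _; rewrite polar_tail.
Qed.

Lemma stereo_sphere u : sphere (stereo u).
Proof.
rewrite /sphere /= -/(dotr _ _) dotr_polar dotrZl dotrC dotrZl -/(s u).
have := stereo_den u; rewrite /stereo_head /stereo_scale /den => d0.
by field; rewrite gt_eqF.
Qed.

Lemma stereo_pole u : r <= `|u - a| -> stereo u = pole.
Proof.
move=> ru; have sr : r ^+ 2 <= s u.
  rewrite -[leRHS]sqr_sqrtr// ler_pXn2r ?nnegrE ?sqrtr_ge0 ?(ltW r0)//.
  exact: le_trans ru (dotr_norm _).
have b0 : b u = 0 by rewrite /b bumpR_eq0// subr_le0.
have := stereo_den u; rewrite /stereo /stereo_head /stereo_scale /den b0 !mulr0 addr0 subr0 => d0.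
by rewrite mul0r scale0r divff// gt_eqF.
Qed.

Lemma stereo_scale_ge0 u : 0 <= stereo_scale u.
Proof. by rewrite /stereo_scale !mulr_ge0 ?bumpR_ge0// invr_ge0 ltW// stereo_den. Qed.

Lemma stereo_scale_eq0 u : stereo_scale u = 0 -> stereo u = pole.
Proof.
move=> /eqP; rewrite /stereo_scale mulf_eq0 invr_eq0 (gt_eqF (stereo_den u)) orbF mulf_eq0.
rewrite pnatr_eq0 /= => /eqP b0.
have := stereo_den u; rewrite /stereo /stereo_head /stereo_scale /den b0 !mulr0 addr0 subr0 => d0.
by rewrite mul0r scale0r divff// gt_eqF.
Qed.

Lemma stereo_centre : stereo a = polar (-1) 0.
Proof.
rewrite /stereo subrr scaler0 /stereo_head /den stereo_centre_s sub0r add0r.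
by rewrite mulNr divff// mulf_neq0// gt_eqF.
Qed.

Lemma pole_neq_antipode : polar (-1) 0 <> pole :> 'rV[R]_(N + D).+1.
Proof.
move=> E; have := congr1 (fun u : 'rV[R]_(N + D).+1 => u 0 0) E.
by rewrite /= !polar_head; lra.
Qed.

Lemma stereo_antipode u : stereo u = polar (-1) 0 -> u = a.
Proof.
move=> E; have [c0|c0] := eqVneq (stereo_scale u) 0.
  by have := pole_neq_antipode; rewrite -E (stereo_scale_eq0 c0).
apply/eqP; rewrite -subr_eq0; apply/eqP/rowP => k.
have := congr1 (fun u : 'rV[R]_(N + D).+1 => u 0 (rshift 1 k)) E.
rewrite /= !polar_tail [LHS]mxE [RHS]mxE => /eqP; rewrite mulf_eq0 (negbTE c0) /= => /eqP ->.
by rewrite mxE.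
Qed.

Let s_Ck k : Ck k setT s.
Proof.
have cc (j : 'I_(N + D)) : Ck k setT (fun u => (u - a) 0 j).
  apply: (Ck_ext openT _ (Ck_add openT (Ck_coord k j openT) (Ck_cst k setT (- a 0 j)))).
  by move=> u _; rewrite !mxE.
have := Ck_sum openT (fun j : 'I_(N + D) => Ck_mul openT (cc j) (cc j)).
by apply: (Ck_ext openT) => u _; rewrite /s dotrE.
Qed.

Let b_Ck k : Ck k setT b.
Proof.
apply: (Ck_comp_real openT openT _ _ (bumpR_Ck k)) => //.
exact: (Ck_add openT (Ck_cst k setT (r ^+ 2)) (Ck_opp openT (s_Ck k))).
Qed.

Let deni_Ck k : Ck k setT (fun u => (den u)^-1).
Proof.
apply: (Ck_inv openT) => [u _|]; first by rewrite gt_eqF// stereo_den.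
exact: Ck_add openT (s_Ck k) (Ck_mul openT (b_Ck k) (b_Ck k)).
Qed.

Lemma stereo_scale_Ck k : Ck k setT stereo_scale.
Proof.
exact: (Ck_mul openT (Ck_mul openT (Ck_cst k setT (2 : R)) (b_Ck k)) (deni_Ck k)).
Qed.

Lemma stereo_head_Ck k : Ck k setT stereo_head.
Proof.
apply: (Ck_mul openT _ (deni_Ck k)).
exact: (Ck_add openT (s_Ck k) (Ck_opp openT (Ck_mul openT (b_Ck k) (b_Ck k)))).
Qed.

Lemma stereo_Ck k : Ck k setT stereo.
Proof.
apply/(Ck_rowP _ _ openT) => j; case: (@split_ordP 1 (N + D) j) => i ->.
  apply: (Ck_ext openT _ (stereo_head_Ck k)) => u _.
  rewrite (_ : lshift (N + D) i = 0 :> 'I_(N + D).+1) ?polar_head//.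
  by apply: val_inj; rewrite /= ord1.
have c : Ck k setT (fun u => u 0 i - a 0 i).
  exact: (Ck_add openT (Ck_coord k i openT) (Ck_cst k setT (- a 0 i))).
apply: (Ck_ext openT _ (Ck_mul openT (stereo_scale_Ck k) c)) => u _.
by rewrite /stereo polar_tail !mxE.
Qed.

Lemma stereo_diff u : differentiable stereo u.
Proof. exact: (Ck1_differentiable openT (stereo_Ck 1) I). Qed.

(** At the centre the factor [u - a] vanishes, so only its derivative contributes, times the scale.
    The first column may stay unspecified: the determinant it enters is block triangular. *)
Lemma stereo_jacobian : exists2 h : R, 0 < h &
  exists c : 'cV[R]_(N + D), jacobian stereo a = (row_mx c h%:M : 'M[R]_(N + D, 1 + (N + D))).
Proof.
exists (stereo_scale a); first by rewrite /stereo_scale !mulr_gt0 ?invr_gt0 ?stereo_den.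
set J := jacobian stereo a.
exists (lsubmx (J : 'M[R]_(N + D, 1 + (N + D)))).
suff EJ : rsubmx (J : 'M[R]_(N + D, 1 + (N + D))) = (stereo_scale a)%:M.
  by rewrite -EJ; exact: esym (@hsubmxK R (N + D) 1 (N + D) J).
have rsubE (M : 'M[R]_(N + D, 1 + (N + D))) i k : rsubmx M i k = M i (rshift 1 k) by rewrite mxE.
apply/matrixP => i k; rewrite rsubE [RHS]mxE.
have rowJ p q (M : 'M[R]_(p, q)) i' j : M i' j = row i' M 0 j by rewrite mxE.
rewrite rowJ.
have -> : row i J = 'D_(delta_mx 0 i) stereo a := row_jacobian i (stereo_diff a).
have dv : derivable stereo a (delta_mx 0 i) by apply: (Ck_derivable (stereo_Ck 1)).
rewrite (derive_mx dv) mxE.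
have ds : derivable stereo_scale a (delta_mx 0 i) by apply: (Ck_derivable (stereo_scale_Ck 1)).
have cC : Ck 1 setT (fun u => u 0 k - a 0 k).
  exact: (Ck_add openT (Ck_coord 1 k openT) (Ck_cst 1 setT (- a 0 k))).
have dc : derivable (fun u => u 0 k - a 0 k) a (delta_mx 0 i) by apply: (Ck_derivable cC).
have E : (fun u => stereo u 0 (rshift 1 k)) = (stereo_scale * (fun u => u 0 k - a 0 k)).
  by apply/funext => u; rewrite /stereo polar_tail !mxE.
rewrite E deriveM// subrr scale0r addr0 -mulr_natr.
have -> : 'D_(delta_mx 0 i) (fun u => u 0 k - a 0 k) a = (i == k)%:R; last by [].
have d1 : derivable (fun u => u 0 k) a (delta_mx 0 i) by apply: (Ck_derivable (Ck_coord 1 k openT)).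
rewrite (deriveB d1 (derivable_cst _ _ _)) derive_cst subr0.
have di : derivable (fun u : 'rV[R]_(N + D) => u) a (delta_mx 0 i) by exact: derivable_id.
have := derive_mx di; rewrite derive_id => /(congr1 (fun u : 'rV[R]_(N + D) => u 0 k)).
by rewrite [RHS]mxE mxE eqxx /= eq_sym => <-.
Qed.

End InverseStereographic.

(** * Height, displacement and collapse in a chart *)

Section Collapse.
Context {R : realType} {N D : nat} (X : riem_data R N) (hX : is_riemannian X).
Context (i0 : idx X) (x0 : X) (d0 : dom i0 x0) (r : R) (r0 : 0 < r)
  (rimg : forall c, `|c - phi i0 x0| <= r -> img i0 c).
Notation Z := (riem_prod X (euclidean D)).

Definition zcentre : 'rV[R]_(N + D) := row_mx (phi i0 x0) 0.

Definition collapse (z : Z) : 'rV[R]_(N + D).+1 :=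
  if `[< dom i0 z.1 >] then stereo zcentre r (row_mx (phi i0 z.1) z.2) else pole.

Lemma zcentre_sub (z : Z) : row_mx (phi i0 z.1) z.2 - zcentre = row_mx (phi i0 z.1 - phi i0 x0) z.2.
Proof. by rewrite /zcentre opp_row_mx add_row_mx oppr0 addr0. Qed.

Lemma row_mx_norml p q (x : 'rV[R]_p) (y : 'rV[R]_q) : `|x| <= `|row_mx x y|.
Proof.
apply: normr_rV_le => // k; rewrite -(row_mxEl x y); exact: normr_coord.
Qed.

Lemma row_mx_normr p q (x : 'rV[R]_p) (y : 'rV[R]_q) : `|y| <= `|row_mx x y|.
Proof.
apply: normr_rV_le => // k; rewrite -(row_mxEr x y); exact: normr_coord.
Qed.

Lemma collapse_pole (z : Z) :
  (dom i0 z.1 -> r <= `|row_mx (phi i0 z.1 - phi i0 x0) z.2|) -> collapse z = pole.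
Proof.
move=> H; rewrite /collapse; case: asboolP => // dz.
by apply: stereo_pole => //; rewrite zcentre_sub; exact: H.
Qed.

Definition chart_ball : set X := psi i0 @` [set c | `|c - phi i0 x0| <= r].
Notation B := chart_ball.

Lemma chart_ball_compact : compact B.
Proof.
apply: continuous_compact; last exact: cball_compact_rV.
apply: continuous_in_subspaceT => c /set_mem Hc.
by apply: (psi_cont hX); exact: rimg.
Qed.

Lemma chart_ball_closed : closed B.
Proof. by apply: compact_closed; [exact: rm_hausdorff hX|exact: chart_ball_compact]. Qed.

Lemma chart_ball_dom x : B x -> dom i0 x.
Proof. by move=> [c Hc <-]; apply: (psi_dom hX); exact: rimg. Qed.

Lemma chart_ballP x : dom i0 x -> `|phi i0 x - phi i0 x0| <= r -> B x.
Proof. by move=> dx h; exists (phi i0 x) => //; exact: rm_phiK hX _ _ dx. Qed.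

Lemma chart_ball_far x : ~ B x -> \forall y \near x, ~ B y.
Proof.
by move=> Bx; apply: open_nbhs_nbhs; split=> //; apply: closed_openC; exact: chart_ball_closed.
Qed.

Lemma continuous_scale (T : topologicalType) m (s : T -> R) (F : T -> 'rV[R]_m) (x : T) :
  {for x, continuous s} -> {for x, continuous F} -> {for x, continuous (fun y => s y *: F y)}.
Proof.
move=> cs cF; apply: continuous_mx => a b.
have cFb : {for x, continuous (fun y => F y a b)}.
  apply: (@continuous_comp _ _ _ F (fun u : 'rV[R]_m => u a b) x cF).
  rewrite ord1; exact: coord_continuous.
have E : (fun y => (s y *: F y) a b) = (fun y => s y * F y a b) by apply/funext => y; rewrite mxE.
by rewrite E; apply: cvgM.
Qed.

Lemma continuous_sum2 (T : topologicalType) m (F G : T -> 'rV[R]_m) (x : T) :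
  {for x, continuous F} -> {for x, continuous G} -> {for x, continuous (fun y => F y + G y)}.
Proof.
move=> cF cG; apply: continuous_mx => a b.
have H (F' : T -> 'rV[R]_m) : {for x, continuous F'} -> {for x, continuous (fun y => F' y a b)}.
  move=> cF'; apply: (@continuous_comp _ _ _ F' (fun u : 'rV[R]_m => u a b) x cF').
  rewrite ord1; exact: coord_continuous.
have E : (fun y => (F y + G y) a b) = (fun y => F y a b + G y a b).
  by apply/funext => y; rewrite mxE.
by rewrite E; apply: cvgD; exact: H.
Qed.

Lemma continuous_row_mx (T : topologicalType) p q (F : T -> 'rV[R]_p) (G : T -> 'rV[R]_q) (x : T) :
  {for x, continuous F} -> {for x, continuous G} -> {for x, continuous (fun y => row_mx (F y) (G y))}.
Proof.
move=> cF cG; apply: continuous_mx => a b; rewrite ord1; case: (split_ordP b) => k ->.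
  have -> : (fun y => row_mx (F y) (G y) 0 (lshift q k)) = (fun y => F y 0 k).
    by apply/funext => y; rewrite row_mxEl.
  by apply: (@continuous_comp _ _ _ F (fun u : 'rV[R]_p => u 0 k) x cF); exact: coord_continuous.
have -> : (fun y => row_mx (F y) (G y) 0 (rshift p k)) = (fun y => G y 0 k).
  by apply/funext => y; rewrite row_mxEr.
by apply: (@continuous_comp _ _ _ G (fun u : 'rV[R]_q => u 0 k) x cG); exact: coord_continuous.
Qed.

Lemma chart_diff_continuous x : dom i0 x -> {for x, continuous (fun y => phi i0 y - phi i0 x0)}.
Proof.
by move=> dx; apply: continuous_sum2; [exact: (phi_cont hX)|exact: cst_continuous].
Qed.

Definition chart_height (x : X) : R :=
  if `[< B x >] then r^-1 * `|phi i0 x - phi i0 x0| else 1.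

(** The displacement [q] of the outline. The factor [1 - chart_height x] makes it vanish on the
    boundary of the chart ball, hence extend by [0]; its norm [e * (1 - e)] is the one required by
    [build_nonvanish]. *)
Definition chart_disp (x : X) : 'rV[R]_N :=
  if `[< B x >] then ((1 - chart_height x) / r) *: (phi i0 x - phi i0 x0) else 0.

Lemma chart_ball_norm x : B x -> `|phi i0 x - phi i0 x0| <= r.
Proof. by move=> [c Hc <-]; rewrite (psiK hX)//; exact: rimg. Qed.

Lemma chart_height01 x : 0 <= chart_height x <= 1.
Proof.
rewrite /chart_height; case: asboolP => [/chart_ball_norm h|_]; last by rewrite ler01 lexx.
by rewrite mulr_ge0 ?invr_ge0 ?(ltW r0)//= mulrC ler_pdivrMr// mul1r.
Qed.

Lemma chart_disp_norm x : `|chart_disp x| = chart_height x * (1 - chart_height x).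
Proof.
have /andP[h0 h1] := chart_height01 x.
rewrite /chart_disp; case: asboolP => [Bx|nB]; last first.
  by rewrite /chart_height asboolF// normr0 subrr mulr0.
rewrite normrZ ger0_norm; last by rewrite divr_ge0 ?subr_ge0// ltW.
have -> : `|phi i0 x - phi i0 x0| = r * chart_height x.
  by rewrite /chart_height asboolT// mulrA divff ?mul1r// gt_eqF.
by field; rewrite gt_eqF.
Qed.

Lemma chart_height_clamp x : dom i0 x ->
  chart_height x = Num.min 1 (r^-1 * `|phi i0 x - phi i0 x0|).
Proof.
move=> dx; rewrite /chart_height; case: asboolP => [/chart_ball_norm h|nB].
  by rewrite min_r// mulrC ler_pdivrMr// mul1r.
rewrite min_l// mulrC ler_pdivlMr// mul1r leNgt; apply/negP => h.
by apply: nB; apply: chart_ballP => //; exact: ltW.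
Qed.

Lemma chart_disp_dom x : dom i0 x ->
  chart_disp x = ((1 - chart_height x) / r) *: (phi i0 x - phi i0 x0).
Proof.
move=> dx; rewrite /chart_disp; case: asboolP => // nB.
by rewrite /chart_height asboolF// subrr mul0r scale0r.
Qed.

Lemma chart_height_continuous : continuous chart_height.
Proof.
move=> x; have [dx|nd] := pselect (dom i0 x).
  have cn : {for x, continuous (fun y => r^-1 * `|phi i0 y - phi i0 x0|)}.
    apply: cvgM; first exact: cvg_cst.
    by apply: cvg_norm; exact: chart_diff_continuous.
  have cmin : continuous (fun t : R => Num.min 1 t).
    move=> e; apply/cvgrPdist_le => h h0; near=> u.
    apply: le_trans (min_lip _ _ _ _) _; rewrite subrr normr0 ge_max (ltW h0) /=.
    by near: u; have /cvgrPdist_le := @cvg_id R (nbhs e); exact.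
  have cm : {for x, continuous (fun y => Num.min 1 (r^-1 * `|phi i0 y - phi i0 x0|))}.
    exact: (@continuous_comp _ _ _ (fun y => r^-1 * `|phi i0 y - phi i0 x0|)
      (fun t : R => Num.min 1 t) x cn (cmin _)).
  apply: (near_eq_continuous cm); near=> y; apply: esym; apply: chart_height_clamp.
  by near: y; exact: dom_nbhs.
have cc : {for x, continuous (fun _ : X => 1 : R)} by exact: cst_continuous.
apply: (near_eq_continuous cc).
have nB : ~ B x by move/chart_ball_dom.
by apply: filterS (chart_ball_far nB) => y By; rewrite /chart_height asboolF.
Unshelve. all: by end_near. Qed.

Lemma chart_disp_continuous : continuous chart_disp.
Proof.
move=> x; have [dx|nd] := pselect (dom i0 x).
  have cn : {for x, continuous (fun y => ((1 - chart_height y) / r) *: (phi i0 y - phi i0 x0))}.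
    apply: continuous_scale; last exact: chart_diff_continuous.
    apply: cvgM; last exact: cvg_cst.
    by apply: cvgB; [exact: cvg_cst|exact: chart_height_continuous].
  apply: (near_eq_continuous cn); near=> y; apply: esym; apply: chart_disp_dom.
  by near: y; exact: dom_nbhs.
have cc : {for x, continuous (fun _ : X => 0 : 'rV[R]_N)} by exact: cst_continuous.
apply: (near_eq_continuous cc).
have nB : ~ B x by move/chart_ball_dom.
by apply: filterS (chart_ball_far nB) => y By; rewrite /chart_disp asboolF.
Unshelve. all: by end_near. Qed.

Lemma chart_height_bounded : exists2 r' : R, 0 < r' &
  forall x, chart_height x < 1 -> riem_dist x0 x < r'.
Proof.
have lm := riem_length_metric hX.
have [s Hs] := compact_balls lm chart_ball_compact (fun _ => @ltr01 R).
exists (1 + \sum_(z <- s) riem_dist x0 z).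
  by rewrite ltr_pwDl// sumr_ge0// => z _; exact: lm_ge0.
move=> x; rewrite /chart_height; case: asboolP => [Bx _|_]; last by rewrite ltxx.
have [z zs zx] := Hs x Bx.
apply: le_lt_trans (lm_tri lm x0 z x) _; rewrite addrC; apply: ltr_leD => //.
by rewrite (big_rem z)//= lerDl sumr_ge0// => y _; exact: lm_ge0.
Qed.

(** A point outside the chart has a neighbourhood missing the compact chart ball, and there the map
    is constant; inside the chart it is [stereo] after a transition map. *)
Lemma collapse_smooth : smooth_map collapse.
Proof.
move=> i k; apply: Ck_local => _ [[x v] [/= dx _] <-] /=.
have [d0x|nd0x] := pselect (dom i0 x).
  exists (zoverlap i.1 i0); split; first exact: zoverlap_open.
    by rewrite /zoverlap /= row_mxKl; exact: overlapP.
  have oz := @zoverlap_open _ _ D _ hX i.1 i0.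
  apply: (Ck_ext oz _ (Ck_comp oz openT (fun _ _ => I) (ztrans_Ck hX k i.1 i0) (stereo_Ck zcentre r0 k))).
  move=> y [x' [d1 d2] Ey] /=; rewrite /collapse /= asboolT//.
  by rewrite -Ey (rm_phiK hX).
have oU : open [set y : 'rV[R]_(N + D) | img i.1 (lsubmx y) /\ (~` B) (psi i.1 (lsubmx y))].
  rewrite openE => y [iy By]; have cl : {for y, continuous (fun y : 'rV[R]_(N + D) => lsubmx y)}.
    exact: (Ck_continuous (@lsubmx_Ck _ _ _ 0 setT openT) I).
  have cp := psi_cont hX iy.
  have n1 : \forall y' \near lsubmx y, img i.1 y' by exact: img_nbhs.
  have n2 : \forall y' \near lsubmx y, (~` B) (psi i.1 y').
    by apply: (cp (~` B)); exact: chart_ball_far.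
  have n3 : \forall y' \near lsubmx y, img i.1 y' /\ (~` B) (psi i.1 y') by exact: filterI.
  exact: (cl _ n3).
exists [set y : 'rV[R]_(N + D) | img i.1 (lsubmx y) /\ (~` B) (psi i.1 (lsubmx y))]; split=> //.
  rewrite /= row_mxKl; split; first exact: imgP.
  rewrite (rm_phiK hX dx) => -[c Hc E]; apply: nd0x; rewrite -E.
  by apply: (psi_dom hX); exact: rimg.
apply: (Ck_ext oU _ (Ck_cst k _ (pole : 'rV[R]_(N + D).+1))) => y [_ By].
apply: esym; apply: collapse_pole => /= dp; apply: le_trans (row_mx_norml _ _).
rewrite leNgt; apply/negP => h; apply: By; exists (phi i0 (psi i.1 (lsubmx y))); first exact: ltW.
exact: rm_phiK hX _ _ dp.
Qed.

Lemma collapse_continuous : continuous collapse.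
Proof.
move=> [x v]; have c1 : {for (x, v), continuous (fun z : Z => z.1)} by exact: cvg_fst.
have c2 : {for (x, v), continuous (fun z : Z => z.2)} by exact: cvg_snd.
have [dx|nd] := pselect (dom i0 x).
  have cr : {for (x, v), continuous (fun z : Z => row_mx (phi i0 z.1) z.2)}.
    apply: continuous_row_mx => //.
    by apply: (@continuous_comp _ _ _ (fun z : Z => z.1) (phi i0) (x, v) c1); exact: (phi_cont hX).
  have cs : {for (x, v), continuous (fun z : Z => stereo zcentre r (row_mx (phi i0 z.1) z.2))}.
    apply: (@continuous_comp _ _ _ _ (stereo zcentre r) (x, v) cr).
    exact: Ck_continuous (stereo_Ck zcentre r0 0) I.
  apply: (near_eq_continuous cs).
  have n1 : \forall z \near (x, v), dom i0 (z : Z).1 by apply: (c1 (dom i0)); exact: dom_nbhs.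
  by apply: filterS n1 => z dz; rewrite /collapse asboolT.
have cc : {for (x, v), continuous (fun _ : Z => pole : 'rV[R]_(N + D).+1)} by exact: cst_continuous.
apply: (near_eq_continuous cc).
have nB : ~ B x by move/chart_ball_dom.
have n1 : \forall z \near (x, v), ~ B (z : Z).1 by apply: (c1 (~` B)); exact: chart_ball_far.
apply: filterS n1 => z Bz; apply: esym; apply: collapse_pole => dz.
apply: le_trans (row_mx_norml _ _); rewrite leNgt; apply/negP => h.
by apply: Bz; apply: chart_ballP => //; exact: ltW.
Qed.

Let z0 : Z := (x0, 0).

Lemma collapse_centre : collapse z0 = polar (-1) 0.
Proof. by rewrite /collapse asboolT// stereo_centre. Qed.

Lemma collapse_antipode z : collapse z = polar (-1) 0 -> z = z0.
Proof.
rewrite /collapse; case: asboolP => [dz|_]; last by move/esym/pole_neq_antipode.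
move=> /(stereo_antipode r0) /eq_row_mx [E1 E2]; case: z dz E1 E2 => x v /= dx E1 ->.
by congr pair; rewrite -(rm_phiK hX dx) E1 (rm_phiK hX d0).
Qed.

Lemma collapse_jacobian (i : idx Z) : dom i.1 x0 -> exists2 h : R, 0 < h &
  exists c : 'cV[R]_(N + D), jacobian (collapse \o psi i) (phi i z0) =
    block_mx (Jac i.1 i0 x0) 0 0 1%:M *m (row_mx c h%:M : 'M[R]_(N + D, 1 + (N + D))).
Proof.
move=> di; have [h h0 [c Hc]] := stereo_jacobian zcentre r0.
exists h => //; exists c.
set y0 := row_mx (phi i.1 x0) 0 : 'rV[R]_(N + D).
have tz : ztrans i.1 i0 y0 = zcentre by rewrite /ztrans row_mxKl row_mxKr trans_phi.
have df := ztrans_diff hX (0 : 'rV[R]_D) di d0.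
have dg := stereo_diff zcentre r0 (ztrans i.1 i0 y0).
have ne : \near y0, (stereo zcentre r \o ztrans i.1 i0) y0 = (collapse \o psi i) y0.
  have oz := @zoverlap_open _ _ D _ hX i.1 i0.
  have zy : zoverlap i.1 i0 y0 by rewrite /zoverlap /= row_mxKl; exact: overlapP.
  have n1 : \forall y \near y0, zoverlap i.1 i0 y by apply: open_nbhs_nbhs.
  apply: filterS n1 => y [x' [d1 d2] Ey] /=; rewrite /collapse /= asboolT//.
  by rewrite -Ey (rm_phiK hX).
have E1 := near_eq_jacobian ne (differentiable_comp df dg).
apply: etrans (esym E1) _; apply: etrans (jacobian_comp df dg) _.
congr (_ *m _); first exact: ztrans_jacobian.
by apply: etrans Hc; congr (jacobian _ _).
Qed.

(** The outward normal at the antipode has head [-1], whence the sign; this is why the orientation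
    has to be [-1] in the chart [i0] at [x0]. *)
Lemma collapse_sign (i : idx Z) : dom i.1 x0 -> jac_sign collapse i z0 = - sg i.1 i0 x0.
Proof.
move=> di; rewrite sgE /jac_sign collapse_centre; have [h h0 [c ->]] := collapse_jacobian di.
set A := block_mx _ _ _ _.
have -> : col_mx (polar (-1) 0) (A *m (row_mx c h%:M : 'M[R]_(N + D, 1 + (N + D)))) =
    block_mx (1%:M : 'M[R]_1) 0 0 A *m
    (block_mx (-1)%:M 0 c h%:M : 'M[R]_(1 + (N + D))) :> 'M[R]_((N + D).+1).
  rewrite block_mxEv mul_block_col !mul0mx addr0 add0r mul1mx; by [].
rewrite (@det_mulmx R (1 + (N + D))) !det_lblock !det1 det_scalar1 det_scalar mul1r mulr1.
rewrite !sgzM sgzN1 (gtr0_sgz (exprn_gt0 _ h0)) mulr1 mulrN1.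
by [].
Qed.

Lemma collapse_degree (o : idx X -> X -> int) : is_orientation o -> o i0 x0 = -1 ->
  forall f : Z -> 'rV[R]_(N + D).+1, homotopic pole f collapse ->
  has_degree (Z := Z) (fun i z => o i.1 z.1) f pole 1.
Proof.
move=> [_ _ o3] oc f [H [cH sH H0 H1 Hp]].
exists collapse, H, (polar (-1) 0), [:: z0], (fun _ => 1); split.
- split=> //; first exact: continuous_subspaceT.
- exact: collapse_smooth.
- split=> //.
  + by rewrite -collapse_centre -[collapse z0]/(extend collapse pole (Some z0)) -H1.
  + exact: pole_neq_antipode.
  + move=> z; rewrite mem_seq1; split=> [/eqP ->|/collapse_antipode ->//].
    exact: collapse_centre.
- move=> z i; rewrite mem_seq1 => /eqP -> [di _]; rewrite collapse_sign//=.
  have E := o3 i.1 i0 x0 di d0; rewrite -/(Jac i.1 i0 x0) -sgE oc in E.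
  rewrite E mulrN1 mulrNN.
  by have [->|->] := sg_pm hX di d0.
- by rewrite big_seq1.
Qed.

End Collapse.

(** * Deformation onto the collapse *)

Section Deformation.
Context {R : realType} {N D : nat} (X : riem_data R N) (hX : complete_riemannian X).
Context (i0 : idx X) (x0 : X) (d0 : dom i0 x0) (r : R) (r0 : 0 < r)
  (rimg : forall c, `|c - phi i0 x0| <= r -> img i0 c).
Context (l : R) (l0 : 0 < l) (Th : X -> 'rV[R]_D -> 'rV[R]_D) (P : R -> X -> 'rV[R]_D -> X) (E : R)
  (md : is_model (@riem_dist R N X) l Th P E).
Notation Z := (riem_prod X (euclidean D)).
Notation d := (@riem_dist R N X).
Notation ht := (chart_height i0 x0 r).
Notation dp := (chart_disp i0 x0 r).
Context (rr : R) (rr0 : 0 < rr) (Hrr : forall x, ht x < 1 -> d x0 x < rr).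

Let hX1 : is_riemannian X := hX.1.
Let lm : length_metric d := riem_length_metric hX1.

(** It starts [E] beyond the radius [rr] enclosing the chart ball: where it is positive, even a
    point moved by less than [E] lies where the height is [1]. The width [l] gives the slope
    [1 / l]. *)
Definition zeta (x : X) : R := clamp01 ((d x0 x - (rr + E)) / l).

Definition core : set X := [set x | d x0 x <= rr + E + l].

Lemma core_compact : compact core.
Proof. by apply: (hopf_rinow lm); exact: hX.2. Qed.

Lemma core_closed : closed core.
Proof. exact: (cball_closed lm). Qed.

Lemma zeta_far x : ~ core x -> 1 <= zeta x.
Proof.
move=> /negP; rewrite /core /= -ltNge => h; rewrite /zeta clamp01_ge1// ler_pdivlMr//; lra.
Qed.

Lemma zeta_near x y : d x y < E -> 0 < zeta x -> ht y = 1.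
Proof.
move=> xy; rewrite /zeta; have [h|h _] := leP ((d x0 x - (rr + E)) / l) 0.
  by rewrite clamp01_le0// ltxx.
have /andP[_ y1] := chart_height01 hX1 r0 rimg y.
apply: le_anti; rewrite y1 /= leNgt; apply/negP => /Hrr hy.
move: h; rewrite pmulr_lgt0 ?invr_gt0// => h.
by have := lm_tri lm x0 y x; rewrite (lm_sym lm y x); lra.
Qed.

Lemma zeta_continuous : continuous zeta.
Proof.
move=> x; have cn : {for x, continuous (fun x => (d x0 x - (rr + E)) / l)}.
  apply: cvgM; last exact: cvg_cst.
  by apply: cvgB; [exact: (lm_continuous lm)|exact: cvg_cst].
exact: (@continuous_comp _ _ _ _ clamp01 x cn (@clamp01_continuous R _)).
Qed.

Lemma zeta_lip x x' : `|zeta x - zeta x'| <= l^-1 * d x x'.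
Proof.
apply: le_trans (clamp01_lip _ _) _.
rewrite (_ : _ - _ = l^-1 * (d x0 x - d x0 x')); last by field; rewrite gt_eqF.
by rewrite normrM gtr0_norm ?invr_gt0// ler_wpM2l ?invr_ge0 ?(ltW l0)// (lm_lipschitz lm).
Qed.

Lemma build_far x y w (th : 'rV[R]_D) e : d x y < E -> `|w - dp y| <= 1 / 32 -> `|e - ht y| <= 1 / 32 ->
  1 / 100 <= `|build w th e (zeta x)|.
Proof.
move=> xy hw he; apply: (@build_nonvanish R N D (dp y) w th (ht y) e (zeta x)) => //.
- exact: (chart_height01 hX1 r0 rimg).
- exact: (chart_disp_norm hX1 r0 rimg).
- by have /andP[] := clamp01P ((d x0 x - (rr + E)) / l).
- exact: zeta_near.
Qed.

Lemma pole_norm : 1 <= `|pole : 'rV[R]_(N + D).+1|.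
Proof.
have := normr_coord (pole : 'rV[R]_(N + D).+1) 0.
by rewrite /pole polar_head normr1.
Qed.

Lemma norm_neq0 m (u : 'rV[R]_m) : 1 / 100 <= `|u| -> u != 0.
Proof. by move=> h; rewrite -normr_gt0; apply: lt_le_trans h; lra. Qed.

Context (J : R) (J0 : 0 < J)
  (HJ : forall x (v : 'rV[R]_D) k, core x -> J <= v 0 k -> Th x v 0 k = 1).

Lemma norm_coord_gt m (v : 'rV[R]_m) (c : R) : 0 <= c -> c < `|v| -> exists k, c < `|v 0 k|.
Proof.
move=> c0 cv; apply: contrapT => H; move: cv; rewrite ltNge => /negP; apply.
by apply: normr_rV_le => // k; rewrite leNgt; apply/negP => ?; apply: H; exists k.
Qed.

(** Far out, [Th x v] and [v] have a coordinate of the same sign in common; the linear homotopy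
    between them therefore keeps away from [0]. *)
Lemma Th_sign x (v : 'rV[R]_D) : core x -> J < `|v| -> exists k,
  [/\ `|v 0 k| > J & (v 0 k > 0 /\ Th x v 0 k = 1) \/ (v 0 k < 0 /\ Th x v 0 k = -1)].
Proof.
move=> Kx /(norm_coord_gt (ltW J0))[k hk]; exists k; split=> //.
have [vk|vk] := leP 0 (v 0 k).
  left; rewrite ger0_norm// in hk; split; first exact: lt_trans hk.
  by apply: HJ => //; exact: ltW.
by right; split=> //; apply: (md_neg md); exact: ltW.
Qed.

Lemma Th_off x v : core x -> J < `|v| -> 1 <= `|Th x v|.
Proof.
move=> Kx /(Th_sign Kx)[k [_ H]]; apply: le_trans (normr_coord _ k).
by case: H => -[_ ->]; rewrite ?normrN1 ?normr1.
Qed.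

Lemma box_compact M : compact [set v : 'rV[R]_D | `|v| <= M].
Proof.
have := @cball_compact_rV R D 0 M.
by rewrite (_ : [set w | _] = [set v | `|v| <= M])//; apply/funext => v /=; rewrite subr0.
Qed.

Lemma box_closed M : closed [set v : 'rV[R]_D | `|v| <= M].
Proof. by apply: compact_closed; [exact: norm_hausdorff|exact: box_compact]. Qed.

Definition supp (M : R) : set Z := core `*` [set v : 'rV[R]_D | `|v| <= M].

Lemma supp_compact M : compact (supp M).
Proof. by apply: compact_setX; [exact: core_compact|exact: box_compact]. Qed.

Lemma supp_closed M : closed (supp M).
Proof.
have -> : supp M = (fst @^-1` core) `&` (snd @^-1` [set v : 'rV[R]_D | `|v| <= M]) by [].
apply: closedI.
  by apply: closed_comp; [move=> z _; exact: cvg_fst|exact: core_closed].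
by apply: closed_comp; [move=> z _; exact: cvg_snd|exact: box_closed].
Qed.

Definition low : set 'rV[R]_D := [set v | exists2 x, core x & `|Th x v| <= 1 / 2].

(** [low] is the projection of a closed part of [supp J], since [Th x v] is not small for larger
    [v]. *)
Lemma low_compact : compact low.
Proof.
have -> : low = snd @` (supp J `&` [set z : Z | `|Th z.1 z.2| <= 1 / 2]).
  apply/seteqP; split=> [v [x Kx h]|_ [[x v] [[/= Kx _] h] <-]]; last by exists x.
  exists (x, v) => //; split=> //; split=> //=; rewrite leNgt; apply/negP => /(Th_off Kx); lra.
apply: continuous_compact; first by apply: continuous_subspaceT => z; exact: cvg_snd.
apply: compact_closedI; first exact: supp_compact.
have -> : [set z : Z | `|Th z.1 z.2| <= 1 / 2] =
  (fun z : X * 'rV[R]_D => `|Th z.1 z.2|) @^-1` [set t | t <= 1 / 2] by [].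
apply: closed_comp; last exact: closed_le.
by move=> z _; apply: cvg_norm; exact: (md_cont md).
Qed.

(* by [md_P1] the choice of the point of the core does not matter *)
Definition shadow (v : 'rV[R]_D) : X := P 1 (xget x0 [set x | core x /\ `|Th x v| <= 1 / 2]) v.

Lemma shadowE x v : low v -> `|Th x v| < 1 -> shadow v = P 1 x v.
Proof.
move=> [y Ky hy] hx; apply: (md_P1 md) => //.
case: xgetP => [x' _ [_ h]|/(_ y)]; first by apply: le_lt_trans h _; lra.
by move/(_ (conj Ky hy)).
Qed.

(** The same [x] serves for all [v'] near [v]: the bound [1 / 2] at [v] leaves [Th x v'] below [1],
    so the shadow is locally [P 1 x], which is continuous. *)
Lemma shadow_near (V : normedModType R) (psi : X -> V) v : continuous psi -> low v ->
  forall e : R, 0 < e -> \forall v' \near v, low v' -> `|psi (shadow v) - psi (shadow v')| < e.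
Proof.
move=> cpsi lv e e0; have [x Kx hx] := lv.
have hx1 : `|Th x v| < 1 by apply: le_lt_trans hx _; lra.
have c1 : {for v, continuous (fun v' : 'rV[R]_D => (x, v'))}.
  by apply: continuous_pair; [exact: cst_continuous|exact: cvg_id].
have cT : {for v, continuous (fun v' => Th x v')}.
  exact: (@continuous_comp _ _ _ (fun v' => (x, v')) (fun w : X * 'rV[R]_D => Th w.1 w.2) v c1
    (@md_cont _ _ _ _ _ _ _ _ md (x, v))).
have c2 : {for v, continuous (fun v' : 'rV[R]_D => (1 : R, (x, v')))}.
  by apply: continuous_pair; [exact: cst_continuous|exact: c1].
have cP : {for v, continuous (fun v' => P 1 x v')}.
  exact: (@continuous_comp _ _ _ (fun v' => (1 : R, (x, v')))
    (fun w : R * (X * 'rV[R]_D) => P w.1 w.2.1 w.2.2) v c2 (@md_Pcont _ _ _ _ _ _ _ _ md 1 x v hx1)).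
have cpP : {for v, continuous (fun v' => psi (P 1 x v'))}.
  exact: (@continuous_comp _ _ _ (fun v' => P 1 x v') psi v cP (cpsi _)).
have n1 : \forall v' \near v, `|psi (P 1 x v) - psi (P 1 x v')| < e by move/cvgrPdist_lt : cpP; apply.
have n2 : \forall v' \near v, `|Th x v'| < 1.
  have cn : {for v, continuous (fun v' => `|Th x v'|)}.
    exact: (@continuous_comp _ _ _ (fun v' => Th x v') (fun y : 'rV[R]_D => `|y|) v cT (@norm_continuous _ _ _)).
  by apply: (cn [set t | t < 1]); exact: lt_nbhsl.
near=> v' => lv'; rewrite (shadowE lv hx1) (shadowE lv' (x := x)); first by near: v'.
by near: v'.
Unshelve. all: by end_near. Qed.

Lemma homotopic_off (c M : R) (Y : R -> Z -> 'rV[R]_(N + D).+1) :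
  continuous (fun u : R * Z => Y u.1 u.2) -> (forall t z, Y t z != 0) ->
  (forall t x v, ~ core x -> Y t (x, v) = pole) ->
  (forall t x v, core x -> M < `|v| -> Y t (x, v) = pole) ->
  homotopic pole (fun z : Z => nrm (Y 0 z)) (fun z : Z => nrm (Y 1 z)).
Proof.
move=> cY Y0 Y1 Y2; apply: (homotopic_nrm (K := supp M)) => //.
- exact: pole_sphere.
- exact: supp_compact.
- exact: supp_closed.
- move=> t [x v] nS; exists 1; rewrite ?scale1r//.
  have [Kx|nK] := pselect (core x); last exact: Y1.
  by apply: Y2 => //; rewrite ltNge; apply/negP => h; exact: nS.
Qed.

(** * The four stages of the homotopy *)

Section Stages.
Context (c : R) (c0 : 0 < c) (W : 'rV[R]_D -> 'rV[R]_N) (We : 'rV[R]_D -> R)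
  (cW : continuous W) (cWe : continuous We)
  (HW : forall v, low v -> `|W v - dp (shadow v)| <= 1 / 32)
  (HWe : forall v, low v -> `|We v - ht (shadow v)| <= 1 / 32).

Definition approx_map (z : Z) : 'rV[R]_(N + D).+1 :=
  build (W (c *: z.2)) (Th z.1 (c *: z.2)) (We (c *: z.2)) (zeta z.1).

Lemma approx_map_norm z : 1 / 100 <= `|approx_map z|.
Proof.
rewrite /approx_map; set v := c *: z.2.
have [Kx|nK] := pselect (core z.1); last first.
  by rewrite build_pole; [apply: le_trans pole_norm; lra|right; right; exact: zeta_far].
have [h|h] := leP `|Th z.1 v| (1 / 2); last first.
  by rewrite build_pole; [apply: le_trans pole_norm; lra|left; lra].
have lv : low v by exists z.1.
apply: (@build_far _ (shadow v)); [|exact: HW|exact: HWe].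
rewrite (shadowE lv (x := z.1)); last by apply: le_lt_trans h _; lra.
exact: (md_near md).
Qed.

Let O := (R * Z)%type.

Let cfst : continuous (fun u : O => u.1). Proof. by move=> u; exact: cvg_fst. Qed.
Let cx : continuous (fun u : O => u.2.1).
Proof. by move=> u; apply: (@continuous_comp _ _ _ snd fst); [exact: cvg_snd|exact: cvg_fst]. Qed.
Let cv0 : continuous (fun u : O => u.2.2).
Proof. by move=> u; apply: (@continuous_comp _ _ _ snd snd); exact: cvg_snd. Qed.
Let cv : continuous (fun u : O => c *: u.2.2).
Proof.
move=> u; have cc : {for u, continuous (fun _ : O => c)} by exact: cst_continuous.
exact: continuous_scale cc (@cv0 u).
Qed.
Let cTh : continuous (fun u : O => Th u.2.1 (c *: u.2.2)).
Proof.
move=> u; exact: (@continuous_comp _ _ _ (fun u : O => (u.2.1, c *: u.2.2))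
  (fun w : X * 'rV[R]_D => Th w.1 w.2) u (continuous_pair (@cx u) (@cv u))
  (@md_cont _ _ _ _ _ _ _ _ md (u.2.1, c *: u.2.2))).
Qed.
Let cz : continuous (fun u : O => zeta u.2.1).
Proof. by move=> u; exact: (@continuous_comp _ _ _ _ zeta u (@cx u) (@zeta_continuous _)). Qed.
Let cP (s : R -> R) u : continuous s -> `|Th u.2.1 (c *: u.2.2)| < 1 ->
  {for u, continuous (fun u : O => P (s u.1) u.2.1 (c *: u.2.2))}.
Proof.
move=> cs h.
have c1 : {for u, continuous (fun u : O => s u.1)} by exact: (@continuous_comp _ _ _ _ s u (@cfst u) (cs _)).
exact: (@continuous_comp _ _ _ (fun u : O => (s u.1, (u.2.1, c *: u.2.2)))
    (fun w : R * (X * 'rV[R]_D) => P w.1 w.2.1 w.2.2) u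
    (continuous_pair c1 (continuous_pair (@cx u) (@cv u))) (@md_Pcont _ _ _ _ _ _ _ _ md (s u.1) u.2.1 (c *: u.2.2) h)).
Qed.
Let cdp : continuous dp. Proof. exact: (chart_disp_continuous hX1 r0 rimg). Qed.
Let cht : continuous ht. Proof. exact: (chart_height_continuous hX1 r0 rimg). Qed.
Let ccl : continuous (fun u : O => clamp01 u.1).
Proof. by move=> u; exact: (@continuous_comp _ _ _ _ clamp01 u (@cfst u) (@clamp01_continuous R _)). Qed.
Let c1cl : continuous (fun u : O => 1 - clamp01 u.1).
Proof. by move=> u; apply: cvgB; [exact: cvg_cst|exact: ccl]. Qed.

Let cbound x (v : 'rV[R]_D) : core x -> J / c < `|v| -> J < `|c *: v|.
Proof. by move=> _; rewrite ltr_pdivrMr// normrZ (gtr0_norm c0) mulrC. Qed.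

Lemma stage_continuous (w : R -> Z -> 'rV[R]_N) (th : R -> Z -> 'rV[R]_D) (e : R -> Z -> R) (u : O) :
  {for u, continuous (fun u : O => th u.1 u.2)} ->
  (`|th u.1 u.2| < 1 -> {for u, continuous (fun u : O => w u.1 u.2)} /\
    {for u, continuous (fun u : O => e u.1 u.2)}) ->
  {for u, continuous (fun u : O => build (w u.1 u.2) (th u.1 u.2) (e u.1 u.2) (zeta u.2.1))}.
Proof.
move=> cth H.
exact: (@build_continuous R N D O (fun u => w u.1 u.2) (fun u => th u.1 u.2) (fun u => e u.1 u.2)
  (fun u => zeta u.2.1) u cth (@cz u) H).
Qed.

(** From the Lipschitz approximations back to the exact displacement and height, by linear
    interpolation, which keeps the errors within [1 / 32]. *)
Lemma stage1 : homotopic pole (fun z => nrm (approx_map z))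
  (fun z : Z => nrm (build (dp (P 1 z.1 (c *: z.2))) (Th z.1 (c *: z.2)) (ht (P 1 z.1 (c *: z.2))) (zeta z.1))).
Proof.
pose w (t : R) (z : Z) := (1 - clamp01 t) *: W (c *: z.2) + clamp01 t *: dp (P 1 z.1 (c *: z.2)).
pose e (t : R) (z : Z) := (1 - clamp01 t) * We (c *: z.2) + clamp01 t * ht (P 1 z.1 (c *: z.2)).
pose Y (t : R) (z : Z) := build (w t z) (Th z.1 (c *: z.2)) (e t z) (zeta z.1).
have := @homotopic_off c (J / c) Y.
have -> : (fun z : Z => nrm (Y 0 z)) = (fun z => nrm (approx_map z)).
  by apply/funext => z; rewrite /Y /w /e /approx_map (@clamp01_le0 _ 0)// subr0 scale1r scale0r addr0 mul1r mul0r addr0.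
have -> : (fun z : Z => nrm (Y 1 z)) = (fun z =>
    nrm (build (dp (P 1 z.1 (c *: z.2))) (Th z.1 (c *: z.2)) (ht (P 1 z.1 (c *: z.2))) (zeta z.1))).
  by apply/funext => z; rewrite /Y /w /e (@clamp01_ge1 _ 1)// subrr scale1r scale0r add0r mul1r mul0r add0r.
apply.
- move=> u; apply: (@stage_continuous w (fun _ z => Th z.1 (c *: z.2)) e u (@cTh u)) => h.
  have cP1 := cP (s := fun _ => 1) (@cst_continuous _ _ _) h.
  split.
    apply: continuous_sum2; apply: continuous_scale; [exact: c1cl| |exact: ccl|].
      exact: (@continuous_comp _ _ _ _ W u (@cv u) (@cW _)).
    exact: (@continuous_comp _ _ _ _ dp u cP1 (@cdp _)).
  apply: cvgD; apply: cvgM; [exact: c1cl| |exact: ccl|].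
    exact: (@continuous_comp _ _ _ _ We u (@cv u) (@cWe _)).
  exact: (@continuous_comp _ _ _ _ ht u cP1 (@cht _)).
- move=> t z; rewrite /Y /w /e; set v := c *: z.2.
  have [Kx|nK] := pselect (core z.1); last first.
    by apply: norm_neq0; rewrite build_pole; [apply: le_trans pole_norm; lra|right; right; exact: zeta_far].
  have [h|h] := leP `|Th z.1 v| (1 / 2); last first.
    by apply: norm_neq0; rewrite build_pole; [apply: le_trans pole_norm; lra|left; lra].
  have lv : low v by exists z.1.
  have h1 : `|Th z.1 v| < 1 by apply: le_lt_trans h _; lra.
  have /andP[t0 t1] := clamp01P t.
  have E1 m (a b : 'rV[R]_m) s : (1 - s) *: a + s *: b - b = (1 - s) *: (a - b).
    by rewrite scalerBr -addrA; congr (_ + _); rewrite [in RHS]scalerBl scale1r opprB.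
  apply: norm_neq0; apply: (@build_far _ (P 1 z.1 v)); first exact: (md_near md).
    rewrite E1 normrZ ger0_norm ?subr_ge0//; have := HW lv; rewrite (shadowE lv h1).
    by have := normr_ge0 (W v - dp (P 1 z.1 v)); nra.
  rewrite (_ : _ - _ = (1 - clamp01 t) * (We v - ht (P 1 z.1 v))); last by ring.
  rewrite normrM ger0_norm ?subr_ge0//; have := HWe lv; rewrite (shadowE lv h1).
  by have := normr_ge0 (We v - ht (P 1 z.1 v)); nra.
- by move=> t x v nK; apply: build_pole; right; right; exact: zeta_far.
- by move=> t x v Kx h; apply: build_pole; left; have := Th_off Kx (cbound Kx h); lra.
Qed.

(** The contractions are undone. Nonvanishing persists because [build_far] accepts any point within
    [E] of [z.1]. *)
Lemma stage2 : homotopic pole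
  (fun z : Z => nrm (build (dp (P 1 z.1 (c *: z.2))) (Th z.1 (c *: z.2)) (ht (P 1 z.1 (c *: z.2))) (zeta z.1)))
  (fun z : Z => nrm (build (dp z.1) (Th z.1 (c *: z.2)) (ht z.1) (zeta z.1))).
Proof.
pose w (t : R) (z : Z) := dp (P (1 - clamp01 t) z.1 (c *: z.2)).
pose e (t : R) (z : Z) := ht (P (1 - clamp01 t) z.1 (c *: z.2)).
pose Y (t : R) (z : Z) := build (w t z) (Th z.1 (c *: z.2)) (e t z) (zeta z.1).
have := @homotopic_off c (J / c) Y.
have -> : (fun z : Z => nrm (Y 0 z)) = (fun z =>
    nrm (build (dp (P 1 z.1 (c *: z.2))) (Th z.1 (c *: z.2)) (ht (P 1 z.1 (c *: z.2))) (zeta z.1))).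
  by apply/funext => z; rewrite /Y /w /e (@clamp01_le0 _ 0)// subr0.
have -> : (fun z : Z => nrm (Y 1 z)) = (fun z : Z => nrm (build (dp z.1) (Th z.1 (c *: z.2)) (ht z.1) (zeta z.1))).
  by apply/funext => z; rewrite /Y /w /e (@clamp01_ge1 _ 1)// subrr !(md_P0 md).
have cs : continuous (fun t : R => 1 - clamp01 t).
  by move=> t; apply: cvgB; [exact: cvg_cst|exact: clamp01_continuous].
apply.
- move=> u; apply: (@stage_continuous w (fun _ z => Th z.1 (c *: z.2)) e u (@cTh u)) => h.
  have cPs := cP cs h; split.
    exact: (@continuous_comp _ _ _ _ dp u cPs (@cdp _)).
  exact: (@continuous_comp _ _ _ _ ht u cPs (@cht _)).
- move=> t z; apply: norm_neq0; apply: (@build_far _ (P (1 - clamp01 t) z.1 (c *: z.2))).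
  + exact: (md_near md).
  + by rewrite subrr normr0.
  + by rewrite subrr normr0.
- by move=> t x v nK; apply: build_pole; right; right; exact: zeta_far.
- by move=> t x v Kx h; apply: build_pole; left; have := Th_off Kx (cbound Kx h); lra.
Qed.

Let E0 : 0 < E.
Proof. by apply: le_lt_trans (md_near md 0 x0 0); exact: (lm_ge0 lm). Qed.

(** [Th] is straightened. Beyond [J / c] some coordinate of [Th] is [1] or [-1] and the same
    coordinate of [(c / J) *: z.2] has that sign and absolute value above [1], so the interpolation
    stays at the pole. *)
Lemma stage3 : homotopic pole
  (fun z : Z => nrm (build (dp z.1) (Th z.1 (c *: z.2)) (ht z.1) (zeta z.1)))
  (fun z : Z => nrm (build (dp z.1) ((c / J) *: z.2) (ht z.1) (zeta z.1))).
Proof.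
pose th (t : R) (z : Z) := (1 - clamp01 t) *: Th z.1 (c *: z.2) + (clamp01 t * (c / J)) *: z.2.
pose Y (t : R) (z : Z) := build (dp z.1) (th t z) (ht z.1) (zeta z.1).
have := @homotopic_off c (J / c) Y.
have -> : (fun z : Z => nrm (Y 0 z)) =
    (fun z : Z => nrm (build (dp z.1) (Th z.1 (c *: z.2)) (ht z.1) (zeta z.1))).
  by apply/funext => z; rewrite /Y /th (@clamp01_le0 _ 0)// subr0 scale1r mul0r scale0r addr0.
have -> : (fun z : Z => nrm (Y 1 z)) =
    (fun z : Z => nrm (build (dp z.1) ((c / J) *: z.2) (ht z.1) (zeta z.1))).
  by apply/funext => z; rewrite /Y /th (@clamp01_ge1 _ 1)// subrr mul1r scale0r add0r.
apply.
- move=> u; apply: (@stage_continuous (fun _ z => dp z.1) th (fun _ z => ht z.1) u) => [|h].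
    apply: continuous_sum2; apply: continuous_scale; [exact: c1cl|exact: cTh| |exact: cv0].
    by apply: cvgM; [exact: ccl|exact: cvg_cst].
  split; first exact: (@continuous_comp _ _ _ _ dp u (@cx u) (@cdp _)).
  exact: (@continuous_comp _ _ _ _ ht u (@cx u) (@cht _)).
- move=> t z; apply: norm_neq0; apply: (@build_far _ z.1); rewrite ?subrr ?normr0//.
  by rewrite (lm_refl lm).
- by move=> t x v nK; apply: build_pole; right; right; exact: zeta_far.
- move=> t x v Kx h; apply: build_pole; left.
  suff : 1 <= `|th t (x, v)| by lra.
  have [k [hk Hk]] := Th_sign Kx (cbound Kx h).
  have /andP[t0 t1] := clamp01P t.
  apply: le_trans (normr_coord _ k); rewrite /th /= mxE [X in `|X + _|]mxE [X in `|_ + X|]mxE.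
  have -> : clamp01 t * (c / J) * v 0 k = clamp01 t * ((c *: v) 0 k / J).
    by rewrite [in RHS]mxE; ring.
  have hJ : 1 < `|(c *: v) 0 k / J| by rewrite normrM normfV (gtr0_norm J0) ltr_pdivlMr// mul1r.
  case: Hk => -[hv ->].
    have hp : 0 < (c *: v) 0 k / J by rewrite divr_gt0.
    rewrite gtr0_norm// in hJ.
    rewrite [leRHS]ger0_norm; nra.
  have hp : (c *: v) 0 k / J < 0 by rewrite pmulr_llt0 ?invr_gt0.
  rewrite ltr0_norm// in hJ.
  rewrite [leRHS]ler0_norm; nra.
Qed.

Lemma chart_centre (z : Z) : dom i0 z.1 -> phi i0 z.1 - phi i0 x0 = 0 -> z.2 = 0 -> z = (x0, 0).
Proof.
case: z => x v /= dx /eqP; rewrite subr_eq0 => /eqP E1 ->; congr pair.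
by rewrite -(rm_phiK hX1 dx) E1 (rm_phiK hX1 d0).
Qed.

(** In the chart, both tails are nonnegative multiples of the centred coordinates, block by block. A
    zero of the interpolation forces these coordinates to vanish, and at the centre both heads are
    [-1]. *)
Lemma stage4_neq0 (s : R) (z : Z) : 0 <= s <= 1 ->
  (1 - s) *: build (dp z.1) ((c / J) *: z.2) (ht z.1) (zeta z.1) + s *: collapse i0 x0 r z != 0.
Proof.
move=> /andP[s0 s1]; apply/eqP => Y0; set B0 := build _ _ _ _ in Y0.
have B1 : 1 / 100 <= `|B0|.
  by apply: (@build_far _ z.1); rewrite ?subrr ?normr0// (lm_refl lm).
pose t0 := cutoff ((c / J) *: z.2) (ht z.1) (zeta z.1).
have /andP[t00 t01] : 0 <= t0 <= 1 by exact: cutoff01.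
have coordE j : (1 - s) * B0 0 j + s * collapse i0 x0 r z 0 j = 0.
  by have := congr1 (fun u : 'rV[R]_(N + D).+1 => u 0 j) Y0; rewrite !mxE.
have hd := coordE 0; rewrite build_head -/t0 in hd.
have tl k := coordE (rshift 1 (lshift D k)).
have tr k := coordE (rshift 1 (rshift N k)).
have [s00|sn0] := eqVneq s 0.
  move: Y0; rewrite s00 subr0 scale1r scale0r addr0 => B00.
  by move: B1; rewrite B00 normr0; lra.
have sp : 0 < s by rewrite lt_def sn0.
have /andP[h0 h1] := chart_height01 hX1 r0 rimg z.1.
have cJ : 0 < c / J by rewrite divr_gt0.
(* At the pole the collapse has no tail, so that of [build] vanishes by itself; this leads to the
   centre, whose collapse is not the pole. *)
have [cp|ncp] := pselect (collapse i0 x0 r z = pole).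
  rewrite cp /pole polar_head mulr1 in hd.
  have t12 : t0 < 1 by rewrite ltNge; apply/negP => ?; nra.
  have s12 : s < 1 by rewrite ltNge; apply/negP => ?; nra.
  have h12 : ht z.1 < 1.
    rewrite lt_neqAle h1 andbT; apply/eqP => E1.
    have : t0 = 1 by apply: cutoff_eq1; right; left; rewrite E1.
    by lra.
  have Bz : chart_ball i0 x0 r z.1.
    by move: h12; rewrite /chart_height; case: asboolP => //; rewrite ltxx.
  have dz := chart_ball_dom hX1 rimg Bz.
  have v0 : z.2 = 0.
    apply/rowP => k; have := tr k; rewrite build_r -/t0 cp /pole polar_tail mxE [X in _ + s * X]mxE.
    rewrite mulr0 addr0 => /eqP; rewrite !mulf_eq0 !subr_eq0 (gt_eqF s12) (gt_eqF t12).
    by rewrite -mulf_eq0 (gt_eqF cJ) /= => /eqP ->; rewrite mxE.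
  have dp0 : dp z.1 = 0.
    apply/rowP => k; have := tl k; rewrite build_l -/t0 cp /pole polar_tail [X in _ + s * X]mxE.
    rewrite mulr0 addr0 => /eqP; rewrite !mulf_eq0 !subr_eq0 (gt_eqF s12) (gt_eqF t12) /=.
    by move=> /eqP ->; rewrite mxE.
  have p0 : phi i0 z.1 - phi i0 x0 = 0.
    have := chart_disp_norm hX1 r0 rimg z.1; rewrite dp0 normr0 => /esym/eqP.
    rewrite mulf_eq0 subr_eq0 (gt_eqF h12) orbF /chart_height asboolT// mulf_eq0 invr_eq0.
    by rewrite (gt_eqF r0) /= normr_eq0 => /eqP.
  move: cp; rewrite (chart_centre dz p0 v0) (collapse_centre d0 r0).
  exact: pole_neq_antipode.
have [dz|ndz] := pselect (dom i0 z.1); last first.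
  by apply: ncp; rewrite /collapse asboolF.
move: ncp tl tr; rewrite /collapse asboolT// => ncp tl tr.
set u := row_mx (phi i0 z.1) z.2 in ncp tl tr.
have hs : 0 < stereo_scale (zcentre i0 x0) r u.
  rewrite lt_def (stereo_scale_ge0 _ r0) andbT; apply/eqP => h; apply: ncp.
  exact: stereo_scale_eq0.
have uE : u - zcentre i0 x0 = row_mx (phi i0 z.1 - phi i0 x0) z.2 by exact: zcentre_sub.
have p0 : phi i0 z.1 - phi i0 x0 = 0.
  apply/rowP => k; have := tl k.
  rewrite build_l -/t0 /stereo polar_tail uE [(_ *: row_mx _ _) _ _]mxE row_mxEl.
  have -> : dp z.1 0 k = (1 - ht z.1) / r * (phi i0 z.1 - phi i0 x0) 0 k.
    by rewrite (chart_disp_dom x0 r dz) mxE.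
  set q := (phi i0 z.1 - phi i0 x0) 0 k => H; rewrite [RHS]mxE.
  (* The two coefficients cannot cancel, the second being positive off the pole. *)
  have A1 : 0 < (1 - s) * ((1 - t0) * ((1 - ht z.1) / r)) + s * stereo_scale (zcentre i0 x0) r u.
    apply: ltr_wpDl; last exact: mulr_gt0.
    by rewrite !mulr_ge0 ?invr_ge0 ?subr_ge0 ?(ltW r0) ?(ltW c0) ?(ltW J0).
  have : ((1 - s) * ((1 - t0) * ((1 - ht z.1) / r)) + s * stereo_scale (zcentre i0 x0) r u) * q = 0.
    by rewrite -[RHS]H; ring.
  by move/eqP; rewrite mulf_eq0 (gt_eqF A1) => /eqP.
have v0 : z.2 = 0.
  apply/rowP => k; have := tr k.
  rewrite build_r -/t0 /stereo polar_tail uE [(_ *: row_mx _ _) _ _]mxE row_mxEr.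
  have -> : ((c / J) *: z.2) 0 k = c / J * z.2 0 k by rewrite mxE.
  set q := z.2 0 k => H; rewrite [RHS]mxE.
  have A1 : 0 < (1 - s) * ((1 - t0) * (c / J)) + s * stereo_scale (zcentre i0 x0) r u.
    apply: ltr_wpDl; last exact: mulr_gt0.
    by rewrite !mulr_ge0 ?invr_ge0 ?subr_ge0 ?(ltW c0) ?(ltW J0).
  have : ((1 - s) * ((1 - t0) * (c / J)) + s * stereo_scale (zcentre i0 x0) r u) * q = 0.
    by rewrite -[RHS]H; ring.
  by move/eqP; rewrite mulf_eq0 (gt_eqF A1) => /eqP.
have zE := chart_centre dz p0 v0.
have ht0 : ht x0 = 0.
  rewrite /chart_height asboolT; first by rewrite subrr normr0 mulr0.
  by apply: (chart_ballP hX1) => //; rewrite subrr normr0 ltW.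
have zt0 : zeta x0 = 0.
  have h : 0 - (rr + E) <= 0 by have := E0; have := rr0; lra.
  by rewrite /zeta (lm_refl lm) clamp01_le0// pmulr_lle0// invr_gt0.
have t0E : t0 = 0.
  by rewrite /t0 zE /= scaler0 /cutoff normr0 mulr0 ht0 zt0 !maxxx min_r.
move: hd; rewrite t0E zE (collapse_centre d0 r0) polar_head; lra.
Qed.

Lemma stage4 : homotopic pole
  (fun z : Z => nrm (build (dp z.1) ((c / J) *: z.2) (ht z.1) (zeta z.1))) (collapse i0 x0 r).
Proof.
pose F (z : Z) := build (dp z.1) ((c / J) *: z.2) (ht z.1) (zeta z.1).
pose Y (t : R) (z : Z) := (1 - clamp01 t) *: F z + clamp01 t *: collapse i0 x0 r z.
have := @homotopic_off c (J / c + r) Y.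
have -> : (fun z : Z => nrm (Y 0 z)) = (fun z : Z => nrm (F z)).
  by apply/funext => z; rewrite /Y (@clamp01_le0 _ 0)// subr0 scale1r scale0r addr0.
have -> : (fun z : Z => nrm (Y 1 z)) = collapse i0 x0 r.
  apply/funext => z; rewrite /Y (@clamp01_ge1 _ 1)// subrr scale1r scale0r add0r nrm_id//.
  by rewrite /collapse; case: asboolP => _; [exact: stereo_sphere|exact: pole_sphere].
have mixp (t : R) : (1 - clamp01 t) *: pole + clamp01 t *: pole = pole :> 'rV[R]_(N + D).+1.
  by rewrite -scalerDl subrK scale1r.
apply.
- move=> u; have cF : {for u, continuous (fun u : O => F u.2)}.
    apply: (@stage_continuous (fun _ z => dp z.1) (fun _ z => (c / J) *: z.2) (fun _ z => ht z.1) u) => [|h].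
      have cc : {for u, continuous (fun _ : O => c / J)} by exact: cst_continuous.
      exact: continuous_scale cc (@cv0 u).
    split; first exact: (@continuous_comp _ _ _ _ dp u (@cx u) (@cdp _)).
    exact: (@continuous_comp _ _ _ _ ht u (@cx u) (@cht _)).
  have cs : {for u, continuous (fun u : O => u.2)} by exact: cvg_snd.
  have cC : {for u, continuous (fun u : O => collapse i0 x0 r u.2)}.
    exact: (@continuous_comp _ _ _ _ (collapse i0 x0 r) u cs (@collapse_continuous _ _ _ _ hX1 _ _ _ r0 rimg _)).
  exact: continuous_sum2 (continuous_scale (@c1cl u) cF) (continuous_scale (@ccl u) cC).
- by move=> t z; apply: stage4_neq0; exact: clamp01P.
- move=> t x v nK; rewrite /Y /F build_pole; last by right; right; exact: zeta_far.
  rewrite collapse_pole// => dx; apply: le_trans (row_mx_norml _ _) => /=.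
  rewrite leNgt; apply/negP => h; apply: nK; rewrite /core /=.
  suff : ht x < 1 by move/Hrr; have := E0; have := l0; lra.
  rewrite chart_height_clamp// gt_min; apply/orP; right.
  by rewrite mulrC ltr_pdivrMr// mul1r.
- move=> t x v Kx h; rewrite /Y /F build_pole.
    rewrite collapse_pole// => dx; apply: le_trans (row_mx_normr _ _) => /=.
    by apply: ltW; apply: le_lt_trans h; rewrite lerDr divr_ge0// ltW.
  left; rewrite /= normrZ gtr0_norm ?divr_gt0//.
  have h1 : J / c < `|v| by apply: le_lt_trans h; rewrite lerDl ltW.
  have : 1 < c / J * `|v| by rewrite mulrAC ltr_pdivlMr// mul1r mulrC -ltr_pdivrMr.
  by lra.
Qed.

Lemma deformation : homotopic pole (fun z => nrm (approx_map z)) (collapse i0 x0 r).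
Proof.
exact: homotopic_trans (homotopic_trans (homotopic_trans stage1 stage2) stage3) stage4.
Qed.

End Stages.
End Deformation.

Lemma lipschitz_continuous (R : realType) (V W : normedModType R) (f : V -> W) (L : R) :
  0 <= L -> (forall v v', `|f v - f v'| <= L * `|v - v'|) -> continuous f.
Proof.
move=> L0 H v; apply/cvgrPdist_le => e e0; near=> w.
apply: le_trans (H v w) _.
have L1 : 0 < L + 1 by lra.
have h : `|v - w| <= e / (L + 1).
  near: w; apply/nbhs_ballP; exists (e / (L + 1)) => /=; last first.
    by move=> w; rewrite -ball_normE /= => /ltW.
  by apply: divr_gt0 => //; lra.
rewrite ler_pdivlMr// in h; have := normr_ge0 (v - w); nra.
Unshelve. all: by end_near. Qed.

(** In [build_lip] the factor [2 + ...] is at most [4], so the total is one change of [W], nine of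
    [Th], four of [We] and four of [zeta]. As [Th] contributes [4 / l] and [2 * c], this gives
    [40 = 9 * 4 + 4] and [18 = 9 * 2]. *)
Lemma approx_map_lip (R : realType) (N D : nat) (X : riem_data R N) (hX : complete_riemannian X)
  (x0 : X) (l : R) (Th : X -> 'rV[R]_D -> 'rV[R]_D) P (E rr c : R) (W : 'rV[R]_D -> 'rV[R]_N)
  (We : 'rV[R]_D -> R) (L L' : R) (z z' : riem_prod X (euclidean D)) :
  0 < l -> 0 < c -> is_model (@riem_dist R N X) l Th P E -> 0 <= L -> 0 <= L' ->
  (forall v v', `|W v - W v'| <= L * `|v - v'|) -> (forall v, `|W v| <= 1) ->
  (forall v v', `|We v - We v'| <= L' * `|v - v'|) ->
  `|approx_map x0 l Th E rr c W We z - approx_map x0 l Th E rr c W We z'|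
    <= (40 * l^-1 + (18 + L + 4 * L') * c) * riem_dist z z'.
Proof.
move=> l0 c0 md L0 L'0 HW W1 HWe; have [p1 p2] := prod_dist hX.1 z z'.
set rho := riem_dist z z' in p1 p2 *; pose i := l^-1; rewrite -/i.
have i0 : 0 < i by rewrite invr_gt0.
have nc : `|c *: z.2 - c *: z'.2| <= c * rho.
  by rewrite -scalerBr normrZ gtr0_norm// ler_wpM2l// ltW.
have rho0 : 0 <= rho := le_trans (normr_ge0 _) p2.
have hw : `|W (c *: z.2) - W (c *: z'.2)| <= L * (c * rho).
  by apply: le_trans (HW _ _) _; rewrite ler_wpM2l.
have he : `|We (c *: z.2) - We (c *: z'.2)| <= L' * (c * rho).
  by apply: le_trans (HWe _ _) _; rewrite ler_wpM2l.
have hz : `|zeta x0 l E rr z.1 - zeta x0 l E rr z'.1| <= i * rho.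
  by apply: le_trans (zeta_lip hX x0 l0 E rr z.1 z'.1) _; rewrite ler_wpM2l// ltW.
have ht : `|Th z.1 (c *: z.2) - Th z'.1 (c *: z'.2)| <= 4 * (i * rho) + 2 * (c * rho).
  rewrite -(subrKA (Th z'.1 (c *: z.2))); apply: le_trans (ler_normD _ _) _; apply: lerD.
    apply: le_trans (md_lipx md z.1 z'.1 (c *: z.2)) _; rewrite -/i -mulrA.
    by rewrite ler_wpM2l// ler_wpM2l// ltW.
  by apply: le_trans (md_lipv md z'.1 (c *: z.2) (c *: z'.2)) _; rewrite ler_wpM2l.
apply: le_trans (build_lip _ _ _ _ _ _ _ _) _.
set a := `|W _ - _| in hw *; set b := `|Th _ _ - _| in ht *; set e := `|We _ - _| in he *.
set f := `|zeta _ _ _ _ _ - _| in hz *.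
have b0 : 0 <= b := normr_ge0 _; have e0 : 0 <= e := normr_ge0 _; have f0 : 0 <= f := normr_ge0 _.
have g0 : 0 <= 2 * b + e + f by lra.
have g1 : (2 + `|W (c *: z'.2)| + `|Th z'.1 (c *: z'.2)|) * (2 * b + e + f) <= 4 * (2 * b + e + f).
  rewrite ler_wpM2r//; have := W1 (c *: z'.2); have := md_bound md z'.1 (c *: z'.2); lra.
have -> : (40 * i + (18 + L + 4 * L') * c) * rho =
    40 * (i * rho) + 18 * (c * rho) + L * (c * rho) + 4 * (L' * (c * rho)) by ring.
lra.
Qed.

Lemma chart_ball_exists (R : realType) (N : nat) (X : riem_data R N) (hX : is_riemannian X)
  (i : idx X) (x : X) : dom i x ->
  exists2 r : R, 0 < r & forall c, `|c - phi i x| <= r -> img i c.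
Proof.
move=> dx; have /nbhs_ballP[r /= r0 Hr] := img_nbhs hX (imgP dx).
exists (r / 2); first by rewrite divr_gt0.
move=> c hc; apply: Hr; rewrite -ball_normE /= distrC; lra.
Qed.

Theorem theorem5 (R : realType) (N : nat) (X : riem_data R N)
  (hX : complete_riemannian X)
  (hcontr : uniformly_contractible (@riem_dist R N X))
  (hasdim : finite_asdim (@riem_dist R N X)) :
  exists n : nat,
    integrally_hyperspherical (riem_prod X (euclidean n)).
Proof.
have [hX1 hcm] := hX; have lm := riem_length_metric hX1.
have [n [ad _]] := hasdim; exists (n.+1 + n.+1)%N; set D := (n.+1 + n.+1)%N.
have [x0 _] := rm_nonempty hX1; have [i0 d0] := rm_dom_cover hX1 x0.
have [r r0 rimg] := chart_ball_exists hX1 d0.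
have [rr rr0 Hrr] := chart_height_bounded hX1 rimg.
(* The sign [-1] compensates that of [collapse_sign], so that the degree is [1] and not [-1]. *)
have [ori [hori ori0]] : exists ori : idx X -> X -> int, is_orientation ori /\ ori i0 x0 = -1.
  have [ori hori] := orientable hX1 hcontr; have [h1 _ _] := hori.
  case: (h1 i0 x0 d0) => E; last by exists ori.
  by exists (fun i x => - ori i x); split; [exact: orientation_opp|rewrite E].
exists (fun i z => ori i.1 z.1); first exact: prod_orientation.
move=> eps eps0.
(* The Lipschitz constant of [nrm] on vectors of norm at least [1 / 100]. *)
pose C : R := 4 * (N + D).+1%:R * (1 / 100)^-1.
have C0 : 0 < C by rewrite !mulr_gt0// invr_gt0 divr_gt0.
(* Makes the part of slope [40 / l] contribute [eps / 2]; the other half is left for [c]. *)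
pose l : R := 80 * C / eps; have l0 : 0 < l by rewrite divr_gt0// mulr_gt0.
have [Th [P [E md]]] := model_exists lm (rm_second_countable hX1) (rm_nonempty hX1) hcontr ad l0.
have [J J0 HJ] := md_pos md (@core_compact _ _ _ hX x0 l E rr).
have cdp := @chart_disp_continuous _ _ _ hX1 i0 x0 r r0 rimg.
have cht := @chart_height_continuous _ _ _ hX1 i0 x0 r r0 rimg.
have clow := @low_compact _ _ _ _ hX x0 l Th P E md rr J J0 (fun x v k => HJ x v k).
have h32 : 0 < 1 / 32 :> R by rewrite divr_gt0.
have h32' : 1 / 32 <= 1 :> R by lra.
have ht1 x : `|chart_height i0 x0 r x| <= 1.
  by have /andP[h1 h2] := chart_height01 hX1 r0 rimg x; rewrite ger0_norm.
have dp1 x : `|chart_disp i0 x0 r x| <= 1.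
  have /andP[h1 h2] := chart_height01 hX1 r0 rimg x.
  by rewrite (chart_disp_norm hX1 r0 rimg); nra.
have [L [W [L0 HW1 HW2 HW3]]] := lipschitz_approx_rV clow
  (fun v lv e e0 => @shadow_near _ _ _ _ x0 l Th P E md rr _ _ v cdp lv e e0) (fun v _ => dp1 _) h32 h32'.
have [L' [We [L'0 HWe1 HWe2 HWe3]]] := lipschitz_approx clow
  (fun v lv e e0 => @shadow_near _ _ _ _ x0 l Th P E md rr _ _ v cht lv e e0) (fun v _ => ht1 _) h32 h32'.
pose B : R := 18 + L + 4 * L'; have B0 : 0 < B by rewrite /B; lra.
(* [L] and [L'] depend on [l], so [c] can only be chosen now. *)
pose c : R := eps / (2 * C * B); have c0 : 0 < c by rewrite divr_gt0// !mulr_gt0.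
have hom := deformation hX d0 r0 rimg l0 md rr0 Hrr J0 HJ c0
  (lipschitz_continuous L0 HW1) (lipschitz_continuous L'0 HWe1) HW2 HWe2.
have nY z := approx_map_norm hX r0 rimg l0 md Hrr c HW2 HWe2 z.
exists (fun z => nrm (approx_map x0 l Th E rr c W We z)), pole; split.
- by move=> z; apply: nrm_sphere; exact: norm_neq0 (nY z).
- exact: pole_sphere.
- exact: homotopic_continuous hom.
- have k0 : 0 < 1 / 100 :> R by rewrite divr_gt0.
  move=> z z'; apply: le_trans (nrm_dist k0 (nY z) (nY z')) _.
  have hlip := @approx_map_lip _ _ _ _ hX x0 _ _ _ _ rr _ _ _ _ _ z z' l0 c0 md L0 L'0 HW1 HW3 HWe1.
  rewrite -/C; apply: (le_trans (ler_wpM2l (ltW C0) hlip)).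
  rewrite mulrA -/B (_ : C * (40 * l^-1 + B * c) = eps)// /l /c; field.
  by rewrite !gt_eqF.
- exact: collapse_degree hom.
Qed.
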